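(* Let $M$ be a compact smooth manifold of dimension $d$, and for $g_0,g_1\in\operatorname{Met}(M)$ let $$\mathcal D^{\mathrm{KL}\text{-}\mathrm{Met}}(g_0\|g_1)=\frac12\int_M\Big(\operatorname{tr}(g_1^{-1}g_0)-2\log\Big(\frac{\operatorname{vol}(g_0)}{\operatorname{vol}(g_1)}\Big)-d\Big)\operatorname{vol}(g_1).$$ Then: (1) $\mathcal D^{\mathrm{KL}\text{-}\mathrm{Met}}:\operatorname{Met}(M)\times\operatorname{Met}(M)\to\mathbb R$ is a divergence function in the sense of information geometry. (2) The Riemannian metric induced by $\mathcal D^{\mathrm{KL}\text{-}\mathrm{Met}}$ is a multiple of the Ebin metric; more precisely, for $g\in\operatorname{Met}(M)$ and $h,k\in T_g\operatorname{Met}(M)$, $$G_g(h,k)=-\frac{\partial^2}{\partial s\,\partial t}\mathcal D^{\mathrm{KL}\text{-}\mathrm{Met}}(g+sh\|g+tk)\Big|_{s=t=0}=\frac12\int_M\operatorname{tr}(g^{-1}h\,g^{-1}k)\operatorname{vol}(g).$$ (3) The divergence descends via the volume map $\pi_1:\operatorname{Met}(M)\to\operatorname{Dens}(M)$, $\pi_1(g)=\operatorname{vol}(g)$, to the $f$-divergence $$\widehat{\mathcal D}^{\mathrm{KL}\text{-}\mathrm{Dens}}(\rho_0\|\rho_1):=\inf_{\substack{g_0,g_1\in\operatorname{Met}(M)\\ \operatorname{vol}(g_0)=\rho_0,\ \operatorname{vol}(g_1)=\rho_1}}\mathcal D^{\mathrm{KL}\text{-}\mathrm{Met}}(g_0\|g_1),$$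 which is given by $$\widehat{\mathcal D}^{\mathrm{KL}\text{-}\mathrm{Dens}}(\rho_0\|\rho_1)=\int_Mf_d\Big(\frac{\rho_0}{\rho_1}\Big)\rho_1,\qquad f_d(r)=\frac12\big(d\,r^{2/d}-2\log r-d\big).$$ For $d=2$ this becomes $\widehat{\mathcal D}^{\mathrm{KL}\text{-}\mathrm{Dens}}(\rho_0\|\rho_1)=\int_M(r-\log r-1)\rho_1$ with $r=\rho_0/\rho_1$, the $f$-divergence associated with the Burg/Itakura--Saito generator.
   Context: $\operatorname{Met}(M)$ is the space of smooth Riemannian metrics on $M$ with $T_g\operatorname{Met}(M)=\Gamma^\infty(\operatorname{Sym}^2T^*M)$; $\operatorname{Dens}(M)$ is the space of smooth positive densities; $\operatorname{vol}(g)$ is the volume density of $g$; metrics are regarded as maps $TM\to T^*M$, so $g_1^{-1}g_0\in\Gamma(\operatorname{End}(TM))$. The Ebin metric is $G^{\mathrm E}_g(h,k)=\int_M\operatorname{tr}(g^{-1}hg^{-1}k)\operatorname{vol}(g)$. A divergence function (in the sense of information geometry) on a space $\mathcal X$ is a smooth function $\mathcal D(\cdot\|\cdot):\mathcal X\times\mathcal X\to\mathbb R$ which is nonnegative, vanishes if and only if its two arguments coincide, and whose first derivatives (in each argument) vanish on the diagonal. *)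

(* Defs.v *)
From HB Require Import structures.
From mathcomp Require Export all_boot all_order all_algebra.
From mathcomp Require Export all_classical all_reals all_analysis.

Export Order.TTheory GRing.Theory Num.Theory.
Export numFieldNormedType.Exports.

#[export] Set Implicit Arguments.
#[export] Unset Strict Implicit.
#[export] Unset Printing Implicit Defensive.

Global Open Scope classical_set_scope.
Global Open Scope ring_scope.

Section Euclidean.
Context {R : realType}.

(* iter_partial [:: a1; ...; ak] f is d_a1 (... (d_ak f)). *)
Fixpoint iter_partial {d : nat} (s : seq 'I_d) (f : 'rV[R]_d -> R) :
    'rV[R]_d -> R :=
  if s is a :: s' then fun y => 'D_(delta_mx 0 a) (iter_partial s' f) y else f.

(* C^oo on U, for open U (iterated partials exist and are continuous), where derivatives at a point of U do not
   depend on the values of f outside U. *)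
Definition smooth_on {d : nat} (U : set 'rV[R]_d) (f : 'rV[R]_d -> R) : Prop :=
  forall (s : seq 'I_d) (y : 'rV[R]_d), U y ->
    {for y, continuous (iter_partial s f)} /\
    forall a : 'I_d, derivable (iter_partial s f) y (delta_mx 0 a).

(* The Lebesgue integral on R^d as an iterated one-dimensional integral; it is
   applied below only to continuous functions with compact support, where
   Fubini's theorem makes the two agree. *)
Fixpoint integral_Rn (d : nat) : ('rV[R]_d -> R) -> R :=
  match d with
  | 0 => fun f => f 0
  | n.+1 => fun f => \int[lebesgue_measure]_(x in [set: R])
      integral_Rn (fun y : 'rV[R]_n => f (row_mx (x%:M : 'rV[R]_1) y))
  end.

End Euclidean.

(* A smooth d-dimensional manifold structure (without boundary) on M.
   The fields cmap i and cinv i are total functions that only matter on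
   cdom i and on its image. *)
Record smooth_atlas (R : realType) (M : topologicalType) (d : nat) :=
  SmoothAtlas {
  cidx : choiceType;
  cdom : cidx -> set M;
  cmap : cidx -> M -> 'rV[R]_d;
  cinv : cidx -> 'rV[R]_d -> M;
  cdom_open : forall i, open (cdom i);
  crange_open : forall i, open (cmap i @` cdom i);
  cmapK : forall i x, cdom i x -> cinv i (cmap i x) = x;
  cmap_continuous : forall i, {within cdom i, continuous (cmap i)};
  cinv_continuous : forall i, {within cmap i @` cdom i, continuous (cinv i)};
  cdom_cover : forall x, exists i, cdom i x;
  transition_smooth : forall i j (a : 'I_d),
    smooth_on (cmap i @` (cdom i `&` cdom j))
      (fun y => cmap j (cinv i y) 0 a)
}.

Arguments cidx {R M d} _.
Arguments cdom {R M d} _ _.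
Arguments cmap {R M d} _ _ _.
Arguments cinv {R M d} _ _ _.

Section Manifold.
Context {R : realType} {M : topologicalType} {d : nat}.
Variable A : smooth_atlas R M d.

Definition crange (i : cidx A) : set 'rV[R]_d := cmap A i @` cdom A i.

(* Row-vector convention of 'J: a tangent vector at x with components v in
   chart i has components v *m transition_jac i j x in chart j. *)
Definition transition_jac (i j : cidx A) (x : M) : 'M[R]_d :=
  jacobian (fun y => cmap A j (cinv A i y)) (cmap A i x).

(* Tensor fields and densities are families of chart components; the value
   of a field outside the chart domain is normalized to 0 in Sym2 and Dens, so
   that Leibniz equality of families is equality of fields. *)
Definition tensor_field : Type := cidx A -> M -> 'M[R]_d.
Definition density_field : Type := cidx A -> M -> R.

(* Gamma^oo(Sym^2 T^*M) *)
Definition Sym2 : set tensor_field := [set h |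
  [/\ forall i x, cdom A i x -> (h i x)^T = h i x,
      forall i j x, cdom A i x -> cdom A j x ->
        h i x = transition_jac i j x *m h j x *m (transition_jac i j x)^T,
      forall i a b, smooth_on (crange i) (fun y => h i (cinv A i y) a b) &
      forall i x, ~ cdom A i x -> h i x = 0]].

Definition Met : set tensor_field := [set g | Sym2 g /\
  forall i x, cdom A i x -> forall v : 'rV[R]_d, v != 0 ->
    0 < (v *m g i x *m v^T) 0 0].

Definition Dens : set density_field := [set rho |
  [/\ forall i x, cdom A i x -> 0 < rho i x,
      forall i j x, cdom A i x -> cdom A j x ->
        rho i x = `|\det (transition_jac i j x)| * rho j x,
      forall i, smooth_on (crange i) (fun y => rho i (cinv A i y)) &
      forall i x, ~ cdom A i x -> rho i x = 0]].

Definition vol (g : tensor_field) : density_field :=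
  fun i x => Num.sqrt (\det (g i x)).

Definition partition_of_unity (s : seq (cidx A * (M -> R))) : Prop :=
  [/\ forall p, p \in s ->
        [/\ forall x, 0 <= p.2 x,
            forall j, smooth_on (crange j) (fun y => p.2 (cinv A j y)) &
            closure [set x | p.2 x != 0] `<=` cdom A p.1] &
      forall x, \sum_(p <- s) p.2 x = 1].

(* Some finite smooth partition of unity subordinate to the atlas; one exists
   when M is compact and Hausdorff. *)
Definition pou : seq (cidx A * (M -> R)) :=
  if pselect (exists s, partition_of_unity s) is left e
  then projT1 (cid e) else [::].

(* Integral over M of a density; by the change of variables formula it does not
   depend on the partition of unity chosen. *)
Definition integral_dens (rho : density_field) : R :=
  \sum_(p <- pou) integral_Rn
    ((fun y => p.2 (cinv A p.1 y) * rho p.1 (cinv A p.1 y)) \_ (crange p.1)).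

(* Basic 0-neighbourhoods of the C^oo topology on tensor fields: all partial
   derivatives of order <= n of the components in the charts i \in s are < e on
   the compact sets K i. *)
Definition Cinf_small (n : nat) (s : seq (cidx A))
    (K : cidx A -> set 'rV[R]_d) (e : R) : set tensor_field :=
  [set h | forall i, i \in s -> forall y, K i y ->
    forall l : seq 'I_d, (size l <= n)%N -> forall a b,
      `|iter_partial l (fun z => h i (cinv A i z) a b) y| < e].

Definition Cinf_nbhs0 (N : set tensor_field) : Prop :=
  exists n s K e, [/\ 0 < e,
    forall i, compact (K i) /\ K i `<=` crange i &
    N = Cinf_small n s K e].

(* Iterated directional derivative d^k F(p; v1, ..., vk). *)
Fixpoint iter_dderiv (vs : seq (tensor_field * tensor_field))
    (F : tensor_field * tensor_field -> R) : tensor_field * tensor_field -> R :=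
  if vs is v :: vs'
  then fun p => derive1 (fun t : R => iter_dderiv vs' F (p + t *: v)) 0
  else F.

Definition Sym2xSym2 : set (tensor_field * tensor_field) := Sym2 `*` Sym2.

(* F is smooth on X x X, for X open in the Frechet space Sym2: all the iterated
   directional derivatives exist and are jointly continuous in the base point
   and the directions (Hamilton, Michal-Bastiani). *)
Definition smooth_functional (X : set tensor_field)
    (F : tensor_field * tensor_field -> R) : Prop :=
  forall (vs : seq (tensor_field * tensor_field)) p,
    (forall v, v \in vs -> Sym2xSym2 v) -> (X `*` X) p ->
    (forall v, Sym2xSym2 v ->
       derivable (fun t : R => iter_dderiv vs F (p + t *: v)) 0 1) /\
    (forall e : R, 0 < e -> exists2 N, Cinf_nbhs0 N &
       forall ws q, size ws = size vs ->
         (forall w, w \in ws -> Sym2xSym2 w) ->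
         (X `*` X) q -> (N `*` N) (q - p) ->
         (forall k, (k < size ws)%N -> (N `*` N) (nth 0 ws k - nth 0 vs k)) ->
         `|iter_dderiv ws F q - iter_dderiv vs F p| < e).

Definition divergence_function (X : set tensor_field)
    (D : tensor_field -> tensor_field -> R) : Prop :=
  [/\ smooth_functional X (fun p => D p.1 p.2),
      forall g0 g1, X g0 -> X g1 -> 0 <= D g0 g1,
      forall g0 g1, X g0 -> X g1 -> (D g0 g1 = 0 <-> g0 = g1) &
      forall g h, X g -> Sym2 h ->
        is_derive (0 : R) (1 : R) (fun t : R => D (g + t *: h) g) 0 /\
        is_derive (0 : R) (1 : R) (fun t : R => D g (g + t *: h)) 0].

(* The mixed derivative exists for a smooth D, so derive1 is not a junk value. *)
Definition induced_metric (D : tensor_field -> tensor_field -> R)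
    (g h k : tensor_field) : R :=
  - derive1 (fun s : R =>
      derive1 (fun t : R => D (g + s *: h) (g + t *: k)) 0) 0.

(* G^E_g(h, k); the components of g^-1 h in chart i are invmx (g i x) *m h i x. *)
Definition ebin_metric (g h k : tensor_field) : R :=
  integral_dens (fun i x =>
    \tr (invmx (g i x) *m h i x *m invmx (g i x) *m k i x) * vol g i x).

(* Both factors of the integrand are written in one chart: the trace and the
   ratio of the volume densities do not depend on the chart. *)
Definition KL_Met (g0 g1 : tensor_field) : R :=
  2^-1 * integral_dens (fun i x =>
    (\tr (invmx (g1 i x) *m g0 i x)
     - 2 * ln (vol g0 i x / vol g1 i x) - d%:R) * vol g1 i x).

(* Extended-real infimum: no junk value on an empty or unbounded set. *)
Definition KL_Dens (rho0 rho1 : density_field) : \bar R :=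
  ereal_inf [set (KL_Met gg.1 gg.2)%:E | gg in
    [set gg : tensor_field * tensor_field |
      [/\ Met gg.1, Met gg.2, vol gg.1 = rho0 & vol gg.2 = rho1]]].

Definition f_divergence (f : R -> R) (rho0 rho1 : density_field) : R :=
  integral_dens (fun i x => f (rho0 i x / rho1 i x) * rho1 i x).

End Manifold.

Arguments Sym2 {R M d} A _.
Arguments Met {R M d} A _.
Arguments Dens {R M d} A _.
Arguments KL_Met {R M d} A _ _.
Arguments vol {R M d A} _ _ _.

Definition f_KL {R : realType} (d : nat) (r : R) : R :=
  2^-1 * (d%:R * r `^ (2 / d%:R) - 2 * ln r - d%:R).

(* Main.v *)
From HB Require Import structures.
Require Import Defs.
From mathcomp Require Import ring lra.

(** Pointwise, with G1 = C C^T and S = C^-1 G0 C^-T = L L^T (Cholesky), the integrand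
is governed by tr S = sum_ij L_ij^2 and det S = prod_i L_ii^2.  Applying ln x <= x - 1 to
L_ii^2 / c gives d + ln det S - d ln c <= tr S / c for every c > 0.  The choice c = 1 is
nonnegativity, with equality only for S = 1; the choice c = r^(2/d), where r is the ratio of
the volume densities, is the lower bound d r^(2/d) <= tr (G1^-1 G0), attained exactly when
g0 is conformal to g1.  Rescaling any metric conformally realizes every pair of densities by
such a pair of metrics, so the infimum is the f-divergence.

For smoothness, the integrand is L(g0(y), g1(y)) in each chart for a fixed smooth function L
on an open set of pairs of matrices, and the iterated derivatives of the functional are
integrals of the iterated derivatives of L, by uniform estimates on the compact supports of the
partition of unity.  The mixed second derivative of L at (G, G) follows from Jacobi's formula. *)

(** The smoothness claim shapes the proof. [smooth_functional] differentiates along lines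
    [p + t *: v] and nests these derivatives, so a formula for the k-th derivative must hold at all
    base points near [p] on such lines, not only at [p]. The induction therefore runs over [regular]
    pairs: on the compact chart supports they are continuous with positive determinants, a condition
    that persists along each line for small t by the tube lemma. [integral_Rn] is a bare recursion
    over one-dimensional integrals; it is controlled on continuous functions vanishing outside a
    fixed box, and limits pass through it by sup-norm estimates weighted with the volume of the box.

    On the matrix side, c = r^(2/d) maximizes c (d + 2 ln r - d ln c), the lower bound for the trace
    that the logarithmic inequality yields once ln det S = 2 ln r; the result is the inequality of
    arithmetic and geometric means for the eigenvalues of S, with the squared Cholesky diagonal
    standing in for the eigenvalues. *)

Section MatrixNorm.
Context {R : realType}.

Lemma coord_le_norm m n (v : 'M[R]_(m, n)) i j : `|v i j| <= `|v|.
Proof.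
by rewrite [leRHS]/Num.Def.normr/= mx_normrE; apply: (le_bigmax _ _ (i, j)).
Qed.

Lemma mx_norm_le m n (v : 'M[R]_(m, n)) (e : R) : 0 <= e ->
  (forall i j, `|v i j| <= e) -> `|v| <= e.
Proof.
move=> e0 ve; rewrite [leLHS]/Num.Def.normr/= mx_normrE.
by apply: bigmax_le => // -[i j] _; apply: ve.
Qed.

Lemma cvg_mx_coord (T : Type) (F : set_system T) (FF : Filter F) m n
    (f : T -> 'M[R]_(m, n)) (l : 'M[R]_(m, n)) :
  (forall i j, f x i j @[x --> F] --> l i j) -> f x @[x --> F] --> l.
Proof.
move=> fl; apply/cvgrPdist_le => e e0.
have : \forall x \near F, forall ij : 'I_m * 'I_n, `|l ij.1 ij.2 - f x ij.1 ij.2| <= e.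
  apply: filter_forall => -[i j] /=.
  by have /cvgrPdist_le/(_ e e0) := fl i j.
apply: filterS => x fx; apply: mx_norm_le; first exact: ltW.
by move=> i j; have := fx (i, j); rewrite !mxE.
Qed.

Lemma near0_norm_lt m n (r : R) : 0 < r ->
  \forall h \near (0 : 'M[R]_(m, n)), `|h| < r.
Proof.
move=> r0; apply/nbhs_ballP; exists r => // h.
by rewrite -ball_normE /= sub0r normrN.
Qed.

Lemma compact_norm_le n (B : R) : compact [set y : 'rV[R]_n | `|y| <= B].
Proof.
apply: bounded_closed_compact.
  by exists B; split; [apply: num_real|move=> x Bx y /= /le_trans; apply; apply: ltW].
apply: (@closed_comp _ _ (fun y : 'rV[R]_n => `|y|) [set r | r <= B]).
  by move=> y _; apply: norm_continuous.
exact: closed_le.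
Qed.

End MatrixNorm.

(** The tube lemma in filter form: an eventual property that is locally uniform in x becomes uniform
    over K. The estimates over chart supports rest on it. *)
Lemma compact_near_uniform (X : topologicalType) (K : set X) (I : Type)
    (F : set_system I) (FF : Filter F) (P : I -> X -> Prop) :
  compact K -> (forall x, K x -> \forall x' \near x & i \near F, P i x') ->
  \forall i \near F, forall x, K x -> P i x.
Proof. by move=> /compact_near_coveringP cK; apply: cK. Qed.



(* [compact_cover] needs a pointed space. *)
Lemma compact_finite_cover (X : topologicalType) (K : set X) (f : X -> set X) :
  compact K -> (forall x, K x -> nbhs x (f x)) ->
  exists s : seq {classic X}, forall x, K x -> exists2 z, z \in s & f z x.
Proof.
move=> cK fK.
(* Finite lists directed by inclusion: being covered by s is eventual along F, so the tube lemma
   returns one list that serves all of K. *)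
pose F := filter_from [set: seq {classic X}]
  (fun s0 => [set s : seq {classic X} | {subset s0 <= s}]).
have FF : Filter F.
  apply: filter_from_filter; first by exists [::].
  move=> s1 s2 _ _; exists (s1 ++ s2) => // s /= ss.
  by split=> z zs; apply: ss; rewrite mem_cat zs ?orbT.
have [|s0 _ s0K] := @compact_near_uniform X K _ F FF
    (fun s x => exists2 z, z \in s & f z x) cK.
  move=> x Kx; exists (f x, [set s : seq {classic X} | x \in s]).
    split; first exact: fK.
    by exists [:: (x : {classic X})] => // s /= ss; apply: ss; rewrite mem_head.
  by move=> [y s] [/= fxy xs]; exists x.
by exists s0; apply: s0K => z.
Qed.

Section CvgBig.
Context {R : realType}.

Lemma cvg_sumr (T I : Type) (F : set_system T) (FF : Filter F) (r : seq I) (P : pred I)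
    (f : I -> T -> R) (l : I -> R) :
  (forall i, P i -> f i x @[x --> F] --> l i) ->
  \sum_(i <- r | P i) f i x @[x --> F] --> \sum_(i <- r | P i) l i.
Proof. by apply: cvg_big; apply: add_continuous. Qed.

End CvgBig.

(** * Smooth functions on open subsets of R^d *)

Section SmoothFunctions.
Context {R : realType} {d : nat}.
Implicit Types (U V : set 'rV[R]_d) (f g : 'rV[R]_d -> R) (a : 'I_d).

Definition partial a f : 'rV[R]_d -> R := fun y => 'D_(delta_mx 0 a) f y.

Definition has_partials U f := forall y, U y ->
  {for y, continuous f} /\ forall a, derivable f y (delta_mx 0 a).

(** The order n is the induction variable for the closure properties; [smooth_on] quantifies over
    all words of partials at once. Already [Ck 0] asks for the partials to exist, so every level can
    be differentiated once more. *)
Fixpoint Ck (n : nat) U f : Prop :=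
  has_partials U f /\ if n is m.+1 then forall a, Ck m U (partial a f) else True.

Lemma Ck_has_partials n U f : Ck n U f -> has_partials U f.
Proof. by case: n => [|n] []. Qed.

Lemma Ck_pred n U f : Ck n.+1 U f -> Ck n U f.
Proof.
elim: n f => [|n IH] f [fU pf]; first by split.
by split=> // a; apply: IH; apply: pf.
Qed.

Lemma iter_partial_rcons s a f :
  iter_partial (rcons s a) f = iter_partial s (partial a f).
Proof. by elim: s => //= b s ->. Qed.

Lemma smooth_on_partial U f a : smooth_on U f -> smooth_on U (partial a f).
Proof. by move=> fU s y Uy; rewrite -iter_partial_rcons; apply: fU. Qed.

Lemma smooth_onP U f : smooth_on U f <-> forall n, Ck n U f.
Proof.
split=> [fU n|fU s y Uy].
  elim: n f fU => [|n IH] f fU; split=> //; first by move=> y; apply: (fU [::]).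
    by move=> y; apply: (fU [::]).
  by move=> a; apply: IH; apply: smooth_on_partial.
have {fU} := fU (size s).
elim/last_ind: s f => [|s a IH] f; first by case=> /(_ _ Uy).
by rewrite size_rcons iter_partial_rcons => -[_ /(_ a)]; apply: IH.
Qed.

Lemma smooth_on_has_partials U f : smooth_on U f -> has_partials U f.
Proof. by move/smooth_onP/(_ 0%N)/Ck_has_partials. Qed.

Lemma smooth_on_continuous U f y : smooth_on U f -> U y -> {for y, continuous f}.
Proof. by move=> /smooth_on_has_partials fU /fU[]. Qed.

Lemma open_near_eq U f g y : open U -> U y -> (forall z, U z -> f z = g z) ->
  \forall z \near y, f z = g z.
Proof.
move=> oU Uy fg.
by near=> z; apply: fg; near: z; apply: open_nbhs_nbhs.
Unshelve. all: by end_near. Qed.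

Lemma near_eq_continuous f g (y : 'rV[R]_d) : (\forall z \near y, f z = g z) ->
  {for y, continuous f} -> {for y, continuous g}.
Proof.
move=> fg cf; rewrite /prop_for /continuous_at -(nbhs_singleton fg).
by apply: cvg_trans cf; apply: (@near_eq_cvg _ _ (nbhs y)).
Qed.

Lemma has_partials_ext U f g : open U -> (forall z, U z -> f z = g z) ->
  has_partials U f -> has_partials U g.
Proof.
move=> oU fg fU y Uy; have [cf df] := fU y Uy.
have nfg := open_near_eq oU Uy fg.
split=> [|a]; first exact: near_eq_continuous nfg cf.
exact: near_eq_derivable nfg (df a).
Qed.

Lemma Ck_ext n U f g : open U -> (forall z, U z -> f z = g z) ->
  Ck n U f -> Ck n U g.
Proof.
move=> oU; elim: n f g => [|n IH] f g fg [fU pf].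
  by split=> //; apply: has_partials_ext fU.
split=> [|a]; first exact: has_partials_ext fU.
apply: (IH (partial a f)); last exact: pf.
move=> z Uz; by apply: near_eq_derive; apply: open_near_eq Uz fg.
Qed.

(** Allows the partial derivatives to be named by a formula [df] valid on U only. As U is open, the
    formula determines [partial a f] near each of its points. *)
Lemma Ck_intro n U f (df : 'I_d -> 'rV[R]_d -> R) : open U ->
  (forall y, U y -> {for y, continuous f}) ->
  (forall y a, U y -> is_derive y (delta_mx 0 a) f (df a y)) ->
  (forall a m, n = m.+1 -> Ck m U (df a)) ->
  Ck n U f.
Proof.
move=> oU cf fdf Cdf.
have fU : has_partials U f.
  by move=> y Uy; split=> [|a]; [apply: cf|have := fdf y a Uy].
case: n Cdf => [|n] Cdf; split=> // => a.
apply: (@Ck_ext _ _ (df a)) => //; last exact: Cdf.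
by move=> z Uz; rewrite /partial; have /@derive_val := fdf z a Uz.
Qed.

Lemma Ck_is_derive n U f y a : Ck n U f -> U y ->
  is_derive y (delta_mx 0 a) f (partial a f y).
Proof. by move=> /Ck_has_partials fU /fU[_ df]; apply: derivableP. Qed.

Lemma Ck_continuous n U f y : Ck n U f -> U y -> {for y, continuous f}.
Proof. by move=> /Ck_has_partials fU /fU[]. Qed.

Lemma Ck_cst n U (c : R) : open U -> Ck n U (cst c).
Proof.
move=> oU; elim: n c => [|n IH] c; apply: (Ck_intro (df := fun _ => cst 0)) => //.
- by move=> y _; apply: cst_continuous.
- by move=> y _; apply: cst_continuous.
- by move=> a m [<-]; apply: IH.
Qed.

Lemma Ck_add n U f g : open U -> Ck n U f -> Ck n U g ->
  Ck n U (fun y => f y + g y).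
Proof.
move=> oU; elim: n f g => [|n IH] f g Cf Cg;
  apply: (Ck_intro (df := fun a y => partial a f y + partial a g y)) => //.
- by move=> y Uy; apply: continuousD (Ck_continuous Cf Uy) (Ck_continuous Cg Uy).
- by move=> y a Uy; apply: is_deriveD (Ck_is_derive a Cf Uy) (Ck_is_derive a Cg Uy).
- by move=> y Uy; apply: continuousD (Ck_continuous Cf Uy) (Ck_continuous Cg Uy).
- by move=> y a Uy; apply: is_deriveD (Ck_is_derive a Cf Uy) (Ck_is_derive a Cg Uy).
- by move=> a m [<-]; apply: IH; [apply: Cf.2|apply: Cg.2].
Qed.

Lemma Ck_mul n U f g : open U -> Ck n U f -> Ck n U g ->
  Ck n U (fun y => f y * g y).
Proof.
move=> oU; elim: n f g => [|n IH] f g Cf Cg;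
  apply: (Ck_intro (df := fun a y => f y * partial a g y + g y * partial a f y)) => //.
- by move=> y Uy; apply: continuousM (Ck_continuous Cf Uy) (Ck_continuous Cg Uy).
- by move=> y a Uy; apply: is_deriveM (Ck_is_derive a Cf Uy) (Ck_is_derive a Cg Uy).
- by move=> y Uy; apply: continuousM (Ck_continuous Cf Uy) (Ck_continuous Cg Uy).
- by move=> y a Uy; apply: is_deriveM (Ck_is_derive a Cf Uy) (Ck_is_derive a Cg Uy).
- move=> a m [<-]; apply: Ck_add => //; apply: IH.
  + exact: Ck_pred.
  + exact: Cg.2.
  + exact: Ck_pred.
  + exact: Cf.2.
Qed.

Lemma is_derive_coord (y v : 'rV[R]_d) b :
  is_derive y v (fun z : 'rV[R]_d => z 0 b) (v 0 b).
Proof.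
have dc := @differentiable_coord R 1 d y 0 b.
split; first exact: diff_derivable.
have := @derive_mx R _ 1 d (@id 'rV[R]_d) y v (@derivable_id _ _ y v).
by rewrite derive_id => /matrixP/(_ 0 b); rewrite mxE => ->.
Qed.

Lemma Ck_coord n U b : open U -> Ck n U (fun y => y 0 b).
Proof.
move=> oU; apply: (Ck_intro (df := fun a => cst ((delta_mx 0 a : 'rV[R]_d) 0 b))) => //.
- by move=> y _; apply: coord_continuous.
- by move=> y a _; apply: is_derive_coord.
- by move=> a m _; apply: Ck_cst.
Qed.

Lemma is_derive_line f (y v : 'rV[R]_d) (l : R) :
  is_derive (0 : R) (1 : R) (fun t : R => f (y + t *: v)) l <-> is_derive y v f l.
Proof.
have E : (fun h : R => h^-1 *: (((fun t : R => f (y + t *: v)) \o shift 0) (h *: 1)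
      - f (y + 0 *: v))) = (fun h => h^-1 *: ((f \o shift y) (h *: v) - f y)).
  rewrite funeqE => h /=; rewrite addr0 scale0r addr0 [_%:A]mulr1. by rewrite (addrC y).
by split=> -[df dE]; split; move: df dE; rewrite /derivable /derive E.
Qed.

Lemma is_derive_comp (h : R -> R) f (y v : 'rV[R]_d) (l m : R) :
  is_derive (f y) 1 h m -> is_derive y v f l -> is_derive y v (h \o f) (m * l).
Proof.
move=> hm /is_derive_line fl; apply/is_derive_line.
apply: (@is_derive1_comp R h (fun t => f (y + t *: v)) 0 m l) => //.
by rewrite scale0r addr0.
Qed.

(** By the chain rule the partials of [h j \o f] are [h' j \o f] times those of f, so an induction
    on n closes once the derivatives [h'] are controlled by the family [h] itself. A one-element
    family suffices for the inverse, [ln] and [expR]; the flat function needs the infinite family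
    [bump]. *)
Lemma Ck_comp_intro (J : Type) (h h' : J -> R -> R) U f :
  open U ->
  (forall j y, U y -> is_derive (f y) (1 : R) (h j) (h' j (f y))) ->
  (forall n, Ck n U f -> (forall j, Ck n U (h j \o f)) ->
     forall j, Ck n U (h' j \o f)) ->
  forall n j, Ck n U f -> Ck n U (h j \o f).
Proof.
move=> oU hh' Ch'.
have chC n j y : Ck n U f -> U y -> {for y, continuous (h j \o f)}.
  move=> Cf Uy; apply: continuous_comp; first exact: Ck_continuous Cf Uy.
  have [+ _] := hh' j y Uy.
  by move/derivable1_diffP; apply: differentiable_continuous.
have chD n j y a : Ck n U f -> U y ->
    is_derive y (delta_mx 0 a) (h j \o f) (h' j (f y) * partial a f y).
  move=> Cf Uy; apply: is_derive_comp; first exact: hh'.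
  exact: Ck_is_derive Cf Uy.
elim=> [|n IH] j Cf; apply: (Ck_intro (df := fun a y => h' j (f y) * partial a f y)) => //.
- by move=> y; apply: (chC _ _ _ Cf).
- by move=> y a; apply: (chD _ _ _ _ Cf).
- by move=> y; apply: (chC _ _ _ Cf).
- by move=> y a; apply: (chD _ _ _ _ Cf).
- move=> a m [<-]; apply: Ck_mul => //; last exact: Cf.2.
  by apply: (Ch' n); [|move=> k; apply: IH]; apply: Ck_pred.
Qed.

Lemma Ck_inv n U f : open U -> (forall y, U y -> f y != 0) ->
  Ck n U f -> Ck n U (fun y => (f y)^-1).
Proof.
move=> oU f0.
apply: (@Ck_comp_intro unit (fun _ => @GRing.inv R) (fun _ x => - x ^- 2)) => //.
  move=> _ y Uy.
  have := @is_deriveV R id (f y) 1 1 (f0 y Uy) (is_derive_id _ _).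
  by rewrite [_%:A]mulr1.
move=> m Cf Cif _; apply: (@Ck_ext _ _ (fun y => -1 * ((f y)^-1 * (f y)^-1))) => //.
  by move=> z _; rewrite /= mulN1r -expr2 exprVn.
by apply: Ck_mul; [|apply: Ck_cst|apply: Ck_mul => //; apply: (Cif tt)].
Qed.

Lemma Ck_ln n U f : open U -> (forall y, U y -> 0 < f y) ->
  Ck n U f -> Ck n U (fun y => ln (f y)).
Proof.
move=> oU f0.
apply: (@Ck_comp_intro unit (fun _ => @ln R) (fun _ x => x^-1)) => //.
  by move=> _ y Uy; apply: is_derive1_ln; apply: f0.
move=> m Cf _ _; apply: Ck_inv => // y /f0; exact: lt0r_neq0.
Qed.

Lemma Ck_expR n U f : open U -> Ck n U f -> Ck n U (fun y => expR (f y)).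
Proof.
move=> oU.
exact: (@Ck_comp_intro unit (fun _ => @expR R) (fun _ => @expR R)).
Qed.

Section Closure.
Variable U : set 'rV[R]_d.
Hypothesis oU : open U.

Lemma smooth_on_ext f g : (forall y, U y -> f y = g y) ->
  smooth_on U f -> smooth_on U g.
Proof. by move=> fg /smooth_onP Cf; apply/smooth_onP => n; apply: Ck_ext fg (Cf n). Qed.

Lemma smooth_on_cst (c : R) : smooth_on U (fun=> c).
Proof. by apply/smooth_onP => n; apply: Ck_cst. Qed.

Lemma smooth_on_coord b : smooth_on U (fun y => y 0 b).
Proof. by apply/smooth_onP => n; apply: Ck_coord. Qed.

Lemma smooth_onD f g : smooth_on U f -> smooth_on U g ->
  smooth_on U (fun y => f y + g y).
Proof.
by move=> /smooth_onP Cf /smooth_onP Cg; apply/smooth_onP => n; apply: Ck_add.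
Qed.

Lemma smooth_onM f g : smooth_on U f -> smooth_on U g ->
  smooth_on U (fun y => f y * g y).
Proof.
by move=> /smooth_onP Cf /smooth_onP Cg; apply/smooth_onP => n; apply: Ck_mul.
Qed.

Lemma smooth_onN f : smooth_on U f -> smooth_on U (fun y => - f y).
Proof.
move=> fU; apply: (@smooth_on_ext (fun y => -1 * f y)).
  by move=> y _; rewrite mulN1r.
by apply: smooth_onM => //; apply: smooth_on_cst.
Qed.

Lemma smooth_onB f g : smooth_on U f -> smooth_on U g ->
  smooth_on U (fun y => f y - g y).
Proof. by move=> fU gU; apply: smooth_onD => //; apply: smooth_onN. Qed.

Lemma smooth_on_sum (I : Type) (s : seq I) (P : pred I) (F : I -> 'rV[R]_d -> R) :
  (forall i, P i -> smooth_on U (F i)) ->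
  smooth_on U (fun y => \sum_(i <- s | P i) F i y).
Proof.
move=> FU; elim: s => [|i s IH].
  by apply: (@smooth_on_ext (fun=> 0)) => [y _|]; rewrite ?big_nil //; apply: smooth_on_cst.
case: (boolP (P i)) => Pi.
  apply: (@smooth_on_ext (fun y => F i y + \sum_(j <- s | P j) F j y)) => [y _|]; first by rewrite big_cons Pi.
  by apply: smooth_onD => //; apply: FU.
by apply: smooth_on_ext IH => y _; rewrite big_cons (negbTE Pi).
Qed.

Lemma smooth_on_prod (I : Type) (s : seq I) (P : pred I) (F : I -> 'rV[R]_d -> R) :
  (forall i, P i -> smooth_on U (F i)) ->
  smooth_on U (fun y => \prod_(i <- s | P i) F i y).
Proof.
move=> FU; elim: s => [|i s IH].
  by apply: (@smooth_on_ext (fun=> 1)) => [y _|]; rewrite ?big_nil //; apply: smooth_on_cst.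
case: (boolP (P i)) => Pi.
  apply: (@smooth_on_ext (fun y => F i y * \prod_(j <- s | P j) F j y)) => [y _|]; first by rewrite big_cons Pi.
  by apply: smooth_onM => //; apply: FU.
by apply: smooth_on_ext IH => y _; rewrite big_cons (negbTE Pi).
Qed.

Lemma smooth_onV f : (forall y, U y -> f y != 0) -> smooth_on U f ->
  smooth_on U (fun y => (f y)^-1).
Proof. by move=> f0 /smooth_onP Cf; apply/smooth_onP => n; apply: Ck_inv. Qed.

Lemma smooth_on_ln f : (forall y, U y -> 0 < f y) -> smooth_on U f ->
  smooth_on U (fun y => ln (f y)).
Proof. by move=> f0 /smooth_onP Cf; apply/smooth_onP => n; apply: Ck_ln. Qed.

Lemma smooth_on_powR f (c : R) : (forall y, U y -> 0 < f y) -> smooth_on U f ->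
  smooth_on U (fun y => f y `^ c).
Proof.
move=> f0 fU; apply: (@smooth_on_ext (fun y => expR (c * ln (f y)))).
  by move=> y /f0 fy; rewrite /powR gt_eqF.
have /smooth_onP Cf : smooth_on U (fun y => c * ln (f y)).
  by apply: smooth_onM; [apply: smooth_on_cst|apply: smooth_on_ln].
by apply/smooth_onP => n; apply: Ck_expR.
Qed.

Lemma smooth_on_sqrt f : (forall y, U y -> 0 < f y) -> smooth_on U f ->
  smooth_on U (fun y => Num.sqrt (f y)).
Proof.
move=> f0 fU; apply: (@smooth_on_ext (fun y => f y `^ (2^-1))).
  by move=> y /f0 fy; rewrite powR12_sqrt // ltW.
exact: smooth_on_powR.
Qed.

Lemma smooth_on_det n (F : 'rV[R]_d -> 'M[R]_n) :
  (forall i j, smooth_on U (fun y => F y i j)) ->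
  smooth_on U (fun y => \det (F y)).
Proof.
move=> FU; apply: smooth_on_sum => s _; apply: smooth_onM; first exact: smooth_on_cst.
by apply: smooth_on_prod => i _; apply: FU.
Qed.

Lemma smooth_on_mulmx m n p (F : 'rV[R]_d -> 'M[R]_(m, n)) (G : 'rV[R]_d -> 'M[R]_(n, p)) :
  (forall i j, smooth_on U (fun y => F y i j)) ->
  (forall i j, smooth_on U (fun y => G y i j)) ->
  forall i j, smooth_on U (fun y => (F y *m G y) i j).
Proof.
move=> FU GU i j; apply: (@smooth_on_ext (fun y => \sum_k F y i k * G y k j)).
  by move=> y _; rewrite mxE.
by apply: smooth_on_sum => k _; apply: smooth_onM.
Qed.

(** Cramer's rule: each entry of the inverse is a cofactor over the determinant. *)
Lemma smooth_on_invmx n (F : 'rV[R]_d -> 'M[R]_n) :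
  (forall y, U y -> \det (F y) != 0) ->
  (forall i j, smooth_on U (fun y => F y i j)) ->
  forall i j, smooth_on U (fun y => invmx (F y) i j).
Proof.
move=> F0 FU i j.
apply: (@smooth_on_ext (fun y => (\det (F y))^-1 *
    ((-1) ^+ (j + i) * \det (row' j (col' i (F y)))))).
  by move=> y /F0 Fy; rewrite /invmx unitmxE unitfE Fy !mxE.
apply: smooth_onM; first by apply: smooth_onV => //; apply: smooth_on_det.
apply: smooth_onM; first exact: smooth_on_cst.
apply: smooth_on_det => k l.
by apply: (@smooth_on_ext (fun y => F y (lift j k) (lift i l))) => // y _; rewrite !mxE.
Qed.

End Closure.

Lemma smooth_on_local U f :
  (forall y, U y -> exists W, [/\ W y & smooth_on W f]) -> smooth_on U f.
Proof. by move=> fU s y /fU[W [Wy]]; apply. Qed.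

Lemma smooth_on_sub U V f : V `<=` U -> smooth_on U f -> smooth_on V f.
Proof. by move=> VU fU s y /VU; apply: fU. Qed.

End SmoothFunctions.

(** * Total differentiability from continuous partial derivatives *)

Section TotalDerivative.
Context {R : realType} {d : nat}.
Implicit Types (U : set 'rV[R]_d) (f : 'rV[R]_d -> R).

Lemma is_derive_at f (y v : 'rV[R]_d) (t l : R) :
  is_derive (y + t *: v) v f l ->
  is_derive t (1 : R) (fun s : R => f (y + s *: v)) l.
Proof.
move=> /is_derive_line fl.
have E : (fun s : R => f (y + s *: v)) = (fun s => f (y + t *: v + s *: v)) \o (fun s => s - t).
  by apply/funext => s /=; rewrite -addrA -scalerDl (addrC t) subrK.
rewrite E -[l]mulr1; apply: is_derive1_comp; first by rewrite subrr.
by rewrite -[X in is_derive _ _ _ X]subr0; apply: is_deriveB.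
Qed.

(** The mean value theorem on the segment between 0 and t for either sign of t. Only [|c| <= |t|] is
    kept of the position of c, which is the form that estimates on balls use. *)
Lemma MVT0 (g dg : R -> R) (t : R) :
  (forall s, `|s| <= `|t| -> is_derive s (1 : R) g (dg s)) ->
  exists2 c, `|c| <= `|t| & g t - g 0 = dg c * t.
Proof.
move=> gd.
have cg a b : (forall s, a <= s <= b -> `|s| <= `|t|) -> {within `[a, b], continuous g}.
  move=> ab; apply: continuous_in_subspaceT => s; rewrite inE /= in_itv /= => /ab/gd[+ _].
  by move/derivable1_diffP; apply: differentiable_continuous.
have [t0|t0] := leP 0 t.
  have bnd s : 0 <= s <= t -> `|s| <= `|t| by move=> /andP[s0 st]; rewrite !ger0_norm.
  have [|c|c + ->] := @MVT_segment R g dg 0 t t0; last by rewrite subr0; exists c => //; apply: bnd.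
    by move=> c; rewrite in_itv /= => /andP[c0 ct]; apply: gd; apply: bnd; rewrite !ltW.
  exact: cg bnd c.
have bnd s : t <= s <= 0 -> `|s| <= `|t|.
  by move=> /andP[st s0]; rewrite !ler0_norm ?lerN2 // ltW.
have [|c|c cI E] := @MVT_segment R g dg t 0 (ltW t0).
- by move=> c; rewrite in_itv /= => /andP[c0 ct]; apply: gd; apply: bnd; rewrite !ltW.
- exact: cg bnd c.
- exists c; first exact: bnd.
  by rewrite -opprB E sub0r mulrN opprK.
Qed.

Let trunc (k : nat) (h : 'rV[R]_d) : 'rV[R]_d :=
  \row_i (if (i < k)%N then h 0 i else 0).

(* Moving from [y] to [y + h] one coordinate at a time. *)
Lemma partials_remainder U f y (e : R) :
  open U -> U y -> has_partials U f ->
  (forall a, {for y, continuous (partial a f)}) -> 0 < e ->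
  \forall h \near (0 : 'rV[R]_d),
    `|f (y + h) - f y - \sum_a h 0 a * partial a f y| <= e * `|h|.
Proof.
move=> oU Uy fU cf e0.
(* Each of the d coordinate moves is granted an error share [e / d%:R]. *)
suff H k : (k <= d)%N -> \forall h \near (0 : 'rV[R]_d),
    `|f (y + trunc k h) - f y - \sum_(a : 'I_d | (a < k)%N) h 0 a * partial a f y|
      <= (k%:R * (e / d%:R)) * `|h|.
  have := H d (leqnn d); apply: filterS => h.
  have -> : trunc d h = h by apply/rowP => i; rewrite mxE ltn_ord.
  under eq_bigl do rewrite ltn_ord.
  move=> /le_trans; apply; apply: ler_wpM2r => //.
  have [->|d0] := posnP d; first by rewrite mul0r ltW.
  by rewrite mulrC divfK // pnatr_eq0 -lt0n.
elim: k => [|k IH] kd.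
  near=> h; rewrite big_pred0 //.
  have -> : trunc 0 h = 0 by apply/rowP => i; rewrite !mxE.
  by rewrite addr0 subr0 subrr normr0 !mul0r.
have d0 : (0 < d)%N by apply: leq_ltn_trans kd.
pose a := Ordinal kd.
have ed : 0 < e / d%:R by rewrite divr_gt0 // ltr0n.
have /nbhs_ballP[r1 /= r10 r1U] : nbhs y U by apply: open_nbhs_nbhs.
have /cvgrPdist_le/(_ _ ed)/nbhs_ballP[r2 /= r20 r2f] := cf a.
near=> h.
have hr1 : `|h| < r1 by near: h; apply: near0_norm_lt.
have hr2 : `|h| < r2 by near: h; apply: near0_norm_lt.
have hk : `|f (y + trunc k h) - f y - \sum_(a : 'I_d | (a < k)%N) h 0 a * partial a f y|
      <= (k%:R * (e / d%:R)) * `|h| by near: h; apply: IH; apply: ltnW.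
(* In the sup norm the broken path from y to y + h never leaves the ball of radius [|h|], so U and
   the continuity estimate apply along all of it. *)
have seg s : `|s| <= `|h 0 a| -> `|trunc k h + s *: delta_mx 0 a| <= `|h|.
  move=> sh; apply: mx_norm_le => // i j; rewrite ord1 !mxE eqxx /=.
  have [jk|jk] := ltnP j k.
    rewrite (_ : j == a = false) ?mulr0 ?addr0 ?coord_le_norm //.
    by apply/eqP => ja; move: jk; rewrite ja ltnn.
  rewrite add0r; case: eqP => _; last by rewrite mulr0 normr0.
  by rewrite mulr1 (le_trans sh) ?coord_le_norm.
have [|c ch E] := @MVT0 (fun s => f (y + trunc k h + s *: delta_mx 0 a))
    (fun s => partial a f (y + trunc k h + s *: delta_mx 0 a)) (h 0 a).
  move=> s sh; apply: is_derive_at; apply: derivableP; apply: (fU _ _).2.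
  apply: r1U; rewrite -ball_normE /= -addrA opprD addNKr normrN.
  exact: le_lt_trans (seg s sh) hr1.
have -> : trunc k.+1 h = trunc k h + h 0 a *: delta_mx 0 a.
  apply/rowP => j; rewrite !mxE eqxx /= ltnS leq_eqVlt.
  have [/eqP jk|jk] := boolP (j == k :> nat).
    have -> : j = a by apply/val_inj.
    by rewrite eqxx ltnn add0r mulr1.
  rewrite (_ : j == a = false) ?mulr0 ?addr0 //.
  by apply: contraNF jk => /eqP ->.
move: E; rewrite scale0r addr0 !addrA => E.
have -> : f (y + trunc k h + h 0 a *: delta_mx 0 a) - f y -
    \sum_(i : 'I_d | (i < k.+1)%N) h 0 i * partial i f y =
    (f (y + trunc k h) - f y - \sum_(i : 'I_d | (i < k)%N) h 0 i * partial i f y) +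
    (partial a f (y + trunc k h + c *: delta_mx 0 a) - partial a f y) * h 0 a.
  rewrite (bigD1 a) //=.
  rewrite (eq_bigl (fun i : 'I_d => (i < k)%N)) => [|i].
    by rewrite mulrBl -E; ring.
  rewrite ltnS ltn_neqAle andbC; congr (_ && _).
have -> : k.+1%:R * (e / d%:R) * `|h| = k%:R * (e / d%:R) * `|h| + e / d%:R * `|h|.
  by rewrite -natr1; ring.
rewrite (le_trans (ler_normD _ _)) // lerD //.
rewrite normrM ler_pM ?coord_le_norm //.
rewrite distrC; apply: r2f; rewrite -ball_normE /= -addrA opprD addNKr normrN.
exact: le_lt_trans (seg c ch) hr2.
Unshelve. all: by end_near. Qed.

(** [smooth_on] speaks of partials alone, while [jacobian] and the chain rule for transition maps
    require the differential; this is the bridge between them. *)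
Lemma has_partials_differentiable U f y :
  open U -> U y -> has_partials U f ->
  (forall a, {for y, continuous (partial a f)}) ->
  differentiable f y /\ forall v, 'd f y v = \sum_a v 0 a * partial a f y.
Proof.
move=> oU Uy fU cf.
pose dl (h : 'rV[R]_d) : R := \sum_a h 0 a * partial a f y.
have dl_lin : linear dl.
  move=> c u v; rewrite /dl scaler_sumr -big_split /=; apply: eq_bigr => i _.
  by rewrite !mxE mulrDl [_ *: _]mulrA.
pose dlM := GRing.isLinear.Build _ _ _ _ _ dl_lin.
pose dL : {linear 'rV[R]_d -> R} := HB.pack dl dlM.
have cdl : continuous dL.
  move=> h; apply: (@cvg_sumr _ _ _ _ (nbhs_filter h)) => i _.
  apply: cvgM; last exact: cvg_cst.
  exact: coord_continuous.
have fo : f \o shift y = cst (f y) + dL +o_ (0 : 'rV[R]_d) id.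
  apply/eqaddoP => e e0; have := partials_remainder oU Uy fU cf e0.
  by apply: filterS => h; rewrite opprD addrA (addrC y).
have dE := diff_unique cdl fo.
split; last by move=> v; rewrite dE.
by apply/diff_locallyP; rewrite dE.
Qed.

Lemma smooth_on_differentiable U f y : open U -> smooth_on U f -> U y ->
  differentiable f y.
Proof.
move=> oU fU Uy; apply: (has_partials_differentiable oU Uy _ _).1.
  exact: smooth_on_has_partials.
by move=> a; apply: smooth_on_continuous (smooth_on_partial a fU) Uy.
Qed.

Lemma smooth_on_is_derive U f y v : open U -> smooth_on U f -> U y ->
  is_derive y v f (\sum_a v 0 a * partial a f y).
Proof.
move=> oU fU Uy; have df := smooth_on_differentiable oU fU Uy.
split; first exact: diff_derivable.
rewrite deriveE //; apply: (has_partials_differentiable oU Uy _ _).2.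
  exact: smooth_on_has_partials.
by move=> a; apply: smooth_on_continuous (smooth_on_partial a fU) Uy.
Qed.

End TotalDerivative.

(** * A smooth flat function on the line *)

Section Bump.
Context {R : realType}.

(* [bump 0] is the usual flat function; the family is closed under differentiation. *)
Definition bump (k : nat) (t : R) : R :=
  if 0 < t then t^-1 ^+ k * expR (- t^-1) else 0.

Definition bump' (k : nat) (t : R) : R := - k%:R * bump k.+1 t + bump k.+2 t.

Lemma bump_ge0 k t : 0 <= bump k t.
Proof.
rewrite /bump; case: ifP => // t0.
by rewrite mulr_ge0 ?expR_ge0 // exprn_ge0 // invr_ge0 ltW.
Qed.

Lemma bump_gt0 t : (0 < bump 0 t) = (0 < t).
Proof. by rewrite /bump; case: ifP => t0; rewrite ?ltxx // mul1r expR_gt0. Qed.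

(** The exponential at 1/t dominates its Taylor term of order k + 2, which leaves two spare powers
    of t. This quadratic decay is what gives derivative 0 at the origin. *)
Lemma bump_le k t : bump k t <= (k.+2)`!%:R * t ^+ 2.
Proof.
rewrite /bump; case: ifPn => [t0|_]; last by rewrite mulr_ge0 ?sqr_ge0.
have ti0 : 0 < t^-1 by rewrite invr_gt0.
have f0 : 0 < (k.+2)`!%:R :> R by rewrite ltr0n fact_gt0.
have := @expR_ge1Dxn R t^-1 k.+1 (ltW ti0).
rewrite expRN => H.
rewrite ler_pdivrMr ?expR_gt0 //.
have H1 : t^-1 ^+ k.+2 / (k.+2)`!%:R <= expR t^-1 by lra.
apply: (@le_trans _ _ ((k.+2)`!%:R * t ^+ 2 * (t^-1 ^+ k.+2 / (k.+2)`!%:R))).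
  rewrite !exprS; rewrite le_eqVlt; apply/orP; left; apply/eqP.
  by field; rewrite !gt_eqF.
by apply: ler_wpM2l => //; rewrite mulr_ge0 ?sqr_ge0 // ltW.
Qed.

Lemma is_derive_quadratic (g : R -> R) (C : R) :
  0 < C -> (forall t, `|g t| <= C * t ^+ 2) -> is_derive (0 : R) (1 : R) g 0.
Proof.
move=> C0 gC.
have g0 : g 0 = 0.
  by have := gC 0; rewrite expr0n mulr0 normr_le0 => /eqP.
suff H : (fun h : R => h^-1 *: ((g \o shift 0) (h *: 1) - g 0)) @ 0^' --> (0 : R).
  by split; [apply/cvg_ex; exists 0|apply: cvg_lim].
apply/cvgrPdist_le => e e0; rewrite /dnbhs near_withinE; near=> t => t0.
rewrite /= addr0 [_%:A]mulr1 g0 subr0 sub0r normrN normrM normfV.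
have tn0 : 0 < `|t| by rewrite normr_gt0.
rewrite ler_pdivrMl // (le_trans (gC t)) // -real_normK ?num_real // expr2 mulrA mulrC.
rewrite ler_wpM2l // -ler_pdivlMl //.
near: t; apply/nbhs_ballP; exists (C^-1 * e); first by rewrite /= mulr_gt0 // invr_gt0.
by move=> t; rewrite /ball /= sub0r normrN => /ltW.
Unshelve. all: by end_near. Qed.

Lemma is_derive_bump k (t : R) : is_derive t (1 : R) (bump k) (bump' k t).
Proof.
have [t0|t0|->] := ltgtP t 0.
- rewrite /bump' /bump !ltNge !(ltW t0) /= mulr0 addr0.
  apply: (@near_eq_is_derive _ _ _ (cst 0)).
  near=> s; rewrite ltNge ifF //; apply/negbF.
  near: s; apply/nbhs_ballP; exists (- t) => [|s]; first by rewrite /= oppr_gt0.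
  by rewrite /ball /= ltr_norml => /andP[]; lra.
- have tn0 : t != 0 by rewrite gt_eqF.
  apply: (@near_eq_is_derive _ _ _ ((fun s : R => s^-1 ^+ k) * (fun s : R => expR (- s^-1)))).
    near=> s; rewrite /bump ifT //.
    near: s; apply/nbhs_ballP; exists t => [|s]; first by [].
    by rewrite /ball /= ltr_norml => /andP[]; lra.
  have dV : is_derive t (1 : R) (fun s : R => s^-1) (- t ^- 2).
    by have := @is_deriveV R id t 1 1 tn0 (is_derive_id _ _); rewrite [_%:A]mulr1.
  have dE : is_derive t (1 : R) (fun s : R => expR (- s^-1)) (expR (- t^-1) * - - t ^- 2).
    by apply: (@is_derive1_comp R expR (fun s => - s^-1)).
  have dX : is_derive t (1 : R) (fun s : R => s^-1 ^+ k) (k%:R * t^-1 ^+ k.-1 * - t ^- 2).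
    have dP : is_derive t^-1 (1 : R) (fun u : R => u ^+ k) (k%:R * t^-1 ^+ k.-1).
      split; first exact: exprn_derivable.
      by rewrite exp_derive [_%:A]mulr1.
    exact: (@is_derive1_comp R (fun u => u ^+ k) (fun s => s^-1)).
  apply: (is_derive_eq (is_deriveM dX dE)).
  rewrite /bump' /bump t0 opprK -!exprVn.
  case: k {dX} => [|k]; first by rewrite /= !mul0r oppr0 mul0r add0r scaler0 addr0 expr0 [_ *: _]mul1r mulrC.
  rewrite /= !exprS /GRing.scale /=. ring.
- rewrite /bump' /bump ltxx mulr0 addr0.
  apply: (@is_derive_quadratic _ (k.+2)`!%:R); first by rewrite ltr0n fact_gt0.
  by move=> s; rewrite ger0_norm ?bump_ge0 // bump_le.
Unshelve. all: by end_near. Qed.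

Lemma smooth_on_bump d (U : set 'rV[R]_d) (f : 'rV[R]_d -> R) : open U ->
  smooth_on U f -> smooth_on U (fun y => bump 0 (f y)).
Proof.
move=> oU /smooth_onP Cf; apply/smooth_onP => n.
apply: (@Ck_comp_intro R d nat bump bump') => //.
  by move=> j y _; apply: is_derive_bump.
move=> m _ Cb j; apply: Ck_add => //; last exact: Cb.
by apply: Ck_mul => //; [apply: Ck_cst|apply: Cb].
Qed.

End Bump.

(** * Iterated integrals of compactly supported continuous functions *)

Section CompactlySupportedIntegral1.
Context {R : realType}.
Notation mu := (@lebesgue_measure R).

Definition cc1 (B : R) (g : R -> R) : Prop :=
  continuous g /\ forall x, B <= `|x| -> g x = 0.

Lemma cc1_restrict B g : cc1 B g -> g \_ `[- B, B] = g.
Proof.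
move=> [_ g0]; apply/funext => x; rewrite patchE; case: ifPn => // /negP xB.
rewrite g0 // leNgt; apply/negP => Bx; apply: xB.
by rewrite inE /= in_itv /= -ler_norml ltW.
Qed.

Lemma cc1_integrable B g : cc1 B g -> mu.-integrable setT (EFin \o g).
Proof.
move=> gB; have [gc _] := gB.
have gI : mu.-integrable `[- B, B] (EFin \o g).
  apply: continuous_compact_integrable; first exact: segment_compact.
  exact: continuous_subspaceT.
rewrite -(cc1_restrict gB) -restrict_EFin.
exact: (@integrable_mkcond _ _ _ mu _ (EFin \o g) (measurable_itv `[- B, B])).1 gI.
Qed.

Lemma Rintegral_cc1_le B g (c : R) : 0 <= B -> cc1 B g ->
  (forall x, g x <= c) -> \int[mu]_x g x <= c * (2 * B).
Proof.
move=> B0 gB gc; rewrite -{1}(cc1_restrict gB) -Rintegral_mkcond.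
apply: (@le_trans _ _ (\int[mu]_(x in `[- B, B]) c)).
  apply: le_Rintegral => //.
  + apply: continuous_compact_integrable; first exact: segment_compact.
    exact: continuous_subspaceT gB.1.
  + apply: continuous_compact_integrable; first exact: segment_compact.
    by apply: continuous_subspaceT => x; apply: cst_continuous.
rewrite Rintegral_cst //= lebesgue_measure_itv /=.
case: ifPn => [_|]; first by rewrite /= opprK -mulr2n mulr_natl.
rewrite lte_fin -leNgt => BB /=; have -> : B = 0 by lra.
by rewrite !mulr0.
Qed.

(** A positive value at x0 persists by continuity as [g x0 / 2] on an interval of length r, and that
    interval alone makes the integral positive. *)
Lemma Rintegral_cc1_eq0 B g : cc1 B g -> (forall x, 0 <= g x) ->
  \int[mu]_x g x = 0 -> forall x, g x = 0.
Proof.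
move=> gB g0 ig x0; apply/eqP; rewrite eq_le g0 andbT leNgt; apply/negP => gx0.
have /cvgrPdist_lt/(_ _ (divr_gt0 gx0 (ltr0n _ 2)))/nbhs_ballP[r /= r0 rg] := gB.1 x0.
pose J := `[x0 - r / 2, x0 + r / 2]%classic.
have gJ x : J x -> g x0 / 2 <= g x.
  rewrite /J /= in_itv /= => /andP[xl xr].
  have := rg x; rewrite /ball /= ltr_norml ltr_norml.
  move=> /(_ _)/wrap[]; first by apply/andP; split; lra.
  by move=> /andP[]; lra.
have cint (c : R) : mu.-integrable J (EFin \o (fun=> c)).
  apply: continuous_compact_integrable; first exact: segment_compact.
  by apply: continuous_subspaceT => x; apply: cst_continuous.
have gint : mu.-integrable J (EFin \o g).
  apply: continuous_compact_integrable; first exact: segment_compact.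
  exact: continuous_subspaceT gB.1.
have : \int[mu]_(x in J) (g x0 / 2) <= \int[mu]_x g x.
  apply: (@le_trans _ _ (\int[mu]_(x in J) g x)).
    by apply: le_Rintegral => //; exact: measurable_itv.
  rewrite Rintegral_mkcond; apply: le_Rintegral => //.
  + rewrite -restrict_EFin.
    exact: (@integrable_mkcond _ _ _ mu _ (EFin \o g) (measurable_itv _)).1 gint.
  + exact: cc1_integrable gB.
  + by move=> x _; rewrite patchE; case: ifP.
rewrite Rintegral_cst; last exact: measurable_itv.
rewrite /= lebesgue_measure_itv /= lte_fin.
have -> /= : x0 - r / 2 < x0 + r / 2 by lra.
rewrite ig; apply/negP; rewrite -ltNge mulr_gt0 //; lra.
Qed.

End CompactlySupportedIntegral1.

Section CompactlySupportedIntegral.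
Context {R : realType}.

(** The bound B belongs to the class because sections and sums keep the same B; the box then has
    volume (2B)^n in every estimate. *)
Definition cc n (B : R) (f : 'rV[R]_n -> R) : Prop :=
  continuous f /\ forall y, B <= `|y| -> f y = 0.

Let sect n (f : 'rV[R]_n.+1 -> R) (x : R) : 'rV[R]_n -> R :=
  fun y => f (row_mx (x%:M : 'rV[R]_1) y).

Lemma row_mx_continuous n (x : R) (y : 'rV[R]_n) :
  (row_mx (z.1%:M : 'rV[R]_1) z.2 : 'rV[R]_n.+1) @[z --> (x, y)] -->
  (row_mx (x%:M : 'rV[R]_1) y : 'rV[R]_n.+1).
Proof.
apply: cvg_mx_coord => i j; case: (@split_ordP 1 n j) => k ->.
  rewrite (@row_mxEl _ 1 1 n) !ord1 mxE mulr1n.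
  under eq_cvg do rewrite (@row_mxEl _ 1 1 n) mxE mulr1n.
  exact: cvg_fst.
rewrite (@row_mxEr _ 1 1 n) ord1; under eq_cvg do rewrite (@row_mxEr _ 1 1 n).
apply: (@cvg_comp _ _ _ snd (fun w : 'rV[R]_n => w 0 k) _ (nbhs y)).
  exact: cvg_snd.
exact: coord_continuous.
Qed.

Lemma norm_row_mx_ge n (x : R) (y : 'rV[R]_n) :
  `|x| <= `|row_mx (x%:M : 'rV[R]_1) y| /\ `|y| <= `|row_mx (x%:M : 'rV[R]_1) y|.
Proof.
split.
  have := coord_le_norm (row_mx (x%:M : 'rV[R]_1) y) 0 (lshift n 0).
  by rewrite row_mxEl mxE mulr1n.
apply: mx_norm_le => // i j.
by have := coord_le_norm (row_mx (x%:M : 'rV[R]_1) y) i (rshift 1 j); rewrite row_mxEr ord1.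
Qed.

Lemma cc_section n B (f : 'rV[R]_n.+1 -> R) x : cc B f -> cc B (sect f x).
Proof.
move=> [cf f0]; split=> [y|y By].
  apply: (@cvg_comp _ _ _ (fun z : 'rV[R]_n => row_mx (x%:M : 'rV[R]_1) z : 'rV[R]_n.+1)
    f _ (nbhs (row_mx (x%:M : 'rV[R]_1) y : 'rV[R]_n.+1))); last exact: cf.
  apply: (@cvg_comp _ _ _ (fun z : 'rV[R]_n => (x, z))
    (fun z => (row_mx (z.1%:M : 'rV[R]_1) z.2 : 'rV[R]_n.+1)) _ (nbhs (x, y)));
    last exact: row_mx_continuous.
  apply: (@cvg_pair _ _ _ (nbhs y) (nbhs x) (nbhs y)); [exact: cvg_cst|exact: cvg_id].
by rewrite /sect f0 // (le_trans By) // (norm_row_mx_ge x y).2.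
Qed.

Lemma cc_section0 n B (f : 'rV[R]_n.+1 -> R) x : cc B f -> B <= `|x| ->
  sect f x = fun=> 0.
Proof.
move=> [_ f0] Bx; apply/funext => y.
by rewrite /sect f0 // (le_trans Bx) // (norm_row_mx_ge x y).1.
Qed.

(** On the compact ball [|y| <= B] this is the tube lemma; outside it both sections vanish. It makes
    the inner integral continuous in the outer variable. *)
Lemma cc_section_uniform n B (f : 'rV[R]_n.+1 -> R) x (e : R) : cc B f -> 0 < e ->
  \forall x' \near x, forall y, `|sect f x' y - sect f x y| <= e.
Proof.
move=> fB e0; have [cf f0] := fB.
have Hc : \forall x' \near x, forall y : 'rV[R]_n, `|y| <= B ->
    `|sect f x' y - sect f x y| <= e.
  apply: (@compact_near_uniform _ _ _ _ (nbhs_filter x)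
    (fun x' y => `|sect f x' y - sect f x y| <= e) (@compact_norm_le R n B)) => y _.
  have c1 : (sect f z.1 z.2) @[z --> (x, y)] --> sect f x y.
    apply: (@cvg_comp _ _ _ (fun z : R * 'rV[R]_n => row_mx (z.1%:M : 'rV[R]_1) z.2 : 'rV[R]_n.+1)
      f _ (nbhs (row_mx (x%:M : 'rV[R]_1) y : 'rV[R]_n.+1))); last exact: cf.
    exact: row_mx_continuous.
  have c2 : (sect f x z.2) @[z --> (x, y)] --> sect f x y.
    apply: (@cvg_comp _ _ _ snd (sect f x) _ (nbhs y)); first exact: cvg_snd.
    exact: (cc_section x fB).1.
  have c3 : (sect f z.1 z.2 - sect f x z.2) @[z --> (x, y)] --> (0 : R).
    by rewrite -(subrr (sect f x y)); apply: cvgB.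
  have sw : (z.2, z.1) @[z --> (y, x)] --> (x, y).
    by apply: (@cvg_pair _ _ _ _ (nbhs x) (nbhs y)); [apply: cvg_snd|apply: cvg_fst].
  have /cvgrPdist_le/(_ e e0) H := cvg_comp _ _ sw c3.
  apply: filterS H => -[y' x'] /=.
  by rewrite sub0r normrN.
apply: (filterS _ Hc) => x' H y; have [yB|/ltW By] := leP `|y| B; first exact: H.
by rewrite !(cc_section _ fB).2 // subrr normr0 ltW.
Qed.

Lemma ccD n B (f g : 'rV[R]_n -> R) : cc B f -> cc B g -> cc B (fun y => f y + g y).
Proof.
move=> [cf f0] [cg g0]; split=> [x|x Bx]; last by rewrite f0 ?g0 ?addr0.
exact: continuousD (cf x) (cg x).
Qed.

Lemma ccZ n B (f : 'rV[R]_n -> R) c : cc B f -> cc B (fun y => c * f y).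
Proof.
move=> [cf f0]; split=> [x|x Bx]; last by rewrite f0 ?mulr0.
by apply: continuousM (cf x); apply: cst_continuous.
Qed.

(** The properties form one induction on the dimension. To integrate once more, the slice integral
    must be known to be continuous with bounded support, and this uses linearity and the upper bound
    in the lower dimension. *)
Lemma integral_Rn_spec n B : 0 <= B ->
  [/\ forall f g : 'rV[R]_n -> R, cc B f -> cc B g ->
        integral_Rn (fun y => f y + g y) = integral_Rn f + integral_Rn g,
      forall (f : 'rV[R]_n -> R) c, cc B f ->
        integral_Rn (fun y => c * f y) = c * integral_Rn f,
      forall (f : 'rV[R]_n -> R) c, cc B f ->
        (forall y, f y <= c) -> integral_Rn f <= c * (2 * B) ^+ n,
      forall (f : 'rV[R]_n -> R), cc B f ->
        (forall y, 0 <= f y) -> 0 <= integral_Rn f &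
      forall (f : 'rV[R]_n -> R), cc B f ->
        (forall y, 0 <= f y) -> integral_Rn f = 0 -> forall y, f y = 0].
Proof.
move=> B0; elim: n => [|n [IHD IHZ IHle IHge0 IH0]].
  split => //=; first by move=> f c _ fc; rewrite expr0 mulr1.
  by move=> f _ _ f0 y; rewrite (_ : y = 0) //; apply/rowP; case.
have B2 : 0 <= (2 * B) ^+ n by rewrite exprn_ge0 // mulr_ge0.
have IHB (f g : 'rV[R]_n -> R) : cc B f -> cc B g ->
    integral_Rn f - integral_Rn g = integral_Rn (fun y => f y + -1 * g y).
  by move=> fB gB; rewrite IHD ?IHZ ?mulN1r //; apply: ccZ.
have IH00 : integral_Rn (fun _ : 'rV[R]_n => 0) = 0.
  have c0 : cc B (fun _ : 'rV[R]_n => 0).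
    by split=> // y; apply: cst_continuous.
  apply: etrans (etrans (IHZ (fun=> 0) 0 c0) (mul0r _)).
  by congr integral_Rn; apply/funext => y; rewrite mul0r.
have slice1 (f : 'rV[R]_n.+1 -> R) : cc B f -> cc1 B (fun x => integral_Rn (sect f x)).
  move=> fB; split=> [x|x Bx]; last by rewrite (cc_section0 fB Bx).
  apply/cvgrPdist_le => e e0.
  (* The added 1 keeps the denominator positive when the box is degenerate. *)
  pose e' := e / ((2 * B) ^+ n + 1).
  have e'0 : 0 < e' by apply: divr_gt0 => //; lra.
  have := cc_section_uniform x fB e'0; apply: filterS => x' Hx'.
  have cx := cc_section x fB; have cx' := cc_section x' fB.
  have bnd (g h : 'rV[R]_n -> R) : cc B g -> cc B h ->
      (forall y, g y - h y <= e') -> integral_Rn g - integral_Rn h <= e.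
    move=> cg ch gh; rewrite IHB //.
    apply: (@le_trans _ _ (e' * (2 * B) ^+ n)).
      apply: IHle; first by apply: ccD => //; apply: ccZ.
      by move=> y; rewrite mulN1r; apply: gh.
    rewrite /e' mulrAC ler_pdivrMr; last lra.
    by rewrite ler_pM2l //; lra.
  rewrite ler_norml lerNl opprB; apply/andP; split; apply: bnd => // y.
    by have := Hx' y; rewrite ler_norml => /andP[].
  by have := Hx' y; rewrite distrC ler_norml => /andP[].
split.
- move=> f g fB gB /=.
  transitivity (\int[lebesgue_measure]_(x in [set: R])
     (integral_Rn (sect f x) + integral_Rn (sect g x))).
    by apply: eq_Rintegral => x _; rewrite -IHD //; apply: cc_section.
  by rewrite RintegralD //; apply: (@cc1_integrable _ B); apply: slice1.
- move=> f c fB /=.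
  transitivity (\int[lebesgue_measure]_(x in [set: R]) (c * integral_Rn (sect f x))).
    by apply: eq_Rintegral => x _; rewrite -IHZ //; apply: cc_section.
  by rewrite RintegralZl //; apply: (@cc1_integrable _ B); apply: slice1.
- move=> f c fB fc; rewrite exprSr mulrA; apply: Rintegral_cc1_le => //.
    exact: slice1.
  move=> x; apply: IHle; first exact: cc_section.
  by move=> y; apply: fc.
- move=> f fB f0; apply: Rintegral_ge0 => x _; apply: IHge0; first exact: cc_section.
  by move=> y; apply: f0.
- move=> f fB f0 If0 y.
  have If1 : forall x, integral_Rn (sect f x) = 0.
    apply: (Rintegral_cc1_eq0 (slice1 f fB) _ If0) => x.
    by apply: IHge0; [apply: cc_section|move=> z; apply: f0].
  have := IH0 _ (cc_section _ fB) (fun z => f0 _) (If1 (y 0 (lshift n 0 : 'I_(1 + n))))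
    (rsubmx (y : 'rV[R]_(1 + n))).
  rewrite /sect.
  have -> : row_mx ((y 0 (lshift n 0 : 'I_(1 + n)))%:M : 'rV[R]_1) (rsubmx (y : 'rV[R]_(1 + n))) = y.
    rewrite -[RHS](@hsubmxK _ 1 1 n); congr row_mx.
    by apply/rowP => i; rewrite !mxE !ord1 eqxx mulr1n.
  by [].
Qed.

Lemma integral_RnB n B (f g : 'rV[R]_n -> R) : 0 <= B -> cc B f -> cc B g ->
  integral_Rn (fun y => f y - g y) = integral_Rn f - integral_Rn g.
Proof.
move=> B0 fB gB; have [iD iZ _ _ _] := integral_Rn_spec n B0.
transitivity (integral_Rn (fun y => f y + -1 * g y)).
  by congr integral_Rn; apply/funext => y; rewrite mulN1r.
by rewrite iD ?iZ ?mulN1r //; apply: ccZ.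
Qed.

Lemma integral_Rn_le n B (f g : 'rV[R]_n -> R) : 0 <= B -> cc B f -> cc B g ->
  (forall y, f y <= g y) -> integral_Rn f <= integral_Rn g.
Proof.
move=> B0 fB gB fg; have [_ _ _ ige0 _] := integral_Rn_spec n B0.
rewrite -subr_ge0 -(integral_RnB B0) //; apply: ige0.
  by have := ccD gB (ccZ (-1) fB); congr cc; apply/funext => y; rewrite mulN1r.
by move=> y; rewrite subr_ge0.
Qed.

Lemma integral_Rn_dist_le n B (f g : 'rV[R]_n -> R) e : 0 <= B -> cc B f -> cc B g ->
  (forall y, `|f y - g y| <= e) ->
  `|integral_Rn f - integral_Rn g| <= e * (2 * B) ^+ n.
Proof.
move=> B0 fB gB fg; have [_ _ ile _ _] := integral_Rn_spec n B0.
have ccB (u v : 'rV[R]_n -> R) : cc B u -> cc B v -> cc B (fun y => u y - v y).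
  by move=> uB vB; have := ccD uB (ccZ (-1) vB); congr cc; apply/funext => y; rewrite mulN1r.
rewrite ler_norml lerNl opprB -!(integral_RnB B0) //.
apply/andP; split; apply: ile; try exact: ccB.
  by move=> y; have := fg y; rewrite ler_norml => /andP[+ _]; rewrite lerNl opprB.
by move=> y; have := fg y; rewrite ler_norml => /andP[].
Qed.

(** Differentiation under the integral from a first-order remainder that is uniform in y:
    integrating it over the fixed box costs only the factor (2B)^n. *)
Lemma integral_Rn_is_derive n B (f : R -> 'rV[R]_n -> R) (df : 'rV[R]_n -> R) :
  0 <= B -> cc B df -> (\forall t \near (0 : R), cc B (f t)) ->
  (forall e, 0 < e -> \forall t \near (0 : R),
     forall y, `|f t y - f 0 y - t * df y| <= e * `|t|) ->
  is_derive (0 : R) (1 : R) (fun t => integral_Rn (f t)) (integral_Rn df).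
Proof.
move=> B0 dfB fB fdf; have [iD iZ _ _ _] := integral_Rn_spec n B0.
have f0B := nbhs_singleton fB.
suff H : (fun h : R => h^-1 *: (((fun t => integral_Rn (f t)) \o shift 0) (h *: 1) -
    integral_Rn (f 0))) @ 0^' --> integral_Rn df.
  by split; [apply/cvg_ex; exists (integral_Rn df)|apply: cvg_lim].
apply/cvgrPdist_le => e e0.
pose e' := e / ((2 * B) ^+ n + 1).
have B2 : 0 <= (2 * B) ^+ n by rewrite exprn_ge0 // mulr_ge0.
have e'0 : 0 < e' by apply: divr_gt0 => //; lra.
rewrite /dnbhs near_withinE; near=> t => t0.
rewrite /= addr0 [_%:A]mulr1.
have ftB : cc B (f t) by near: t.
have ft : forall y, `|f t y - f 0 y - t * df y| <= e' * `|t| by near: t; apply: fdf.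
have := @integral_Rn_dist_le n B (f t) (fun y => f 0 y + t * df y) (e' * `|t|) B0 ftB
  (ccD f0B (ccZ t dfB)).
move=> /(_ _)/wrap[]; first by move=> y; rewrite opprD addrA.
rewrite iD ?iZ //; last exact: ccZ.
move=> H.
have tn0 : 0 < `|t| by rewrite normr_gt0.
rewrite -(ler_pM2l tn0) -normrM mulrBr [_ *: _]mulrC [t * (_ / _)]mulrC divfK //.
rewrite distrC -addrA -opprD (le_trans H) // mulrAC mulrC ler_wpM2l //.
rewrite /e' mulrAC ler_pdivrMr; last lra.
by rewrite ler_pM2l //; lra.
Unshelve. all: by end_near. Qed.

End CompactlySupportedIntegral.

(** * Positive definite matrices *)

Section PositiveDefinite.
Context {R : realType}.

Definition posdef n (S : 'M[R]_n) : Prop :=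
  S^T = S /\ forall v : 'rV[R]_n, v != 0 -> 0 < (v *m S *m v^T) 0 0.

(** Induction by splitting off the first row and column: the Schur complement
    [C - a^-1 *: (b *m b^T)] is again positive definite, and its factor L completes the column built
    from the square root of a. *)
Lemma cholesky n (S : 'M[R]_n) : posdef S ->
  exists L : 'M[R]_n, [/\ is_trig_mx L, forall i, 0 < L i i & S = L *m L^T].
Proof.
elim: n S => [|n IH] S [Ssym Spos].
  exists 0; split; [exact: mx0_is_trig|by case|by apply/matrixP => -[]].
pose S1 : 'M[R]_(1 + n) := S.
pose a := S1 0 0; pose b := dlsubmx S1; pose C := drsubmx S1.
have Sul : ulsubmx S1 = a%:M.
  by rewrite [LHS]mx11_scalar !mxE; congr (S _ _)%:M; apply/val_inj.
have Sur : ursubmx S1 = b^T by rewrite /b trmx_dlsub [S1^T]Ssym.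
have Csym : C^T = C by rewrite /C trmx_drsub [S1^T]Ssym.
have SE : S1 = block_mx a%:M b^T b C by rewrite -Sul -Sur submxK.
have quad (x : 'M[R]_1) (v : 'rV[R]_n) :
    (row_mx x v *m S1 *m (row_mx x v)^T) 0 0 =
    a * x 0 0 ^+ 2 + 2 * x 0 0 * (v *m b) 0 0 + (v *m C *m v^T) 0 0.
  have addE (A B : 'M[R]_1) : (A + B) 0 0 = A 0 0 + B 0 0 by rewrite mxE.
  have mulE (A B : 'M[R]_1) : (A *m B) 0 0 = A 0 0 * B 0 0 by rewrite mxE big_ord1.
  have trE (A : 'M[R]_1) : A^T = A by apply/matrixP => i j; rewrite mxE !ord1.
  rewrite SE mul_row_block tr_row_mx mul_row_col !mulmxDl !addE.
  have -> : x *m b^T *m v^T = x *m (v *m b) by rewrite -[v *m b]trE trmx_mul mulmxA.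
  rewrite trE !mulE; have -> : (a%:M : 'M[R]_1) 0 0 = a by rewrite mxE.
  ring.
have a0 : 0 < a.
  have := Spos (row_mx 1%:M 0); rewrite -[X in _ *m X *m _]/S1 quad !mul0mx !mxE.
  rewrite eqxx mulr1n mulr0 !addr0 expr1n mulr1; apply.
  apply/eqP => /(congr1 (fun w : 'rV[R]_(1 + n) => lsubmx w 0 0)).
  by rewrite row_mxKl !mxE => /eqP; rewrite oner_eq0.
have [|L [Ltrig Lpos SL]] := IH (C - a^-1 *: (b *m b^T)).
  split.
    by rewrite linearB linearZ /= trmx_mul trmxK Csym.
  move=> v v0.
  (* For fixed v this first coordinate minimizes the quadratic form of S, and the minimum is the
     Schur complement evaluated at v. *)
  have := Spos (row_mx (- a^-1 *: (v *m b)) v).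
  rewrite -[X in _ *m X *m _]/S1 quad => /(_ _)/wrap[].
    apply: contra v0 => /eqP/(congr1 (fun w : 'rV[R]_(1 + n) => rsubmx w)).
    by rewrite row_mxKr linear0 => ->.
  suff -> : (v *m (C - a^-1 *: (b *m b^T)) *m v^T) 0 0 =
     a * (- a^-1 *: (v *m b)) 0 0 ^+ 2 +
     2 * (- a^-1 *: (v *m b)) 0 0 * (v *m b) 0 0 + (v *m C *m v^T) 0 0 by [].
  rewrite mulmxBr mulmxBl -scalemxAr -scalemxAl.
  have -> : v *m (b *m b^T) *m v^T = (v *m b) *m (v *m b)^T.
    by rewrite trmx_mul !mulmxA.
  set vb := v *m b; rewrite [X in X = _]mxE [X in _ + X = _]mxE [X in _ - X = _]mxE.
  rewrite [(vb *m vb^T) 0 0]mxE big_ord1 [vb^T 0 0]mxE [(_ *: vb) 0 0]mxE.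
  by field; rewrite gt_eqF.
exists (block_mx (Num.sqrt a)%:M 0 ((Num.sqrt a)^-1 *: b) L).
have sa0 : 0 < Num.sqrt a by rewrite sqrtr_gt0.
split.
- by rewrite (@is_trig_block_mx _ 1 n 1 n) // eqxx scalar_mx_is_trig.
- move=> i; case: (@split_ordP 1 n i) => j ->.
    by rewrite (@block_mxEul _ 1 n 1 n) mxE eqxx mulr1n.
  by rewrite (@block_mxEdr _ 1 n 1 n).
- rewrite -[LHS]/S1 SE (@tr_block_mx _ 1 n 1 n) (@mulmx_block _ 1 n 1 n 1 n) !trmx0 !mulmx0 !mul0mx !addr0.
  rewrite tr_scalar_mx -scalar_mxM -expr2 sqr_sqrtr ?ltW // linearZ /=.
  rewrite mul_scalar_mx mul_mx_scalar !scalerA divff ?gt_eqF // scale1r.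
  rewrite -SL -scalemxAl -scalemxAr scalerA -expr2 exprVn sqr_sqrtr ?ltW //.
  by rewrite scale1r (addrC (a^-1 *: _)) subrK.
Qed.

Lemma ln_le_subr1 (x : R) : 0 < x -> ln x <= x - 1.
Proof.
move=> x0; have := @le_ln1Dx R (x - 1); rewrite (addrC 1) subrK; apply; lra.
Qed.

Lemma ln_eq_subr1 (x : R) : 0 < x -> ln x = x - 1 -> x = 1.
Proof.
move=> x0 E; apply/eqP; rewrite -ln_eq0 //; apply: contraT => /expR_gt1Dx.
by rewrite lnK ?posrE // E (addrC 1) subrK ltxx.
Qed.

Lemma det_cholesky n (L : 'M[R]_n) : is_trig_mx L ->
  \det (L *m L^T) = \prod_i L i i ^+ 2.
Proof.
by move=> Lt; rewrite det_mulmx det_tr det_trig // -expr2 prodrXl.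
Qed.

Lemma trace_cholesky n (L : 'M[R]_n) :
  \tr (L *m L^T) = \sum_i (L i i ^+ 2 + \sum_(j | j != i) L i j ^+ 2).
Proof.
apply: eq_bigr => i _; rewrite mxE (bigD1 i) //= mxE -expr2; congr (_ + _).
by apply: eq_bigr => j _; rewrite mxE -expr2.
Qed.

Lemma ln_prod (I : Type) (s : seq I) (F : I -> R) : (forall i, 0 < F i) ->
  ln (\prod_(i <- s) F i) = \sum_(i <- s) ln (F i).
Proof.
move=> F0; elim: s => [|i s IH]; first by rewrite !big_nil ln1.
by rewrite !big_cons lnM ?posrE ?IH // prodr_gt0.
Qed.

Lemma posdef_det_gt0 n (S : 'M[R]_n) : posdef S -> 0 < \det S.
Proof.
move=> /cholesky[L [Lt Lp ->]]; rewrite det_cholesky //.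
by apply: prodr_gt0 => i _; rewrite exprn_gt0.
Qed.

Lemma posdef_trace_ge n (S : 'M[R]_n) (c : R) : posdef S -> 0 < c ->
  n%:R + ln (\det S) - n%:R * ln c <= \tr S / c.
Proof.
move=> /cholesky[L [Lt Lp ->]] c0; rewrite det_cholesky // ln_prod; last first.
  by move=> i; rewrite exprn_gt0.
rewrite trace_cholesky mulr_suml.
have nE (x : R) : n%:R * x = \sum_(i < n) x by rewrite sumr_const card_ord mulr_natl.
rewrite -[n%:R in X in X + _ - _]mulr1 !nE -big_split /= -sumrB; apply: ler_sum => i _.
have Lii : 0 < L i i ^+ 2 by rewrite exprn_gt0.
have := @ln_le_subr1 (L i i ^+ 2 / c) (divr_gt0 Lii c0).
rewrite ln_div ?posrE // mulrDl.
have : 0 <= (\sum_(j | j != i) L i j ^+ 2) / c.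
  by apply: divr_ge0; [apply: sumr_ge0 => j _; apply: sqr_ge0|apply: ltW].
lra.
Qed.

(** Row i contributes [L i i ^+ 2 - 1 - ln (L i i ^+ 2)] and its off-diagonal squares to the defect.
    All of these are nonnegative, so a zero defect forces a unit diagonal and zeros elsewhere. *)
Lemma posdef_trace_eq n (S : 'M[R]_n) : posdef S ->
  \tr S = n%:R + ln (\det S) -> S = 1%:M.
Proof.
move=> /cholesky[L [Lt Lp ->]]; rewrite det_cholesky // ln_prod; last first.
  by move=> i; rewrite exprn_gt0.
rewrite trace_cholesky.
have -> : n%:R = \sum_(i < n) (1 : R) by rewrite sumr_const card_ord.
move=> /eqP; rewrite -big_split /= -subr_eq0 -sumrB.
have off i : 0 <= \sum_(j | j != i) L i j ^+ 2.
  by apply: sumr_ge0 => j _; apply: sqr_ge0.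
have diag i : 0 < L i i ^+ 2 by rewrite exprn_gt0.
rewrite psumr_eq0 => [/allP L0|i _]; last first.
  by have := ln_le_subr1 (diag i); have := off i; lra.
have {}L0 i : L i i ^+ 2 = 1 /\ \sum_(j | j != i) L i j ^+ 2 = 0.
  have /implyP/(_ isT)/eqP := L0 i (mem_index_enum i).
  have := ln_le_subr1 (diag i); have := off i => Hoff Hln E.
  by split; [apply: ln_eq_subr1 => //|]; lra.
suff -> : L = 1%:M by rewrite trmx1 mulmx1.
apply/matrixP => i j; rewrite mxE; have [Li Lo] := L0 i.
have [<-|ij] := eqVneq i j.
  by apply/eqP; rewrite -(@eqrXn2 _ 2%N) ?ler01 ?expr1n ?Li ?ltW.
have := psumr_eq0P _ Lo => /(_ _ j)/wrap[].
  by move=> k _; apply: sqr_ge0.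
by rewrite eq_sym ij => /(_ isT)/eqP; rewrite sqrf_eq0 => /eqP.
Qed.

(* With [G1 = C C^T], [tr (G1^-1 G0)] is the trace of the positive definite matrix
   [C^-1 G0 C^-T]. *)
Lemma posdef_relative n (G0 G1 : 'M[R]_n) : posdef G0 -> posdef G1 ->
  exists C S : 'M[R]_n, [/\ posdef S, G0 = C *m S *m C^T, G1 = C *m C^T,
    \tr (invmx G1 *m G0) = \tr S & ln (\det S) = ln (\det G0) - ln (\det G1)].
Proof.
move=> G0p G1p; have [C [Ct Cp G1E]] := cholesky G1p.
have G1u : G1 \in unitmx by rewrite unitmxE unitfE gt_eqF // posdef_det_gt0.
have Cu : C \in unitmx by move: G1u; rewrite G1E unitmx_mul => /andP[].
have CTu : C^T \in unitmx by rewrite unitmx_tr.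
pose S := invmx C *m G0 *m (invmx C)^T.
have G0E : G0 = C *m S *m C^T.
  by rewrite /S !mulmxA mulmxV // mul1mx -mulmxA -trmx_mul mulmxV // trmx1 mulmx1.
have Sp : posdef S.
  split; first by rewrite /S !trmx_mul trmxK G0p.1 !mulmxA.
  move=> v v0; have -> : v *m S *m v^T = (v *m invmx C) *m G0 *m (v *m invmx C)^T.
    by rewrite /S trmx_mul !mulmxA.
  apply: G0p.2; apply: contra v0 => /eqP/(congr1 (mulmx^~ C)).
  by rewrite mulmxKV // mul0mx => ->.
exists C, S; split => //.
  have -> : invmx G1 *m G0 = invmx C^T *m (S *m C^T).
    apply: (can_inj (mulKmx G1u)); rewrite mulKVmx // G1E.
    by rewrite -mulmxA mulKVmx // mulmxA -G0E.
  by rewrite mxtrace_mulC mulmxK.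
have G1d := posdef_det_gt0 G1p; have Sd := posdef_det_gt0 Sp.
have -> : \det G0 = \det G1 * \det S.
  by rewrite {1}G0E G1E !det_mulmx det_tr; ring.
by rewrite lnM ?posrE // addrC addKr.
Qed.

Lemma relative_trace_ge n (G0 G1 : 'M[R]_n) (c : R) :
  posdef G0 -> posdef G1 -> 0 < c ->
  n%:R + (ln (\det G0) - ln (\det G1)) - n%:R * ln c <= \tr (invmx G1 *m G0) / c.
Proof.
move=> G0p G1p c0; have [C [S [Sp _ _ -> <-]]] := posdef_relative G0p G1p.
exact: posdef_trace_ge.
Qed.

Lemma relative_trace_eq n (G0 G1 : 'M[R]_n) : posdef G0 -> posdef G1 ->
  \tr (invmx G1 *m G0) = n%:R + (ln (\det G0) - ln (\det G1)) -> G0 = G1.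
Proof.
move=> G0p G1p; have [C [S [Sp -> -> -> <-]]] := posdef_relative G0p G1p.
by move=> /(posdef_trace_eq Sp) ->; rewrite mulmx1.
Qed.

End PositiveDefinite.

(** * Charts and partitions of unity *)

Section Charts.
Context {R : realType} {M : topologicalType} {d : nat}.
Variable A : smooth_atlas R M d.
Local Notation cdom := (cdom A).
Local Notation cmap := (cmap A).
Local Notation cinv := (cinv A).
Implicit Types (i j k : cidx A) (x : M) (y v : 'rV[R]_d).

Definition transition (i j : cidx A) (y : 'rV[R]_d) : 'rV[R]_d := cmap j (cinv i y).

Lemma crangeP i y : crange i y -> cdom i (cinv i y) /\ cmap i (cinv i y) = y.
Proof. by move=> [x xi <-]; rewrite cmapK. Qed.

Lemma crange_cmap i x : cdom i x -> crange i (cmap i x).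
Proof. by move=> xi; exists x. Qed.

Lemma open_crange i : open (crange i : set 'rV[R]_d).
Proof. exact: crange_open. Qed.

Lemma cinv_continuous_at i y : crange i y -> {for y, continuous (cinv i)}.
Proof.
have := @cinv_continuous _ _ _ A i.
rewrite continuous_open_subspace; last exact: crange_open.
by move=> H iy; apply: H; rewrite inE.
Qed.

Lemma cmap_continuous_at i x : cdom i x -> {for x, continuous (cmap i)}.
Proof.
have := @cmap_continuous _ _ _ A i.
rewrite continuous_open_subspace; last exact: cdom_open.
by move=> H ix; apply: H; rewrite inE.
Qed.

Lemma open_chart_preimage i (W : set M) : open W ->
  open (crange i `&` cinv i @^-1` W).
Proof.
move=> oW; have H : {in crange i, continuous (cinv i)}.
  by move=> y; rewrite inE => iy; apply: cinv_continuous_at.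
exact: ((continuous_inP (cinv i) (@open_crange i)).1 H).
Qed.

Lemma overlapE i j : cmap i @` (cdom i `&` cdom j) = crange i `&` cinv i @^-1` cdom j.
Proof.
apply/seteqP; split=> [y [x [xi xj] <-]|y [iy yj]].
  by split; [exact: crange_cmap|rewrite /= cmapK].
by have [yi yE] := crangeP iy; exists (cinv i y).
Qed.

Lemma open_overlap i j : open (cmap i @` (cdom i `&` cdom j)).
Proof. by rewrite overlapE; apply: open_chart_preimage; apply: cdom_open. Qed.

Lemma transition_cmap i j x : cdom i x -> transition i j (cmap i x) = cmap j x.
Proof. by move=> xi; rewrite /transition cmapK. Qed.

Lemma differentiable_rV n (f : 'rV[R]_n -> 'rV[R]_d) (y : 'rV[R]_n) :
  (forall b, differentiable (fun z : 'rV[R]_n => f z 0 b : R) y) -> differentiable f y.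
Proof.
move=> df; have -> : f = \sum_(b < d) (fun z => f z 0 b *: (delta_mx 0 b : 'rV[R]_d)).
  by apply/funext => z; rewrite fct_sumE [LHS]row_sum_delta.
by apply: differentiable_sum => b; apply: differentiableZl.
Qed.

Lemma transition_differentiable i j x : cdom i x -> cdom j x ->
  differentiable (transition i j) (cmap i x).
Proof.
move=> xi xj; apply: differentiable_rV => b.
apply: (smooth_on_differentiable (@open_overlap i j)).
  exact: transition_smooth.
by exists x.
Qed.

Lemma transition_jacE i j x v : cdom i x -> cdom j x ->
  v *m transition_jac i j x = 'd (transition i j) (cmap i x) v.
Proof.
move=> xi xj; rewrite -deriveE ?deriveEjacobian //; exact: transition_differentiable.
Qed.

Lemma transition_jac_partial i j x a b : cdom i x -> cdom j x ->
  transition_jac i j x a b = partial a (fun y => transition i j y 0 b) (cmap i x).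
Proof.
move=> xi xj; have dT := transition_differentiable xi xj.
have := deriveEjacobian (delta_mx 0 a) dT.
rewrite derive_mx; last exact: diff_derivable.
by move=> /matrixP/(_ 0 b); rewrite mxE -rowE mxE => /esym.
Qed.

(* Keeps unification from comparing Jacobians by unfolding ['d]. *)
Opaque transition_jac.

(** The chain rule for the transition maps. The factorization through chart j holds only on the
    overlap of charts i and j, hence as an equality near [cmap i x], which is enough for
    derivatives. *)
Lemma transition_jac_comp i j k x : cdom i x -> cdom j x -> cdom k x ->
  transition_jac i k x = transition_jac i j x *m transition_jac j k x.
Proof.
move=> xi xj xk; apply/row_matrixP => a; rewrite !rowE mulmxA.
have dij := transition_differentiable xi xj.
have dik := transition_differentiable xi xk.
have djk : differentiable (transition j k) (transition i j (cmap i x)).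
  by rewrite (transition_cmap j xi); exact: (transition_differentiable xj xk).
have Tcomp : \forall y \near cmap i x, transition i k y =
    (transition j k \o transition i j) y.
  near=> y; have : (cmap i @` (cdom i `&` cdom j)) y.
    by near: y; apply: open_nbhs_nbhs; split; [apply: open_overlap|exists x].
  by rewrite overlapE /transition /= => -[iy yj]; rewrite cmapK.
apply: etrans (transition_jacE _ xi xk) _; apply/esym.
apply: etrans (transition_jacE _ xj xk) _.
apply: etrans (congr1 ('d (transition j k) (cmap j x)) (transition_jacE _ xi xj)) _.
apply/esym; apply: etrans (esym (deriveE _ dik)) _.
apply: etrans (near_eq_derive _ Tcomp) _.
apply: etrans (deriveE _ (differentiable_comp dij djk)) _.
apply: etrans (congr1 (fun h : _ -> _ => h _) (diff_comp dij djk)) _.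
by rewrite /comp transition_cmap.
Unshelve. all: by end_near. Qed.

Lemma transition_jac_id i x : cdom i x -> transition_jac i i x = 1%:M.
Proof.
move=> xi; apply/row_matrixP => a; rewrite !rowE mulmx1.
apply: etrans (transition_jacE _ xi xi) _.
apply: etrans (esym (deriveE _ (transition_differentiable xi xi))) _.
apply: etrans (near_eq_derive (g := id) _ _) (derive_id _ _).
near=> y; apply: (crangeP _).2; near: y.
by apply: open_nbhs_nbhs; split; [apply: open_crange|apply: crange_cmap].
Unshelve. all: by end_near. Qed.

Lemma transition_jac_smooth i j a b :
  smooth_on (cmap i @` (cdom i `&` cdom j)) (fun y => transition_jac i j (cinv i y) a b).
Proof.
apply: (@smooth_on_ext _ _ _ (@open_overlap i j)
    (partial a (fun y => transition i j y 0 b))).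
  move=> y; rewrite overlapE => -[iy yj]; have [yi yE] := crangeP iy.
  by rewrite transition_jac_partial // yE.
exact: smooth_on_partial a (@transition_smooth _ _ _ A i j b).
Qed.

Lemma transition_jacK i j x : cdom i x -> cdom j x ->
  transition_jac i j x *m transition_jac j i x = 1%:M.
Proof.
move=> xi xj; apply: etrans (esym (transition_jac_comp xi xj xi)) _.
exact: transition_jac_id.
Qed.

Lemma mulmx_transition_jac_neq0 i j x (v : 'rV[R]_d) : cdom i x -> cdom j x ->
  v != 0 -> v *m transition_jac i j x != 0.
Proof.
move=> xi xj; have JJ := transition_jacK xi xj.
move: (transition_jac i j x) (transition_jac j i x) JJ => J J' JJ.
by apply: contra => /eqP/(congr1 (mulmx^~ J')); rewrite -mulmxA JJ mulmx1 mul0mx => ->.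
Qed.

(** Extension by zero: the range of chart j is covered by two open sets, the overlap with chart i
    and the preimage of the complement of C, where f vanishes. *)
Lemma smooth_in_charts (C : set M) i j (f : M -> R) :
  closed C -> C `<=` cdom i -> (forall x, ~ C x -> f x = 0) ->
  smooth_on (cmap j @` (cdom j `&` cdom i)) (fun y => f (cinv j y)) ->
  smooth_on (crange j) (fun y => f (cinv j y)).
Proof.
move=> cC Ci f0 fs; apply: smooth_on_local => y jy.
have [yi|yi] := pselect (cdom i (cinv j y)).
  by exists (cmap j @` (cdom j `&` cdom i)); split => //; rewrite overlapE.
have oW := @open_chart_preimage j _ (closed_openC cC).
exists (crange j `&` cinv j @^-1` ~` C); split.
  by split => // /Ci.
apply: (@smooth_on_ext _ _ _ oW (fun=> 0)); last exact: smooth_on_cst.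
by move=> z [_ /f0 ->].
Qed.

End Charts.

(** * Partitions of unity on a compact Hausdorff manifold *)

Section CompactManifold.
Context {R : realType} {M : topologicalType} {d : nat}.
Variable A : smooth_atlas R M d.
Hypotheses (M_hausdorff : hausdorff_space M) (M_compact : compact [set: M]).
Local Notation cdom := (cdom A).
Local Notation cmap := (cmap A).
Local Notation cinv := (cinv A).
Implicit Types (i j k : cidx A) (x : M) (y v : 'rV[R]_d).

Lemma cinv_compact i (K : set 'rV[R]_d) : compact K -> K `<=` crange i ->
  compact (cinv i @` K).
Proof.
move=> cK Ki; apply: continuous_compact => //.
by apply: continuous_subspaceW Ki _; apply: cinv_continuous.
Qed.

Lemma cmap_compact i (C : set M) : closed C -> C `<=` cdom i -> compact (cmap i @` C).
Proof.
move=> cC Ci; apply: continuous_compact.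
  by apply: continuous_subspaceW Ci _; apply: cmap_continuous.
exact: subclosed_compact cC M_compact _.
Qed.

(** The flat function is applied to [e ^+ 2 - q] in one chart and extended by zero; its support lies
    in the image of a closed coordinate ball inside the chart. *)
Lemma coordinate_bump x0 : exists i (f : M -> R),
  [/\ forall x, 0 <= f x,
      forall j, smooth_on (crange j) (fun y => f (cinv j y)),
      closure [set x | f x != 0] `<=` cdom i &
      \forall x \near x0, 0 < f x].
Proof.
have [i x0i] := cdom_cover A x0.
pose y0 := cmap i x0.
have /nbhs_ballP[r /= r0 ry0] : nbhs y0 (crange i : set 'rV[R]_d).
  by apply: open_nbhs_nbhs; split; [apply: open_crange|apply: crange_cmap].
(* The squared Euclidean distance replaces the sup norm because it is a polynomial; with e = r / 2
   its ball of radius e lies strictly inside the sup-norm ball of radius r. *)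
pose q (y : 'rV[R]_d) := \sum_b (y 0 b - y0 0 b) ^+ 2.
pose e := r / 2; have e0 : 0 < e by rewrite divr_gt0.
pose K := [set y | q y <= e ^+ 2].
have qnorm y : q y <= e ^+ 2 -> `|y - y0| <= e.
  move=> qy; apply: mx_norm_le => [|a b]; first exact: ltW.
  rewrite ord1 !mxE -ler_sqr; [|exact: normr_ge0|exact: ltW].
  rewrite real_normK ?num_real //.
  apply: le_trans qy; rewrite /q (bigD1 b) //= lerDl.
  by apply: sumr_ge0 => c _; apply: sqr_ge0.
have qsmooth U : open U -> smooth_on U q.
  move=> oU; apply: smooth_on_sum => // b _; rewrite /=.
  have H : smooth_on U (fun y => y 0 b - y0 0 b).
    by apply: smooth_onB => //; [apply: smooth_on_coord|apply: smooth_on_cst].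
  by apply: (@smooth_on_ext _ _ _ oU (fun y => (y 0 b - y0 0 b) * (y 0 b - y0 0 b)));
    [move=> y _; rewrite expr2|apply: smooth_onM].
have qcont : continuous q.
  by move=> y; apply: (smooth_on_continuous (qsmooth setT openT)).
have Ki : K `<=` crange i.
  move=> y /qnorm H; apply: ry0; rewrite -ball_normE /= distrC (le_lt_trans H) //.
  by rewrite /e ltr_pdivrMr // ltr_pMr // ltr1n.
have cK : compact K.
  apply: (@subclosed_compact _ _ [set y | `|y| <= e + `|y0|]).
  - apply: (@closed_comp _ _ q [set s | s <= e ^+ 2]); last exact: closed_le.
    by move=> y _; apply: qcont.
  - exact: compact_norm_le.
  - move=> y /qnorm H /=; rewrite -(subrK y0 y) (le_trans (ler_normD _ _)) //.
    by rewrite lerD2r.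
pose C := cinv i @` K.
(* Here the Hausdorff property enters: the compact image of K is closed in M, so the bump is locally
   zero off it and the closure of its support stays in the chart. *)
have cC : closed C by apply: compact_closed => //; apply: cinv_compact.
have Ci : C `<=` cdom i by move=> x [y /Ki/crangeP[yi _] <-].
pose f x := if `[< cdom i x >] then bump 0 (e ^+ 2 - q (cmap i x)) else 0.
have fE x : cdom i x -> f x = bump 0 (e ^+ 2 - q (cmap i x)).
  by move=> xi; rewrite /f; case: asboolP.
have f_ge0 x : 0 <= f x by rewrite /f; case: ifP => // _; apply: bump_ge0.
have f0 x : ~ C x -> f x = 0.
  move=> xC; rewrite /f; case: asboolP => // xi; apply/eqP.
  rewrite eq_le bump_ge0 andbT leNgt bump_gt0 subr_gt0; apply/negP => H; apply: xC.
  by exists (cmap i x); [apply: ltW|rewrite cmapK].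
have fsmooth j : smooth_on (crange j) (fun y => f (cinv j y)).
  apply: (smooth_in_charts cC Ci f0).
  have oW := @open_overlap _ _ _ A j i.
  apply: (@smooth_on_ext _ _ _ oW (fun y => bump 0 (e ^+ 2 - q (transition j i y)))).
    by move=> y; rewrite overlapE => -[jy yi]; rewrite fE.
  apply: smooth_on_bump => //; apply: smooth_onB => //; first exact: smooth_on_cst.
  apply: smooth_on_sum => // b _.
  have H : smooth_on (cmap j @` (cdom j `&` cdom i)) (fun y => transition j i y 0 b - y0 0 b).
    by apply: smooth_onB => //; [apply: transition_smooth|apply: smooth_on_cst].
  by apply: (@smooth_on_ext _ _ _ oW
      (fun y => (transition j i y 0 b - y0 0 b) * (transition j i y 0 b - y0 0 b)));
    [move=> y _; rewrite expr2|apply: smooth_onM].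
exists i, f; split => //.
  apply: subset_trans Ci; rewrite [X in _ `<=` X](iffLR (closure_id C)) //.
  apply: closureS => x /= fx; apply: contrapT => /f0 fx0; by rewrite fx0 eqxx in fx.
have qx0 : q (cmap i x0) < e ^+ 2.
  by rewrite /q big1 ?exprn_gt0 // => b _; rewrite subrr expr0n.
have ci := cmap_continuous_at x0i.
have cq : {for x0, continuous (q \o cmap i)}.
  by apply: continuous_comp => //; apply: qcont.
have near1 : nbhs x0 (cdom i).
  by apply: open_nbhs_nbhs; split => //; apply: cdom_open.
have near2 : \forall x \near x0, q (cmap i x) < e ^+ 2 by apply: cvgr_lt cq _ qx0.
near=> x; rewrite fE; last by near: x; exact: near1.
by rewrite bump_gt0 subr_gt0; near: x.
Unshelve. all: by end_near. Qed.

(** Finitely many bumps whose positivity sets cover M have a positive sum; dividing by it normalizes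
    them without enlarging their supports. *)
Lemma partition_of_unity_exists : exists s, partition_of_unity (A := A) s.
Proof.
have [ix /choice [f fP]] := choice coordinate_bump.
have f_ge0 z x : 0 <= f z x by have [] := fP z.
have [D DM] := compact_finite_cover (f := fun z => [set x | 0 < f z x]) M_compact
  (fun z _ => let: And4 _ _ _ H := fP z in H).
pose S x := \sum_(z <- D) f z x.
have S0 x : 0 < S x.
  have [z zD fz] := DM x I.
  rewrite /S (big_rem z) //=; apply: (lt_le_trans fz); rewrite lerDl.
  by apply: sumr_ge0 => w _; apply: f_ge0.
exists [seq (ix z, fun x => f z x / S x) | z <- D]; split; last first.
  by move=> x; rewrite big_map /= -mulr_suml -/(S x) divff // gt_eqF.
move=> p /(@mapP {classic M})[z zD ->] /=; have [_ fs fi _] := fP z; split.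
- by move=> x; rewrite divr_ge0 // ltW.
- move=> j; apply: smooth_onM => //; first exact: open_crange.
  apply: smooth_onV => //; first exact: open_crange.
    by move=> y _; rewrite gt_eqF.
  apply: smooth_on_sum => //; first exact: open_crange.
  by move=> w _; have [_ ws _ _] := fP w; apply: ws.
- apply: subset_trans fi; apply: closureS => x /=.
  by rewrite mulf_eq0 negb_or => /andP[].
Qed.

(** [pou] falls back to the empty list when no partition exists, which would make every integral 0;
    existence excludes that branch. *)
Lemma pouP : partition_of_unity (pou A).
Proof.
rewrite /pou; case: pselect => [e|]; last by move=> /(_ partition_of_unity_exists).
by case: (cid e).
Qed.

End CompactManifold.

(** * Integration of densities *)

Section Integration.
Context {R : realType} {M : topologicalType} {d : nat}.
Variable A : smooth_atlas R M d.
Hypotheses (M_hausdorff : hausdorff_space M) (M_compact : compact [set: M]).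
Local Notation cdom := (cdom A).
Local Notation cmap := (cmap A).
Local Notation cinv := (cinv A).
Implicit Types (i j k : cidx A) (x : M) (y v : 'rV[R]_d) (rho : density_field A).
Implicit Types p : cidx A * (M -> R).

Let pA := pouP A M_hausdorff M_compact.

Lemma pou_ge0 p x : p \in pou A -> 0 <= p.2 x.
Proof. by move=> /pA.1[]. Qed.

Lemma pou_le1 p x : p \in pou A -> p.2 x <= 1.
Proof.
move=> pP; rewrite -(pA.2 x) (big_rem p) //= lerDl big_seq.
by apply: sumr_ge0 => q /mem_rem; apply: pou_ge0.
Qed.

Lemma pou_support p x : p \in pou A -> p.2 x != 0 -> cdom p.1 x.
Proof. by move=> /pA.1[_ _ H] px; apply: H; apply: subset_closure. Qed.

Lemma pou_neq0 x : exists2 p, p \in pou A & p.2 x != 0.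
Proof.
apply: contrapT => H; have := pA.2 x; rewrite big_seq big1 => [/esym/eqP|p pP].
  by rewrite oner_eq0.
by apply/eqP; apply: contraPT H => px; apply; exists p.
Qed.

Definition chart_support p : set 'rV[R]_d := cmap p.1 @` closure [set x | p.2 x != 0].

Lemma chart_support_compact p : p \in pou A -> compact (chart_support p).
Proof.
move=> /pA.1[_ _ H]; apply: cmap_compact => //; exact: closed_closure.
Qed.

Lemma chart_support_sub p : p \in pou A -> chart_support p `<=` crange p.1.
Proof. by move=> /pA.1[_ _ H] y [x /H xp <-]; apply: crange_cmap. Qed.

Lemma chart_support_out p y : crange p.1 y -> ~ chart_support p y -> p.2 (cinv p.1 y) = 0.
Proof.
move=> py yK; apply/eqP; apply: contra_notT yK => px.
by exists (cinv p.1 y); [apply: subset_closure|have [] := crangeP py].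
Qed.

(** One B serves every u, so whole families of integrands share a box. Continuity of u is asked on
    the support only: around any other point the product vanishes identically, whatever u does
    there. *)
Lemma pou_cc p : p \in pou A -> exists2 B, 0 <= B &
  forall u : 'rV[R]_d -> R, (forall y, chart_support p y -> {for y, continuous u}) ->
    cc B ((fun y => p.2 (cinv p.1 y) * u y) \_ (crange p.1)).
Proof.
move=> pP; have [_ ps _] := pA.1 p pP.
have cK := chart_support_compact pP; have Kp := chart_support_sub pP.
have clK : closed (chart_support p) by apply: compact_closed => //; apply: norm_hausdorff.
have [B0 [_ B0K]] := compact_bounded cK.
have KB y : chart_support p y -> `|y| <= `|B0| + 1.
  by apply: B0K; rewrite (le_lt_trans (ler_norm B0)) // ltrDl.
have near0 u y : ~ chart_support p y ->
    \forall z \near y, 0 = ((fun y => p.2 (cinv p.1 y) * u y) \_ (crange p.1)) z.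
  move=> yK; near=> z; rewrite patchE; case: ifP => //; rewrite inE => pz.
  rewrite chart_support_out ?mul0r //.
  by near: z; apply: open_nbhs_nbhs; split => //; apply: closed_openC.
(* The support lies within radius [|B0| + 1]; the larger bound places all y with [B <= |y|] outside
   it. *)
exists (`|B0| + 2) => [|u cu]; first by rewrite addr_ge0.
split=> [y|y By]; last first.
  apply/esym; apply: (nbhs_singleton (near0 u y _)) => /KB yB.
  have := le_trans By yB; lra.
have [yK|yK] := pselect (chart_support p y); last first.
  by apply: near_eq_continuous (near0 u y yK) _; apply: cst_continuous.
have py := Kp _ yK.
apply: (@near_eq_continuous _ _ (fun z => p.2 (cinv p.1 z) * u z)).
  apply: (open_near_eq (@open_crange _ _ _ A p.1)) => // z pz.
  by rewrite patchE mem_set.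
by apply: continuousM; [apply: smooth_on_continuous (ps p.1) py|apply: cu].
Unshelve. all: by end_near. Qed.

Definition chart_continuous rho := forall i y, crange i y ->
  {for y, continuous (fun z => rho i (cinv i z))}.

Lemma pou_rho_cc p : p \in pou A -> exists2 B, 0 <= B & forall rho, chart_continuous rho ->
    cc B ((fun y => p.2 (cinv p.1 y) * rho p.1 (cinv p.1 y)) \_ (crange p.1)).
Proof.
move=> pP; have [B B0 BB] := pou_cc pP; exists B => // rho cr; apply: BB => y /chart_support_sub.
by move=> /(_ pP); apply: cr.
Qed.

Lemma eq_integral_dens rho rho' : (forall i x, cdom i x -> rho i x = rho' i x) ->
  integral_dens rho = integral_dens rho'.
Proof.
move=> E; apply: eq_bigr => p _; congr integral_Rn; apply/funext => y; rewrite !patchE.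
by case: ifP => //; rewrite inE => /crangeP[py _]; rewrite E.
Qed.

Lemma integral_densZ c rho : chart_continuous rho ->
  integral_dens (fun i x => c * rho i x) = c * integral_dens rho.
Proof.
move=> cr; rewrite /integral_dens mulr_sumr !big_seq; apply: eq_bigr => p pP.
have [B B0 BB] := pou_rho_cc pP; have [_ iZ _ _ _] := @integral_Rn_spec R d B B0.
rewrite -iZ; last exact: BB.
congr integral_Rn; apply/funext => y; rewrite !patchE.
by case: ifP => _; rewrite ?mulr0 // mulrCA.
Qed.

Lemma le_integral_dens rho rho' : chart_continuous rho -> chart_continuous rho' ->
  (forall i x, cdom i x -> rho i x <= rho' i x) ->
  integral_dens rho <= integral_dens rho'.
Proof.
move=> cr cr' E; rewrite /integral_dens !big_seq; apply: ler_sum => p pP.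
have [B B0 BB] := pou_rho_cc pP.
apply: (integral_Rn_le B0); [exact: BB|exact: BB|].
move=> y; rewrite !patchE; case: ifP => //; rewrite inE => /crangeP[py _].
by apply: ler_wpM2l; [apply: pou_ge0|apply: E].
Qed.

Lemma integral_dens_ge0 rho : chart_continuous rho ->
  (forall i x, cdom i x -> 0 <= rho i x) -> 0 <= integral_dens rho.
Proof.
move=> cr r0; rewrite /integral_dens big_seq; apply: sumr_ge0 => p pP.
have [B B0 BB] := pou_rho_cc pP; have [_ _ _ ige0 _] := @integral_Rn_spec R d B B0.
apply: ige0; first exact: BB.
move=> y; rewrite patchE; case: ifP => //; rewrite inE => /crangeP[py _].
by apply: mulr_ge0; [apply: pou_ge0|apply: r0].
Qed.

(** Vanishing is obtained in the chart of p and where p is nonzero, since the integrand carries that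
    weight. By [pou_neq0] some such p exists at each x, and transformation laws then reach the other
    charts. *)
Lemma integral_dens_eq0 rho : chart_continuous rho ->
  (forall i x, cdom i x -> 0 <= rho i x) -> integral_dens rho = 0 ->
  forall p x, p \in pou A -> p.2 x != 0 -> rho p.1 x = 0.
Proof.
move=> cr r0 /eqP; rewrite /integral_dens big_seq psumr_eq0 => [/allP H p x pP px|p pP].
  have xp := pou_support pP px.
  have /implyP/(_ pP)/eqP := H p pP.
  have [B B0 BB] := pou_rho_cc pP; have [_ _ _ _ ieq0] := @integral_Rn_spec R d B B0.
  move=> /(ieq0 _ (BB _ cr))/wrap[].
    move=> y; rewrite patchE; case: ifP => //; rewrite inE => /crangeP[py _].
    by apply: mulr_ge0; [apply: pou_ge0|apply: r0].
  move=> /(_ (cmap p.1 x)); rewrite patchE mem_set; last exact: crange_cmap.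
  by rewrite cmapK // => /eqP; rewrite mulf_eq0 (negbTE px) => /eqP.
have [B B0 BB] := pou_rho_cc pP; have [_ _ _ ige0 _] := @integral_Rn_spec R d B B0.
apply: ige0; first exact: BB.
move=> y; rewrite patchE; case: ifP => //; rewrite inE => /crangeP[py _].
by apply: mulr_ge0; [apply: pou_ge0|apply: r0].
Qed.

End Integration.

(** * Volume densities, existence of metrics, conformal rescaling *)

Section Metrics.
Context {R : realType} {M : topologicalType} {d : nat}.
Variable A : smooth_atlas R M d.
Hypotheses (M_hausdorff : hausdorff_space M) (M_compact : compact [set: M]).
Local Notation cdom := (cdom A).
Local Notation cmap := (cmap A).
Local Notation cinv := (cinv A).
Implicit Types (i j k : cidx A) (x : M) (y v : 'rV[R]_d) (rho : density_field A).
Implicit Types (g h : tensor_field A).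

(** The empty determinant is 1, so [vol g] takes the normalizing value 0 outside the chart domain
    only in positive dimension. *)
Lemma detzero n : (0 < n)%N -> \det (0 : 'M[R]_n) = 0.
Proof. by case: n => // n _; rewrite det0. Qed.

Lemma Met_posdef g i x : Met A g -> cdom i x -> posdef (g i x).
Proof. by move=> [[gs _ _ _] gp] xi; split; [apply: gs|apply: gp]. Qed.

Lemma Met_det_gt0 g i x : Met A g -> cdom i x -> 0 < \det (g i x).
Proof. by move=> gM xi; apply: posdef_det_gt0; apply: Met_posdef. Qed.

Lemma vol_gt0 g i x : Met A g -> cdom i x -> 0 < vol g i x.
Proof. by move=> gM xi; rewrite sqrtr_gt0; apply: Met_det_gt0. Qed.

Lemma Sym2_smooth h i a b : Sym2 A h -> smooth_on (crange i) (fun y => h i (cinv i y) a b).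
Proof. by case=> _ _ + _; apply. Qed.

Lemma vol_Dens g : (0 < d)%N -> Met A g -> Dens A (vol g).
Proof.
move=> d0 gM; have [[gs gt gsm g0] gp] := gM; split.
- by move=> i x; apply: vol_gt0.
- move=> i j x xi xj; rewrite /vol (gt i j x xi xj) !det_mulmx det_tr mulrAC -expr2.
  by rewrite sqrtrM ?sqr_ge0 // sqrtr_sqr.
- move=> i; have oi := @open_crange _ _ _ A i.
  apply: smooth_on_sqrt => //; last by apply: smooth_on_det.
  by move=> y /crangeP[yi _]; apply: Met_det_gt0.
- by move=> i x /g0 gx; rewrite /vol gx detzero // sqrtr0.
Qed.

(* Glues the flat metrics of the charts with the partition of unity. *)
Lemma Met_nonempty : exists g, Met A g.
Proof.
have [ppos psum] := pouP A M_hausdorff M_compact.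
(* The Jacobians are replaced by a family J known only through its cocycle identity, injectivity and
   smoothness, the three facts from which the glued metric is built. *)
have [J [JC Jn0 Jsm JE]] : exists J : cidx A -> cidx A -> M -> 'M[R]_d,
    [/\ forall i j k x, cdom i x -> cdom j x -> cdom k x -> J i k x = J i j x *m J j k x,
        forall i j x v, cdom i x -> cdom j x -> v != 0 -> v *m J i j x != 0,
        forall i j a b, smooth_on (cmap i @` (cdom i `&` cdom j)) (fun y => J i j (cinv i y) a b) &
        forall i j x, transition_jac i j x = J i j x].
  exists (fun i j x => transition_jac i j x); split => //.
  - by move=> i j k x; apply: transition_jac_comp.
  - by move=> i j x v; apply: mulmx_transition_jac_neq0.
  - by move=> i j a b; apply: transition_jac_smooth.
pose S i x : 'M[R]_d := \sum_(p <- pou A) p.2 x *: (J i p.1 x *m (J i p.1 x)^T).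
pose g : tensor_field A := fun i x => if `[< cdom i x >] then S i x else 0.
have gE i x : cdom i x -> g i x = S i x by move=> xi; rewrite /g; case: asboolP.
(* The form is a weighted sum of squared lengths, each measured in one chart. At every x some weight
   is positive, and injectivity of that Jacobian makes its term positive. *)
have trace_quad v i x : (v *m S i x *m v^T) 0 0 =
    \sum_(p <- pou A) p.2 x * \sum_b ((v *m J i p.1 x) 0 b) ^+ 2.
  rewrite /S mulmx_sumr mulmx_suml summxE; apply: eq_bigr => p _.
  rewrite -scalemxAr -scalemxAl mxE; congr (_ * _).
  have -> : v *m (J i p.1 x *m (J i p.1 x)^T) *m v^T = (v *m J i p.1 x) *m (v *m J i p.1 x)^T.
    by rewrite trmx_mul !mulmxA.
  rewrite mxE; apply: eq_bigr => b _.
  by rewrite [X in _ * X]mxE expr2.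
exists g; split; last first.
  move=> i x xi v v0; rewrite gE // trace_quad.
  have [p pP px] := pou_neq0 A M_hausdorff M_compact x.
  have sq_ge0 q : 0 <= \sum_b ((v *m J i q x) 0 b) ^+ 2.
    by apply: sumr_ge0 => b _; apply: sqr_ge0.
  rewrite (big_rem p) //=; apply: ltr_wpDr.
    by rewrite big_seq; apply: sumr_ge0 => q /mem_rem qP; rewrite mulr_ge0 // (pou_ge0 M_hausdorff M_compact).
  apply: mulr_gt0; first by rewrite lt0r px (pou_ge0 M_hausdorff M_compact).
  rewrite lt0r sq_ge0 andbT psumr_eq0; last by move=> b _; apply: sqr_ge0.
  have xp := pou_support M_hausdorff M_compact pP px.
  have := Jn0 _ _ _ _ xi xp v0; apply: contra => /allP H; apply/eqP/rowP => b; rewrite [RHS]mxE; apply/eqP.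
  by have := H b (mem_index_enum b); rewrite sqrf_eq0.
split.
- move=> i x xi; rewrite gE // /S linear_sum /=; apply: eq_bigr => p _.
  by rewrite linearZ /= trmx_mul trmxK.
- move=> i j x xi xj; rewrite JE !gE // /S mulmx_sumr mulmx_suml !big_seq.
  apply: eq_bigr => p pP.
  have [->|px] := eqVneq (p.2 x) 0; first by rewrite !scale0r mulmx0 mul0mx.
  have xp := pou_support M_hausdorff M_compact pP px.
  rewrite -scalemxAr -scalemxAl; congr (_ *: _).
  by rewrite (JC i j) // trmx_mul !mulmxA.
- move=> i a b; have oi := @open_crange _ _ _ A i.
  apply: (@smooth_on_ext _ _ _ oi (fun y => \sum_(p <- pou A | p \in pou A) p.2 (cinv i y) *
      (J i p.1 (cinv i y) *m (J i p.1 (cinv i y))^T) a b)).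
    move=> y /crangeP[yi _]; rewrite gE // summxE [RHS]big_seq.
    by apply: eq_bigr => p _; rewrite !mxE.
  apply: smooth_on_sum => // p pP; have [_ ps psupp] := ppos p pP.
  (* [J i p.1] is smooth only on the overlap with chart [p.1]; the closed support of [p.2] permits
     extension by zero. *)
  apply: (@smooth_in_charts _ _ _ _ (closure [set x | p.2 x != 0]) p.1 i
    (fun x => p.2 x * (J i p.1 x *m (J i p.1 x)^T) a b)) => //.
  + exact: closed_closure.
  + move=> x px; have [->|px0] := eqVneq (p.2 x) 0; first by rewrite mul0r.
    by exfalso; apply: px; apply: subset_closure.
  have oW := @open_overlap _ _ _ A i p.1.
  apply: smooth_onM => //.
    apply: smooth_on_sub (ps i); rewrite overlapE; exact: subIsetl.
  apply: (@smooth_on_mulmx _ _ _ oW _ _ _ (fun y => J i p.1 (cinv i y))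
    (fun y => (J i p.1 (cinv i y))^T)) => // a' b'.
  apply: (@smooth_on_ext _ _ _ oW (fun y => J i p.1 (cinv i y) b' a')).
    by move=> y _; rewrite [RHS]mxE.
  exact: Jsm.
- by move=> i x xi; rewrite /g; case: asboolP.
Qed.

(* [vol (c g) = c^(d/2) vol g], so this metric has volume density [rho]. *)
Definition conformal rho g : tensor_field A :=
  fun i x => (rho i x / vol g i x) `^ (2 / d%:R) *: g i x.

Lemma conformal_Met rho g : Dens A rho -> Met A g -> Met A (conformal rho g).
Proof.
move=> [rpos rtr rsm r0] gM; have [[gs gt gsm g0] gp] := gM.
(* Both densities acquire the same factor, the absolute Jacobian determinant, so their ratio is a
   function on M and rescaling by it preserves the tensor law. *)
have ratio i j x : cdom i x -> cdom j x -> rho i x / vol g i x = rho j x / vol g j x.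
  move=> xi xj; have ri := rpos i x xi; move: ri; rewrite (rtr i j x xi xj).
  have -> : vol g i x = `|\det (transition_jac i j x)| * vol g j x.
    rewrite /vol (gt i j x xi xj) !det_mulmx det_tr mulrAC -expr2.
    by rewrite sqrtrM ?sqr_ge0 // sqrtr_sqr.
  have vj := vol_gt0 gM xj.
  move=> H; have D0 : `|\det (transition_jac i j x)| != 0.
    by apply: contraTneq H => ->; rewrite mul0r ltxx.
  by field; rewrite D0 gt_eqF.
have rv0 i x : cdom i x -> 0 < rho i x / vol g i x.
  by move=> xi; rewrite divr_gt0 ?rpos // vol_gt0.
split; first split.
- by move=> i x xi; rewrite linearZ /= gs.
- move=> i j x xi xj; rewrite /conformal (ratio i j x xi xj) {1}(gt i j x xi xj).
  by rewrite -scalemxAr -scalemxAl.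
- move=> i a b; have oi := @open_crange _ _ _ A i.
  apply: (@smooth_on_ext _ _ _ oi (fun y =>
      (rho i (cinv i y) / vol g i (cinv i y)) `^ (2 / d%:R) * g i (cinv i y) a b)).
    by move=> y _; rewrite !mxE.
  apply: smooth_onM => //; apply: smooth_on_powR => //.
    by move=> y /crangeP[yi _]; apply: rv0.
  apply: smooth_onM => //; apply: smooth_onV => //.
    by move=> y /crangeP[yi _]; rewrite gt_eqF // vol_gt0.
  apply: smooth_on_sqrt => //; last exact: smooth_on_det.
  by move=> y /crangeP[yi _]; apply: Met_det_gt0.
- by move=> i x /g0 gx; rewrite /conformal gx scaler0.
- move=> i x xi v v0; rewrite -scalemxAr -scalemxAl mxE mulr_gt0 ?gp //.
  by rewrite powR_gt0 // rv0.
Qed.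

Lemma conformal_vol rho g : (0 < d)%N -> Dens A rho -> Met A g -> vol (conformal rho g) = rho.
Proof.
move=> d0 [rpos rtr rsm r0] gM; have [[gs gt gsm g0] gp] := gM.
apply/funext => i; apply/funext => x; rewrite /vol detZ.
have [xi|xi] := pselect (cdom i x); last first.
  by rewrite g0 // r0 // detzero // mulr0 sqrtr0.
have v0 := vol_gt0 gM xi.
have rv : 0 < rho i x / vol g i x by rewrite divr_gt0 // rpos.
(* The determinant raises the factor to the power d, so (r^(2/d))^d = r^2, whose square root is the
   ratio r. *)
rewrite -powR_mulrn ?powR_ge0 // -powRrM divfK ?pnatr_eq0 -?lt0n //.
rewrite powR_mulrn ?ltW // sqrtrM ?sqr_ge0 // sqrtr_sqr gtr0_norm //.
by rewrite -/(vol g i x) divfK // gt_eqF.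
Qed.

End Metrics.

(** * Iterated directional derivatives and uniform estimates *)

Section BigSumDerivative.
Context {R : realType}.

Lemma is_derive_bigsum (V : normedModType R) (I : eqType) (r : seq I) (f : I -> V -> R)
    (df : I -> R) (x v : V) :
  (forall i, i \in r -> is_derive x v (f i) (df i)) ->
  is_derive x v (fun z => \sum_(i <- r) f i z) (\sum_(i <- r) df i).
Proof.
elim: r => [|i r IH] fr.
  rewrite big_nil (_ : (fun z => _) = cst 0); first exact: is_derive_cst.
  by apply/funext => z; rewrite big_nil.
rewrite big_cons (_ : (fun z => _) = f i + (fun z => \sum_(i <- r) f i z)); last first.
  by apply/funext => z; rewrite big_cons.
apply: is_deriveD; first by apply: fr; rewrite mem_head.
by apply: IH => j jr; apply: fr; rewrite in_cons jr orbT.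
Qed.

Lemma is_derive_scale (V : normedModType R) (f : V -> R) (c l : R) (x v : V) :
  is_derive x v f l -> is_derive x v (fun z => c * f z) (c * l).
Proof. by move=> fl; apply: (@is_deriveZ _ _ _ f c x v l). Qed.

End BigSumDerivative.

Section IteratedDerivatives.
Context {R : realType} {N : nat}.
Variables (U : set 'rV[R]_N) (L : 'rV[R]_N -> R).
Hypotheses (oU : open U) (sL : smooth_on U L).
Implicit Types (vs ws : seq 'rV[R]_N) (s : seq 'I_N) (z w : 'rV[R]_N).

(* [multi_derive vs [::] z] is the iterated directional derivative of [L] at [z] in the
   directions [vs], expanded in partial derivatives; [s] accumulates the indices. *)
Fixpoint multi_derive vs s : 'rV[R]_N -> R :=
  if vs is v :: vs' then fun z => \sum_a v 0 a * multi_derive vs' (rcons s a) z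
  else iter_partial s L.

Lemma smooth_on_iter_partial s : smooth_on U (iter_partial s L).
Proof.
have E t : iter_partial t (iter_partial s L) = iter_partial (t ++ s) L.
  by elim: t => //= a t ->.
by move=> t y Uy; rewrite E; apply: sL.
Qed.

(** The new index goes to the front of s, as the outermost partial, while [multi_derive] appends at
    the rear. For empty s the right-hand side is therefore [multi_derive (w :: vs) [::] z] by
    computation. *)
Lemma multi_derive_is_derive vs s z w : U z ->
  is_derive z w (multi_derive vs s) (\sum_a w 0 a * multi_derive vs (a :: s) z).
Proof.
move=> Uz; elim: vs s => [|v vs IH] s /=.
  exact: (smooth_on_is_derive w oU (smooth_on_iter_partial s) Uz).
have -> : \sum_a w 0 a * (\sum_b v 0 b * multi_derive vs (a :: rcons s b) z) =
    \sum_b v 0 b * (\sum_a w 0 a * multi_derive vs (a :: rcons s b) z).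
  under eq_bigr do rewrite mulr_sumr.
  rewrite exchange_big; apply: eq_bigr => b _; rewrite mulr_sumr.
  by apply: eq_bigr => a _; rewrite mulrCA.
by apply: is_derive_bigsum => b _; apply: is_derive_scale; apply: IH.
Qed.

Lemma multi_derive_cvg (T : Type) (F : set_system T) (FF : Filter F)
    (V : T -> seq 'rV[R]_N) (G : T -> 'rV[R]_N) vs z s : U z ->
  (\forall x \near F, size (V x) = size vs) ->
  (forall k, (k < size vs)%N -> nth 0 (V x) k @[x --> F] --> nth 0 vs k) ->
  G x @[x --> F] --> z ->
  multi_derive (V x) s (G x) @[x --> F] --> multi_derive vs s z.
Proof.
move=> Uz + + Gz; elim: vs V s => [|v vs IH] V s sV cV.
  have c0 : iter_partial s L (G x) @[x --> F] --> iter_partial s L z.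
    apply: (cvg_comp _ _ Gz).
    exact: smooth_on_continuous (smooth_on_iter_partial s) Uz.
  apply: cvg_trans c0; apply: near_eq_cvg.
  by apply: filterS sV => x /size0nil ->.
have c1 : \sum_a (head 0 (V x)) 0 a * multi_derive (behead (V x)) (rcons s a) (G x) @[x --> F]
    --> \sum_a v 0 a * multi_derive vs (rcons s a) z.
  apply: cvg_sumr => a _; apply: cvgM.
    apply: (@cvg_comp _ _ _ (fun x => head 0 (V x)) (fun u : 'rV[R]_N => u 0 a) _ (nbhs v)).
      have := cV 0%N isT; rewrite /=; apply: cvg_trans; apply: near_eq_cvg.
      by near=> x; rewrite nth0.
    exact: coord_continuous.
  apply: IH; first by apply: filterS sV => x; rewrite size_behead => ->.
  move=> k kv; have := cV k.+1 kv; apply: cvg_trans; apply: near_eq_cvg.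
  by near=> x; rewrite nth_behead.
apply: cvg_trans c1; apply: near_eq_cvg.
by apply: filterS sV => x; case: (V x).
Unshelve. all: by end_near. Qed.

Lemma multi_derive_eps vs z (e : R) : U z -> 0 < e ->
  exists2 r : R, 0 < r & forall ws w, size ws = size vs ->
    (forall k, (k < size vs)%N -> `|nth 0 ws k - nth 0 vs k| <= r) -> `|w - z| <= r ->
    `|multi_derive ws [::] w - multi_derive vs [::] z| <= e.
Proof.
move=> Uz e0.
(* These sets are a base for convergence of a base point together with a list of directions of fixed
   length; the limit lemma along their filter yields one radius for all arguments. *)
pose B (r : R) := [set x : seq 'rV[R]_N * 'rV[R]_N |
  [/\ size x.1 = size vs, forall k, (k < size vs)%N -> `|nth 0 x.1 k - nth 0 vs k| <= r &
    `|x.2 - z| <= r]].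
pose F := filter_from [set r : R | 0 < r] B.
have FF : Filter F.
  apply: filter_from_filter; first by exists 1 => /=.
  move=> r1 r2 /= r10 r20; exists (Num.min r1 r2); first by rewrite /= lt_min r10.
  move=> x [sx kx zx]; split; split => // [k kv|].
  - by have := kx k kv; rewrite le_min => /andP[].
  - by move: zx; rewrite le_min => /andP[].
  - by have := kx k kv; rewrite le_min => /andP[].
  - by move: zx; rewrite le_min => /andP[].
have H : multi_derive x.1 [::] x.2 @[x --> F] --> multi_derive vs [::] z.
  apply: multi_derive_cvg => //.
  - by exists 1; [exact: ltr01|move=> x []].
  - move=> k kv; apply/cvgrPdist_le => r r0.
    by exists r => // x [_ /(_ k kv) + _]; rewrite distrC.
  - by apply/cvgrPdist_le => r r0; exists r => // x [_ _]; rewrite distrC.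
have /cvgrPdist_le/(_ e e0)[r r0 rB] := H.
exists r => // ws w sw kw ww.
by rewrite distrC; apply: (rB (ws, w)).
Qed.

End IteratedDerivatives.

(** * First-order expansions uniform over a compact set *)

Section UniformEstimates.
Context {R : realType} {N d : nat}.
Variables (U : set 'rV[R]_N) (L : 'rV[R]_N -> R).
Hypotheses (oU : open U) (sL : smooth_on U L).
Variables (K : set 'rV[R]_d) (cK : compact K).
Variable z : 'rV[R]_d -> 'rV[R]_N.
Hypotheses (cz : forall y, K y -> {for y, continuous z}) (Uz : forall y, K y -> U (z y)).
Variable vs : seq ('rV[R]_d -> 'rV[R]_N).
Hypothesis cvs : forall v, v \in vs -> forall y, K y -> {for y, continuous v}.

Let vsat y := [seq v y | v <- vs].

Let near_vs y0 (r : R) : K y0 -> 0 < r ->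
  \forall y \near y0, forall k, (k < size vs)%N -> `|nth 0 (vsat y) k - nth 0 (vsat y0) k| <= r.
Proof.
move=> Ky0 r0; rewrite /vsat; elim: vs cvs => [|v ws IH] cws; first by near=> y.
have cv : {for y0, continuous v} by apply: cws => //; rewrite mem_head.
have H1 : \forall y \near y0, `|v y - v y0| <= r.
  by have /cvgrPdist_le/(_ r r0) := cv; apply: filterS => y; rewrite distrC.
have H2 := IH (fun w wws => cws w (mem_behead (s := v :: ws) wws)).
by apply: filterS2 H1 H2 => y vy wy [|k] //= kw; apply: wy.
Unshelve. all: by end_near. Qed.

Lemma near_uniform_domain (w : 'rV[R]_d -> 'rV[R]_N) :
  (forall y, K y -> {for y, continuous w}) ->
  \forall t \near (0 : R), forall y, K y -> U (z y + t *: w y).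
Proof.
move=> cw; apply: (@compact_near_uniform _ _ _ _ (nbhs_filter (0 : R)) (fun t y => U (z y + t *: w y)) cK) => y Ky.
have c : z x.1 + x.2 *: w x.1 @[x --> (y, 0 : R)] --> z y.
  have E : z y = z y + 0 *: w y by rewrite scale0r addr0.
  rewrite [X in _ --> X]E; apply: cvgD.
    by apply: (@cvg_comp _ _ _ fst z _ (nbhs y)); [apply: cvg_fst|apply: cz].
  apply: cvgZ; first exact: cvg_snd.
  by apply: (@cvg_comp _ _ _ fst w _ (nbhs y)); [apply: cvg_fst|apply: cw].
by apply: c; apply: open_nbhs_nbhs; split => //; apply: Uz.
Qed.

(** The mean value theorem turns the remainder into t times an increment of the next derivative
    along the segment, and the tube lemma makes that increment small uniformly in y. *)
Lemma near_uniform_derivative (w : 'rV[R]_d -> 'rV[R]_N) (e : R) :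
  (forall y, K y -> {for y, continuous w}) -> 0 < e ->
  \forall t \near (0 : R), forall y, K y ->
    `|multi_derive L (vsat y) [::] (z y + t *: w y) - multi_derive L (vsat y) [::] (z y)
      - t * multi_derive L (w y :: vsat y) [::] (z y)| <= e * `|t|.
Proof.
move=> cw e0.
have := near_uniform_domain cw => /nbhs_ballP[r1 /= r10 r1U].
have H : \forall t \near (0 : R), forall y, K y -> forall s : R, `|s| <= `|t| ->
    `|multi_derive L (w y :: vsat y) [::] (z y + s *: w y) -
      multi_derive L (w y :: vsat y) [::] (z y)| <= e.
  apply: (@compact_near_uniform _ _ _ _ (nbhs_filter (0 : R)) (fun t y => forall s : R, `|s| <= `|t| ->
    `|multi_derive L (w y :: vsat y) [::] (z y + s *: w y) -
      multi_derive L (w y :: vsat y) [::] (z y)| <= e) cK) => y0 Ky0.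
  have [r r0 rP] := multi_derive_eps sL (w y0 :: vsat y0) (Uz Ky0) (divr_gt0 e0 (ltr0n _ 2)).
  (* Half of the radius pays for moving the base point from y0 to y, the other half for the step
     [s *: w y], whose direction is locally bounded by [|w y0| + 1]. *)
  have r2 : 0 < r / 2 by rewrite divr_gt0.
  have nw1 : \forall y \near y0, `|w y - w y0| <= r.
    by have /cvgrPdist_le/(_ r r0) := cw y0 Ky0; apply: filterS => y; rewrite distrC.
  have nw2 : \forall y \near y0, `|w y| <= `|w y0| + 1.
    have /cvgrPdist_le/(_ 1 ltr01) := cw y0 Ky0; apply: filterS => y H.
    by rewrite -(subrK (w y0) (w y)) addrC (le_trans (ler_normD _ _)) // lerD2l distrC.
  have nz : \forall y \near y0, `|z y - z y0| <= r / 2.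
    by have /cvgrPdist_le/(_ _ r2) := cz Ky0; apply: filterS => y; rewrite distrC.
  have nv := near_vs Ky0 r0.
  have w1 : 0 < `|w y0| + 1 by rewrite ltr_wpDl.
  exists ([set y | [/\ `|w y - w y0| <= r, `|w y| <= `|w y0| + 1, `|z y - z y0| <= r / 2 &
      forall k, (k < size vs)%N -> `|nth 0 (vsat y) k - nth 0 (vsat y0) k| <= r]],
      [set t : R | `|t| <= r / 2 / (`|w y0| + 1)]).
    split => /=; first by near=> y; split; near: y.
    apply/nbhs_ballP; exists (r / 2 / (`|w y0| + 1)); first by rewrite /= divr_gt0.
    by move=> t; rewrite /ball /= sub0r normrN => /ltW.
  move=> [y t] [/= [y1 y2 y3 y4] tr] s st.
  have close (s' : R) : `|s'| <= `|t| -> `|multi_derive L (w y :: vsat y) [::] (z y + s' *: w y) -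
      multi_derive L (w y0 :: vsat y0) [::] (z y0)| <= e / 2.
    move=> s't; apply: rP => //=; first by rewrite !size_map.
      by move=> [|k] //=; rewrite ltnS size_map; apply: y4.
    rewrite addrAC (le_trans (ler_normD _ _)) // [leRHS](splitr r) lerD // normrZ.
    rewrite (le_trans (ler_pM _ _ (le_trans s't tr) y2)) //.
    by rewrite divfK // gt_eqF.
  have := close 0; rewrite normr0 scale0r addr0 => /(_ (normr_ge0 _)) c0.
  have cs := close s st.
  rewrite (splitr e) -(subrKA (multi_derive L (w y0 :: vsat y0) [::] (z y0))).
  by rewrite (le_trans (ler_normD _ _)) // lerD // distrC.
near=> t => y Ky.
have tr1 : `|t| < r1.
  near: t; apply/nbhs_ballP; exists r1 => // t.
  by rewrite /ball /= sub0r normrN.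
have [|c ct E] := @MVT0 R (fun s => multi_derive L (vsat y) [::] (z y + s *: w y))
    (fun s => multi_derive L (w y :: vsat y) [::] (z y + s *: w y)) t.
  move=> s st; apply: is_derive_at; apply: (multi_derive_is_derive oU sL).
  by apply: (r1U s _ y Ky); rewrite /ball /= sub0r normrN (le_lt_trans st).
move: E; rewrite scale0r addr0 => ->.
rewrite (mulrC t) -mulrBl normrM ler_wpM2r //.
have Ht : forall y, K y -> forall s : R, `|s| <= `|t| ->
    `|multi_derive L (w y :: vsat y) [::] (z y + s *: w y) -
      multi_derive L (w y :: vsat y) [::] (z y)| <= e by near: t.
exact: Ht.
Unshelve. all: by end_near. Qed.

(** Here the radius r itself is the variable tending to 0, so the tube lemma produces one radius
    valid for every y in K. *)
Lemma near_uniform_continuity (e : R) : 0 < e ->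
  \forall r \near (0 : R), forall y, K y -> forall ws w, size ws = size vs ->
    (forall k, (k < size vs)%N -> `|nth 0 ws k - nth 0 (vsat y) k| <= r) -> `|w - z y| <= r ->
    `|multi_derive L ws [::] w - multi_derive L (vsat y) [::] (z y)| <= e.
Proof.
move=> e0.
apply: (@compact_near_uniform _ _ _ _ (nbhs_filter (0 : R)) (fun r y => forall ws w, size ws = size vs ->
    (forall k, (k < size vs)%N -> `|nth 0 ws k - nth 0 (vsat y) k| <= r) -> `|w - z y| <= r ->
    `|multi_derive L ws [::] w - multi_derive L (vsat y) [::] (z y)| <= e) cK) => y0 Ky0.
have [r r0 rP] := multi_derive_eps sL (vsat y0) (Uz Ky0) (divr_gt0 e0 (ltr0n _ 2)).
have r2 : 0 < r / 2 by rewrite divr_gt0.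
have nz : \forall y \near y0, `|z y - z y0| <= r / 2.
  by have /cvgrPdist_le/(_ _ r2) := cz Ky0; apply: filterS => y; rewrite distrC.
have nv := near_vs Ky0 r2.
exists ([set y | `|z y - z y0| <= r / 2 /\
    forall k, (k < size vs)%N -> `|nth 0 (vsat y) k - nth 0 (vsat y0) k| <= r / 2],
    [set t : R | `|t| <= r / 2]).
  split => /=; first by near=> y; split; near: y.
  apply/nbhs_ballP; exists (r / 2) => // t.
  by rewrite /ball /= sub0r normrN => /ltW.
move=> [y t] [/= [y1 y2] tr] ws w sw wk wz.
have tr' : t <= r / 2 := le_trans (ler_norm t) tr.
have rr : r / 2 <= r by lra.
have c1 : `|multi_derive L ws [::] w - multi_derive L (vsat y0) [::] (z y0)| <= e / 2.
  apply: rP; first by rewrite size_map.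
    move=> k; rewrite size_map => kv.
    rewrite -(subrKA (nth 0 (vsat y) k)) (le_trans (ler_normD _ _)) //.
    by rewrite (splitr r) lerD ?y2 // (le_trans (wk k kv)).
  rewrite -(subrKA (z y)) (le_trans (ler_normD _ _)) //.
  by rewrite (splitr r) lerD // (le_trans wz).
have c2 : `|multi_derive L (vsat y) [::] (z y) - multi_derive L (vsat y0) [::] (z y0)| <= e / 2.
  apply: rP; first by rewrite !size_map.
    by move=> k; rewrite size_map => kv; rewrite (le_trans (y2 k kv)).
  exact: le_trans y1 rr.
rewrite (splitr e) -(subrKA (multi_derive L (vsat y0) [::] (z y0))).
by rewrite (le_trans (ler_normD _ _)) // lerD // distrC.
Unshelve. all: by end_near. Qed.

End UniformEstimates.

(** * The integrand as a smooth function of a pair of matrices *)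

Section PairEncoding.
Context {R : realType} {d : nat}.
Local Notation N := (d * d + d * d)%N.

(** Flattens a pair of matrices into one row vector, so that the calculus on R^N applies to
    functions of two matrices. *)
Definition enc (G : 'M[R]_d * 'M[R]_d) : 'rV[R]_N := row_mx (mxvec G.1) (mxvec G.2).
Definition dec0 (z : 'rV[R]_N) : 'M[R]_d := vec_mx (lsubmx z).
Definition dec1 (z : 'rV[R]_N) : 'M[R]_d := vec_mx (rsubmx z).

Lemma enc0K G : dec0 (enc G) = G.1.
Proof. by rewrite /dec0 row_mxKl mxvecK. Qed.

Lemma enc1K G : dec1 (enc G) = G.2.
Proof. by rewrite /dec1 row_mxKr mxvecK. Qed.

Lemma encD G H (t : R) : enc (G.1 + t *: H.1, G.2 + t *: H.2) = enc G + t *: enc H.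
Proof. by rewrite /enc /= scale_row_mx add_row_mx !linearD !linearZ. Qed.

Lemma enc_coord G j : exists a b, enc G 0 j = G.1 a b \/ enc G 0 j = G.2 a b.
Proof.
case: (split_ordP j) => k ->; case/mxvec_indexP: k => a b; exists a, b.
  by left; rewrite row_mxEl mxvecE.
by right; rewrite row_mxEr mxvecE.
Qed.

Lemma enc_norm_le (G : 'M[R]_d * 'M[R]_d) (e : R) : 0 <= e ->
  (forall a b, `|G.1 a b| <= e) -> (forall a b, `|G.2 a b| <= e) -> `|enc G| <= e.
Proof.
move=> e0 G0 G1; apply: mx_norm_le => // i j; rewrite ord1.
by have [a [b [->|->]]] := enc_coord G j.
Qed.

Lemma enc_cvg (T : Type) (F : set_system T) (FF : Filter F) (f0 f1 : T -> 'M[R]_d) (G0 G1 : 'M[R]_d) :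
  (forall a b, f0 x a b @[x --> F] --> G0 a b) ->
  (forall a b, f1 x a b @[x --> F] --> G1 a b) ->
  enc (f0 x, f1 x) @[x --> F] --> enc (G0, G1).
Proof.
move=> h0 h1; apply: cvg_mx_coord => i j; rewrite ord1.
case: (split_ordP j) => k ->; case/mxvec_indexP: k => a b.
  rewrite row_mxEl mxvecE /=; under eq_cvg do rewrite row_mxEl mxvecE /=.
  exact: h0.
rewrite row_mxEr mxvecE /=; under eq_cvg do rewrite row_mxEr mxvecE /=.
exact: h1.
Qed.

Definition KL_density (G0 G1 : 'M[R]_d) : R :=
  (\tr (invmx G1 *m G0) - 2 * ln (Num.sqrt (\det G0) / Num.sqrt (\det G1)) - d%:R)
  * Num.sqrt (\det G1).

Definition KL_coord (z : 'rV[R]_N) : R := KL_density (dec0 z) (dec1 z).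

(** The natural domain of the formula: inverse, logarithm and square root are smooth where the two
    determinants are positive, and this set is visibly open and contains all pairs of positive
    definite matrices. *)
Definition KL_dom : set 'rV[R]_N := [set z | 0 < \det (dec0 z) /\ 0 < \det (dec1 z)].

Lemma dec0_smooth (V : set 'rV[R]_N) a b : open V -> smooth_on V (fun z => dec0 z a b).
Proof.
move=> oV; apply: (@smooth_on_ext _ _ _ oV (fun z => z 0 (lshift _ (mxvec_index a b)))).
  by move=> z _; rewrite !mxE.
exact: smooth_on_coord.
Qed.

Lemma dec1_smooth (V : set 'rV[R]_N) a b : open V -> smooth_on V (fun z => dec1 z a b).
Proof.
move=> oV; apply: (@smooth_on_ext _ _ _ oV (fun z => z 0 (rshift _ (mxvec_index a b)))).
  by move=> z _; rewrite !mxE.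
exact: smooth_on_coord.
Qed.

Lemma KL_dom_open : open KL_dom.
Proof.
have co (F : 'rV[R]_N -> 'M[R]_d) : (forall a b, smooth_on setT (fun z => F z a b)) ->
    open [set z | 0 < \det (F z)].
  move=> sF; apply: (@open_comp _ _ (fun z => \det (F z)) [set r | 0 < r]).
    by move=> z _; apply: (smooth_on_continuous (smooth_on_det openT sF)).
  exact: open_gt.
by apply: openI; apply: co => a b; [apply: dec0_smooth|apply: dec1_smooth]; apply: openT.
Qed.

Lemma KL_coord_smooth : smooth_on KL_dom KL_coord.
Proof.
have oU := KL_dom_open.
have sd0 : smooth_on KL_dom (fun z => \det (dec0 z)).
  by apply: (smooth_on_det oU) => a b; apply: dec0_smooth oU.
have sd1 : smooth_on KL_dom (fun z => \det (dec1 z)).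
  by apply: (smooth_on_det oU) => a b; apply: dec1_smooth oU.
have ss0 : smooth_on KL_dom (fun z => Num.sqrt (\det (dec0 z))).
  by apply: (smooth_on_sqrt oU) => // z [].
have ss1 : smooth_on KL_dom (fun z => Num.sqrt (\det (dec1 z))).
  by apply: (smooth_on_sqrt oU) => // z [].
apply: (smooth_onM oU _ ss1); apply: (smooth_onB oU); last exact: smooth_on_cst oU _.
apply: (smooth_onB oU).
  apply: (smooth_on_sum oU) => a _.
  apply: (@smooth_on_mulmx _ _ _ oU _ _ _ (fun z => invmx (dec1 z)) (fun z => dec0 z)).
    apply: (smooth_on_invmx oU) => [z [_ z1]|b c]; first by rewrite gt_eqF.
    exact: dec1_smooth oU.
  by move=> b c; apply: dec0_smooth oU.
apply: (smooth_onM oU); first exact: smooth_on_cst oU _.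
apply: (smooth_on_ln oU).
  by move=> z [z0 z1]; rewrite divr_gt0 // sqrtr_gt0.
apply: (smooth_onM oU ss0); apply: (smooth_onV oU _ ss1) => z [_ z1].
by rewrite gt_eqF // sqrtr_gt0.
Qed.

End PairEncoding.

Lemma near_seq_all (T : Type) (F : set_system T) (FF : Filter F) (I : eqType) (r : seq I)
    (P : I -> T -> Prop) :
  (forall i, i \in r -> \forall x \near F, P i x) ->
  \forall x \near F, forall i, i \in r -> P i x.
Proof.
elim: r => [|i r IH] Pr; first by near=> x => i; rewrite in_nil.
have P1 := Pr i (mem_head i r).
have P2 := IH (fun j jr => Pr j (mem_behead (s := i :: r) jr)).
apply: filterS2 P1 P2 => x Px Prx j; rewrite in_cons => /orP[/eqP -> //|]; exact: Prx.
Unshelve. all: by end_near. Qed.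

(** * Differentiating the functional under the integral sign *)

Section Functional.
Context {R : realType} {M : topologicalType} {d : nat}.
Variable A : smooth_atlas R M d.
Hypotheses (M_hausdorff : hausdorff_space M) (M_compact : compact [set: M]).
Local Notation cdom := (cdom A).
Local Notation cmap := (cmap A).
Local Notation cinv := (cinv A).
Local Notation N := (d * d + d * d)%N.
Local Notation fields := (tensor_field A * tensor_field A)%type.
Local Notation L := (@KL_coord R d).
Implicit Types (q v : fields) (vs ws : seq fields) (p : cidx A * (M -> R)).

Definition eval_pair i (y : 'rV[R]_d) v : 'rV[R]_N :=
  enc (v.1 i (cinv i y), v.2 i (cinv i y)).

Lemma eval_pairD i y q v (t : R) :
  eval_pair i y (q + t *: v) = eval_pair i y q + t *: eval_pair i y v.
Proof.
exact: (encD (q.1 i (cinv i y), q.2 i (cinv i y)) (v.1 i (cinv i y), v.2 i (cinv i y)) t).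
Qed.

Definition regular_dir v := forall p, p \in pou A -> forall y, chart_support p y ->
  {for y, continuous (fun y => eval_pair p.1 y v)}.

(** Differentiating at q involves q + t v for small t. The conditions are imposed on the compact
    chart supports alone, so they survive such a perturbation by any regular direction. *)
Definition regular q := regular_dir q /\
  forall p, p \in pou A -> forall y, chart_support p y -> KL_dom (eval_pair p.1 y q).

Definition KL_deriv vs q : R := 2^-1 * \sum_(p <- pou A) integral_Rn
  ((fun y => p.2 (cinv p.1 y) *
     multi_derive L [seq eval_pair p.1 y v | v <- vs] [::] (eval_pair p.1 y q))
   \_ (crange p.1)).

Lemma Sym2_regular_dir v : Sym2xSym2 v -> regular_dir v.
Proof.
move=> [v1 v2] p pP y /(chart_support_sub M_hausdorff M_compact pP) py.
by apply: (@enc_cvg _ _ _ _ (nbhs_filter y)) => a b;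
  apply: (smooth_on_continuous _ py); apply: Sym2_smooth.
Qed.

Lemma Met_regular q : (Met A `*` Met A) q -> regular q.
Proof.
move=> [q1 q2]; split; first by apply: Sym2_regular_dir; split; [case: q1|case: q2].
move=> p pP y /(chart_support_sub M_hausdorff M_compact pP)/crangeP[py _].
by rewrite /KL_dom /= enc0K enc1K; split; apply: Met_det_gt0 py.
Qed.

Lemma KL_Met_deriv q : KL_Met A q.1 q.2 = KL_deriv [::] q.
Proof.
congr (_ * _); apply: eq_bigr => p _; congr integral_Rn; congr (_ \_ _).
by apply/funext => y; rewrite /= /KL_coord enc0K enc1K.
Qed.

Let fieldmap p vs := [seq (fun y => eval_pair p.1 y v) | v <- vs].

Let fieldmapE p vs y : [seq u y | u <- fieldmap p vs] = [seq eval_pair p.1 y v | v <- vs].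
Proof. by rewrite -map_comp. Qed.

Let fieldmap_cont p vs : p \in pou A -> (forall v, v \in vs -> regular_dir v) ->
  forall u, u \in fieldmap p vs -> forall y, chart_support p y -> {for y, continuous u}.
Proof. by move=> pP vr u /mapP[v /vr vreg ->] y; apply: vreg. Qed.

Lemma regular_near q v : regular q -> regular_dir v ->
  \forall t \near (0 : R), regular (q + t *: v).
Proof.
move=> [cq Uq] cv.
have : \forall t \near (0 : R), forall p, p \in pou A -> forall y, chart_support p y ->
    KL_dom (eval_pair p.1 y q + t *: eval_pair p.1 y v).
  apply: (@near_seq_all _ _ (nbhs_filter (0 : R))) => p pP.
  have cK := chart_support_compact M_hausdorff M_compact pP.
  exact: (@near_uniform_domain _ _ _ _ KL_dom_open _ cK _ (cq p pP) (Uq p pP) _ (cv p pP)).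
apply: filterS => t H; split => [p pP y Ky|p pP y Ky]; last by rewrite eval_pairD; apply: H.
have -> : (fun y => eval_pair p.1 y (q + t *: v)) =
    (fun y => eval_pair p.1 y q + t *: eval_pair p.1 y v).
  by apply/funext => z; rewrite eval_pairD.
apply: continuousD; first exact: cq.
by apply: continuousZr; apply: cv.
Qed.

Lemma multi_derive_continuous p vs q : p \in pou A -> regular q ->
  (forall v, v \in vs -> regular_dir v) ->
  forall y, chart_support p y -> {for y, continuous (fun y =>
    multi_derive L [seq eval_pair p.1 y v | v <- vs] [::] (eval_pair p.1 y q))}.
Proof.
move=> pP [cq Uq] cv y Ky.
apply: (@multi_derive_cvg R _ _ _ KL_coord_smooth _ _ (nbhs_filter y)
  (fun z => [seq eval_pair p.1 z v | v <- vs]) (fun z => eval_pair p.1 z q)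
  [seq eval_pair p.1 y v | v <- vs] (eval_pair p.1 y q) [::] (Uq p pP y Ky)).
- by near=> z; rewrite !size_map.
- move=> k; rewrite size_map => kv; rewrite (nth_map 0) //.
  under eq_cvg do rewrite (nth_map 0) //.
  by apply: cv => //; apply: mem_nth.
- exact: (cq p pP y Ky).
Unshelve. all: by end_near. Qed.

Lemma pou_cc_uniform : exists2 B, 0 <= B & forall p, p \in pou A ->
  forall u : 'rV[R]_d -> R, (forall y, chart_support p y -> {for y, continuous u}) ->
    cc B ((fun y => p.2 (cinv p.1 y) * u y) \_ (crange p.1)).
Proof.
have : forall p, p \in pou A -> exists2 B, 0 <= B &
  forall u : 'rV[R]_d -> R, (forall y, chart_support p y -> {for y, continuous u}) ->
    cc B ((fun y => p.2 (cinv p.1 y) * u y) \_ (crange p.1)).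
  by move=> p pP; apply: pou_cc.
elim: (pou A) => [|p s IH] H; first by exists 0.
have [B B0 HB] := H p (mem_head p s).
have [C C0 HC] := IH (fun p' ps => H p' (mem_behead (s := p :: s) ps)).
exists (B + C); first by rewrite addr_ge0.
have mono (B' : R) f : B' <= B + C -> cc B' f -> cc (B + C) f.
  by move=> BB [cf f0]; split => // y By; apply: f0; apply: le_trans By.
move=> p'; rewrite in_cons => /orP[/eqP -> u cu|ps u cu].
  by apply: mono (HB u cu); rewrite lerDl.
by apply: mono (HC p' ps u cu); rewrite lerDr.
Qed.

Lemma pou_integral_is_derive p (f : R -> 'rV[R]_d -> R) (df : 'rV[R]_d -> R) :
  p \in pou A ->
  (forall y, chart_support p y -> {for y, continuous df}) ->
  (\forall t \near (0 : R), forall y, chart_support p y -> {for y, continuous (f t)}) ->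
  (forall e, 0 < e -> \forall t \near (0 : R), forall y, chart_support p y ->
     `|f t y - f 0 y - t * df y| <= e * `|t|) ->
  is_derive (0 : R) (1 : R)
    (fun t => integral_Rn ((fun y => p.2 (cinv p.1 y) * f t y) \_ (crange p.1)))
    (integral_Rn ((fun y => p.2 (cinv p.1 y) * df y) \_ (crange p.1))).
Proof.
move=> pP cdf cf fdf; have [B B0 HB] := pou_cc M_hausdorff M_compact pP.
apply: (@integral_Rn_is_derive _ _ B (fun t =>
    (fun y => p.2 (cinv p.1 y) * f t y) \_ (crange p.1))) => //.
- exact: HB.
- by apply: filterS cf => t; apply: HB.
move=> e e0; apply: filterS (fdf e e0) => t Ht y; rewrite !patchE; case: ifP => [|_]; last first.
  by rewrite mulr0 subrr subr0 normr0 mulr_ge0 // ltW.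
rewrite inE => py; have [yK|yK] := pselect (chart_support p y); last first.
  by rewrite (chart_support_out py yK) !mul0r mulr0 subrr subr0 normr0 mulr_ge0 // ltW.
have -> : p.2 (cinv p.1 y) * f t y - p.2 (cinv p.1 y) * f 0 y - t * (p.2 (cinv p.1 y) * df y) =
    p.2 (cinv p.1 y) * (f t y - f 0 y - t * df y) by ring.
rewrite normrM; apply: le_trans (Ht y yK); rewrite ler_piMl //.
by rewrite ger0_norm ?(pou_ge0 M_hausdorff M_compact) // (pou_le1 M_hausdorff M_compact).
Qed.

Lemma pou_integral_dist_le B p (f g : 'rV[R]_d -> R) (e : R) : p \in pou A -> 0 <= B ->
  (forall u : 'rV[R]_d -> R, (forall y, chart_support p y -> {for y, continuous u}) ->
    cc B ((fun y => p.2 (cinv p.1 y) * u y) \_ (crange p.1))) ->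
  0 <= e ->
  (forall y, chart_support p y -> {for y, continuous f}) ->
  (forall y, chart_support p y -> {for y, continuous g}) ->
  (forall y, chart_support p y -> `|f y - g y| <= e) ->
  `|integral_Rn ((fun y => p.2 (cinv p.1 y) * f y) \_ (crange p.1)) -
    integral_Rn ((fun y => p.2 (cinv p.1 y) * g y) \_ (crange p.1))| <= e * (2 * B) ^+ d.
Proof.
move=> pP B0 HB e0 cf cg fg; apply: (integral_Rn_dist_le B0 (HB f cf) (HB g cg)).
move=> y; rewrite !patchE; case: ifP => [|_]; last by rewrite subrr normr0.
rewrite inE => py; rewrite -mulrBr normrM.
have [yK|yK] := pselect (chart_support p y); last first.
  by rewrite (chart_support_out py yK) normr0 mul0r.
rewrite -[leRHS]mul1r; apply: ler_pM => //; last exact: fg.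
by rewrite ger0_norm ?(pou_ge0 M_hausdorff M_compact) // (pou_le1 M_hausdorff M_compact).
Qed.

Lemma KL_deriv_is_derive vs q v : regular q -> regular_dir v ->
  (forall v, v \in vs -> regular_dir v) ->
  is_derive (0 : R) (1 : R) (fun t : R => KL_deriv vs (q + t *: v)) (KL_deriv (v :: vs) q).
Proof.
move=> qr vr vsr; have [cq Uq] := qr.
apply: is_derive_scale; apply: is_derive_bigsum => p pP.
have cK := chart_support_compact M_hausdorff M_compact pP.
have vvsr u : u \in v :: vs -> regular_dir u by rewrite in_cons => /orP[/eqP ->|/vsr].
apply: (@pou_integral_is_derive p (fun t y => multi_derive L
  [seq eval_pair p.1 y v | v <- vs] [::] (eval_pair p.1 y (q + t *: v))) _ pP).
- exact: (multi_derive_continuous pP qr vvsr).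
- apply: filterS (regular_near qr vr) => t qtr.
  exact: (multi_derive_continuous pP qtr vsr).
move=> e e0.
have H := @near_uniform_derivative _ _ _ _ _ KL_dom_open KL_coord_smooth _ cK _ (cq p pP)
  (Uq p pP) _ (fieldmap_cont pP vsr) _ _ (vr p pP) e0.
apply: filterS H => t Ht y yK; have := Ht y yK.
by rewrite fieldmapE -eval_pairD scale0r addr0.
Qed.

Local Notation F := (fun q : fields => KL_Met A q.1 q.2).

(** A derivative at 0 depends on the germ of the function, and q + t v is regular for small t, so
    the induction hypothesis applies along the line. *)
Lemma iter_dderiv_KL vs q : regular q -> (forall v, v \in vs -> regular_dir v) ->
  iter_dderiv vs F q = KL_deriv vs q.
Proof.
elim: vs q => [|v vs IH] q qr vr; first exact: KL_Met_deriv.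
have vreg : regular_dir v by apply: vr; rewrite mem_head.
have vsreg u : u \in vs -> regular_dir u by move=> us; apply: vr; rewrite in_cons us orbT.
rewrite /= derive1E.
rewrite (@near_eq_derive _ _ _ _ (fun t : R => KL_deriv vs (q + t *: v))).
  by have [_ ->] := KL_deriv_is_derive qr vreg vsreg.
have := regular_near qr vreg; apply: filterS => t qtr; exact: IH.
Qed.

Lemma iter_dderiv_KL_derivable vs q v : regular q -> regular_dir v ->
  (forall v, v \in vs -> regular_dir v) ->
  derivable (fun t : R => iter_dderiv vs F (q + t *: v)) 0 1.
Proof.
move=> qr vreg vsreg.
apply: (@near_eq_derivable _ _ _ (fun t : R => KL_deriv vs (q + t *: v))); last first.
  by have [] := KL_deriv_is_derive qr vreg vsreg.
have := regular_near qr vreg; apply: filterS => t qtr; apply/esym.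
exact: iter_dderiv_KL.
Qed.

Lemma KL_deriv_continuous vs q (e : R) : regular q ->
  (forall v, v \in vs -> regular_dir v) -> 0 < e ->
  exists2 r : R, 0 < r & forall ws w, size ws = size vs -> regular w ->
    (forall v, v \in ws -> regular_dir v) ->
    (forall p, p \in pou A -> forall y, chart_support p y ->
      `|eval_pair p.1 y w - eval_pair p.1 y q| <= r /\
      forall k, (k < size vs)%N ->
        `|eval_pair p.1 y (nth 0 ws k) - eval_pair p.1 y (nth 0 vs k)| <= r) ->
    `|KL_deriv ws w - KL_deriv vs q| < e.
Proof.
move=> qr vsr e0; have [cq Uq] := qr; have [B B0 HB] := pou_cc_uniform.
pose C := \sum_(p <- pou A) (2 * B) ^+ d.
have C0 : 0 <= C by apply: sumr_ge0 => p _; rewrite exprn_ge0 // mulr_ge0.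
pose e' := e / (C + 1).
have e'0 : 0 < e' by rewrite divr_gt0 // ltr_wpDl.
have : \forall r \near (0 : R), forall p, p \in pou A -> forall y, chart_support p y ->
    forall (zs : seq 'rV[R]_N) (z : 'rV[R]_N), size zs = size vs ->
    (forall k, (k < size vs)%N ->
       `|nth 0 zs k - eval_pair p.1 y (nth 0 vs k)| <= r) -> `|z - eval_pair p.1 y q| <= r ->
    `|multi_derive L zs [::] z -
      multi_derive L [seq eval_pair p.1 y v | v <- vs] [::] (eval_pair p.1 y q)| <= e'.
  apply: (@near_seq_all _ _ (nbhs_filter (0 : R))) => p pP.
  have cK := chart_support_compact M_hausdorff M_compact pP.
  have := @near_uniform_continuity _ _ _ _ _ KL_coord_smooth _ cK _ (cq p pP)
    (Uq p pP) _ (fieldmap_cont pP vsr) e' e'0.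
  apply: filterS => r H y yK ws w sw kw wq; rewrite -fieldmapE; apply: H => //.
    by rewrite size_map.
  move=> k; rewrite size_map => kv; rewrite fieldmapE (nth_map 0) //; exact: kw.
move=> /nbhs_ballP[r0 /= r00 rH].
have r20 : 0 < r0 / 2 by rewrite divr_gt0.
have {}rH := rH (r0 / 2).
exists (r0 / 2) => // ws w sw wr wsr close.
rewrite /KL_deriv -mulrBr -sumrB normrM gtr0_norm ?invr_gt0 //.
(* The prefactor [2^-1] turns the weak bound by e on the sum of integrals into the strict one
   required. *)
apply: (@le_lt_trans _ _ (2^-1 * (e' * C))); last first.
  have : e' * C <= e by rewrite /e' mulrAC ler_pdivrMr ?ltr_wpDl // ler_pM2l // lerDl.
  by lra.
rewrite ler_pM2l ?invr_gt0 //.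
apply: le_trans (ler_norm_sum _ _ _) _.
rewrite /C mulr_sumr !big_seq; apply: ler_sum => p pP.
apply: (pou_integral_dist_le pP B0 (HB p pP) (ltW e'0)).
- exact: (multi_derive_continuous pP wr wsr).
- exact: (multi_derive_continuous pP qr vsr).
move=> y yK; have [H1 H2] := close p pP y yK.
apply: (rH _ p pP y yK); last exact: H1.
- by rewrite /ball /= sub0r normrN gtr0_norm // ltr_pdivrMr // ltr_pMr // ltr1n.
- by rewrite size_map.
- by move=> k kv; rewrite (nth_map 0) ?sw //; apply: H2.
Qed.

(** The integrand depends on the values of the components and not on their derivatives, so
    neighbourhoods given by order-0 seminorms on the chart supports already control every iterated
    derivative. *)
Lemma KL_smooth_functional : smooth_functional (A := A) (Met A) F.
Proof.
move=> vs q vsS qM.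
have qr := Met_regular qM.
have vsr v : v \in vs -> regular_dir v by move=> /vsS; apply: Sym2_regular_dir.
split=> [v vS|e e0].
  by apply: iter_dderiv_KL_derivable => //; apply: Sym2_regular_dir.
have [r r0 rH] := KL_deriv_continuous qr vsr e0.
(* Several members of the partition may use the same chart, so the compact set for chart i is the
   union of their supports. *)
pose K (i : cidx A) : set 'rV[R]_d := \big[setU/set0]_(p <- pou A | p.1 == i) chart_support p.
have KE p y : p \in pou A -> chart_support p y -> K p.1 y.
  by move=> pP yK; rewrite /K -bigcup_seq_cond; exists p => //=; rewrite pP eqxx.
pose s := [seq p.1 | p <- pou A].
exists (Cinf_small (A := A) 0 s K r).
  exists 0%N, s, K, r; split => // i; split.
    rewrite /K big_seq_cond; apply: bigsetU_compact => p /andP[pP _].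
    exact: chart_support_compact.
  move=> y; rewrite /K -bigcup_seq_cond => -[p /= /andP[pP /eqP <-]].
  exact: chart_support_sub.
move=> ws w sw wsS wM wq wk.
have wr := Met_regular wM.
have wsr v : v \in ws -> regular_dir v by move=> /wsS; apply: Sym2_regular_dir.
rewrite !iter_dderiv_KL //; apply: rH => // p pP y yK.
have small (u u' : fields) : (Cinf_small (A := A) 0 s K r `*` Cinf_small (A := A) 0 s K r) (u - u') ->
    `|eval_pair p.1 y u - eval_pair p.1 y u'| <= r.
  move=> [u1 u2].
  have ps : p.1 \in s by apply: map_f.
  have yKK := KE p y pP yK.
  have E : eval_pair p.1 y (u - u') = eval_pair p.1 y u - eval_pair p.1 y u'.
    by have := eval_pairD p.1 y u u' (-1); rewrite !scaleN1r.
  rewrite -E; apply: enc_norm_le => [|a b|a b]; first exact: ltW.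
    by apply: ltW; apply: (u1 p.1 ps y yKK [::]).
  by apply: ltW; apply: (u2 p.1 ps y yKK [::]).
split; first exact: small.
by move=> k kv; apply: small; apply: wk; rewrite sw.
Qed.

End Functional.

(** * Derivatives of the Kullback-Leibler density *)

Section MatrixCalculus.
Context {R : realType} {n : nat}.
Implicit Types G H K X : 'M[R]_n.

(** Expansion along row i: the determinant is affine in each single entry, with the cofactor as
    slope. This is the entrywise form of Jacobi's formula. *)
Lemma det_add_delta G i j (t : R) :
  \det (G + t *: delta_mx i j) = \det G + t * cofactor G i j.
Proof.
rewrite (expand_det_row _ i) (expand_det_row G i).
have E k : cofactor (G + t *: delta_mx i j) i k = cofactor G i k.
  rewrite /cofactor; congr (_ * \det _); apply/matrixP => a b.
  by rewrite !mxE eq_sym (negbTE (neq_lift _ _)) /= mulr0 addr0.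
under eq_bigr => k _ do rewrite E mxE mulrDl.
rewrite big_split /=; congr (_ + _).
rewrite (bigD1 j) //= big1 => [|k kj]; first by rewrite !mxE !eqxx mulr1 addr0.
by rewrite !mxE (negbTE kj) andbF mulr0 mul0r.
Qed.

(** Gives existence of the derivative in direction K from smoothness in the flattened coordinates,
    and reduces its value to elementary directions, where it can be computed. *)
Lemma mxvec_smooth (f : 'M[R]_n -> R) (U : set 'rV[R]_(n * n)) G K :
  open U -> U (mxvec G) -> smooth_on U (fun z => f (vec_mx z)) ->
  exists2 l, is_derive (0 : R) (1 : R) (fun t : R => f (G + t *: K)) l &
    l = \sum_i \sum_j K i j * 'D_1 (fun t : R => f (G + t *: delta_mx i j)) 0.
Proof.
move=> oU UG fU.
have line X : (fun t : R => f (vec_mx (mxvec G + t *: mxvec X))) = (fun t => f (G + t *: X)).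
  by apply/funext => t; rewrite -linearZ -linearD mxvecK.
have D X := (is_derive_line _ _ _ _).2 (smooth_on_is_derive (mxvec X) oU fU UG).
have DK := D K; rewrite line in DK.
eexists; first exact: DK.
rewrite (reindex _ (curry_mxvec_bij n n)) /= pair_bigA /=.
apply: eq_bigr => -[i j] _ /=; rewrite mxvecE; congr (_ * _).
have Dij := D (delta_mx i j); rewrite line in Dij.
have [_ ->] := Dij; rewrite mxvec_delta (bigD1 (mxvec_index i j)) //=.
rewrite mxE !eqxx mul1r big1 ?addr0 // => a aij.
by rewrite mxE (negbTE aij) andbF mul0r.
Qed.

Lemma vec_mx_smooth (U : set 'rV[R]_(n * n)) i j : open U ->
  smooth_on U (fun z => (vec_mx z : 'M[R]_n) i j).
Proof.
move=> oU; apply: (@smooth_on_ext _ _ _ oU (fun z => z 0 (mxvec_index i j))).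
  by move=> z _; rewrite mxE.
exact: smooth_on_coord oU _.
Qed.

Lemma is_derive_det G K :
  is_derive (0 : R) (1 : R) (fun t : R => \det (G + t *: K)) (\tr (\adj G *m K)).
Proof.
have [|l Dl lE] := @mxvec_smooth (fun X => \det X) setT G K openT I.
  by apply: (smooth_on_det openT) => i j; apply: vec_mx_smooth openT.
suff <- : l = \tr (\adj G *m K) by [].
rewrite lE; under [RHS]eq_bigr => i _ do rewrite mxE.
rewrite exchange_big /=; apply: eq_bigr => j _; apply: eq_bigr => i _.
rewrite [\adj G _ _]mxE mulrC; congr (_ * _); rewrite /=.
have H1 : is_derive (0 : R) (1 : R) (fun t : R => cofactor G i j * t) (cofactor G i j * 1).
  exact: is_derive_scale (is_derive_id _ _).
have H := is_deriveD (is_derive_cst (\det G) (0 : R) (1 : R)) H1.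
have E : cst (\det G) + (fun t : R => cofactor G i j * t) =
    (fun t : R => \det (G + t *: delta_mx i j)).
  by apply/funext => t; rewrite det_add_delta mulrC.
by rewrite E add0r mulr1 in H; have [_ ->] := H.
Qed.

Lemma is_derive_det_unit G K : \det G != 0 ->
  is_derive (0 : R) (1 : R) (fun t : R => \det (G + t *: K)) (\det G * \tr (invmx G *m K)).
Proof.
move=> G0; have := is_derive_det G K; congr is_derive.
have -> : \adj G = \det G *: invmx G.
  by rewrite /invmx unitmxE unitfE G0 scalerA divff // scale1r.
by rewrite -scalemxAl linearZ.
Qed.

Lemma det_near G K : 0 < \det G -> \forall t \near (0 : R), 0 < \det (G + t *: K).
Proof.
move=> G0; have [D _] := is_derive_det G K.
have c : {for 0, continuous (fun t : R => \det (G + t *: K))}.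
  by apply: differentiable_continuous; apply/derivable1_diffP.
by apply: cvgr_gt c _ _; rewrite scale0r addr0.
Qed.

(** Cramer's rule shows that the derivative D of the inverse exists; differentiating the product of
    [G + t *: K] with its inverse gives [K *m invmx G + G *m D = 0], which determines D. *)
Lemma is_derive_invmx G K a b : \det G != 0 ->
  is_derive (0 : R) (1 : R) (fun t : R => invmx (G + t *: K) a b)
    (- (invmx G *m K *m invmx G) a b).
Proof.
move=> G0.
pose U := [set z : 'rV[R]_(n * n) | \det (vec_mx z : 'M[R]_n) != 0].
have oU : open U.
  apply: (@open_comp _ _ (fun z : 'rV[R]_(n * n) => \det (vec_mx z : 'M[R]_n)) [set r | r != 0]).
    move=> z _; apply: (@smooth_on_continuous _ _ setT) => //.
    by apply: (smooth_on_det openT) => i j; apply: vec_mx_smooth openT.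
  exact: open_neq.
have UG : U (mxvec G) by rewrite /U /= mxvecK.
have ex i j : derivable (fun t : R => invmx (G + t *: K) i j) 0 1.
  have [|l [+ _]] := @mxvec_smooth (fun X => invmx X i j) U G K oU UG; last by [].
  by apply: (smooth_on_invmx oU) => // k l; apply: vec_mx_smooth oU.
pose D := \matrix_(i, j) 'D_1 (fun t : R => invmx (G + t *: K) i j) 0.
have Gu : G \in unitmx by rewrite unitmxE unitfE.
suff DE : D = - (invmx G *m K *m invmx G).
  split; first exact: ex.
  by have /matrixP/(_ a b) := DE; rewrite !mxE => ->.
suff E : K *m invmx G + G *m D = 0.
  apply: (can_inj (mulKmx Gu)); rewrite mulmxN -!mulmxA mulKVmx //.
  by apply/eqP; rewrite -addr_eq0 addrC E.
apply/matrixP => i j; rewrite [RHS]mxE.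
have dX k : is_derive (0 : R) (1 : R) ((fun t : R => (G + t *: K) i k) *
    (fun t : R => invmx (G + t *: K) k j)) (G i k * D k j + invmx G k j * K i k).
  have d1 : is_derive (0 : R) (1 : R) (fun t : R => (G + t *: K) i k) (K i k).
    have -> : (fun t : R => (G + t *: K) i k) = cst (G i k) + (fun t : R => K i k * t).
      by apply/funext => t; rewrite !mxE mulrC.
    have H : is_derive (0 : R) (1 : R) (fun t : R => K i k * t) (K i k * 1).
      exact: is_derive_scale (is_derive_id _ _).
    by apply: (is_derive_eq (is_deriveD (is_derive_cst (G i k) (0 : R) (1 : R)) H)); rewrite add0r mulr1.
  have d2 : is_derive (0 : R) (1 : R) (fun t : R => invmx (G + t *: K) k j) (D k j).
    by rewrite mxE; apply: derivableP; apply: ex.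
  by apply: (is_derive_eq (is_deriveM d1 d2)); rewrite scale0r addr0.
have S : is_derive (0 : R) (1 : R)
    (fun t : R => \sum_k (G + t *: K) i k * invmx (G + t *: K) k j)
    (\sum_k (G i k * D k j + invmx G k j * K i k)).
  by apply: is_derive_bigsum => k _; apply: dX.
(* Near t = 0 the matrix stays invertible and the product is the constant identity, so the sum of
   derivatives is that of a constant. *)
have : is_derive (0 : R) (1 : R) (cst ((1%:M : 'M[R]_n) i j))
    (\sum_k (G i k * D k j + invmx G k j * K i k)).
  apply: near_eq_is_derive S.
  have [dD _] := is_derive_det G K.
  have c : {for 0, continuous (fun t : R => \det (G + t *: K))}.
    by apply: differentiable_continuous; apply/derivable1_diffP.
  have nz : \forall t \near (0 : R), \det (G + t *: K) != 0.
    by apply: cvgr_neq0 c _; rewrite scale0r addr0.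
  apply: filterS nz => t tu.
  have tu' : G + t *: K \in unitmx by rewrite unitmxE unitfE.
  by rewrite -(mulmxV tu') mxE.
move=> [_]; rewrite derive_cst => S0.
rewrite [LHS]mxE [X in X + _]mxE [X in _ + X]mxE -big_split /=.
by apply: etrans (esym S0); apply: eq_bigr => k _; rewrite addrC [K i k * _]mulrC.
Qed.

Lemma is_derive_trace_mul (F : R -> 'M[R]_n) (DF : 'M[R]_n) X :
  (forall a b, is_derive (0 : R) (1 : R) (fun t => F t a b) (DF a b)) ->
  is_derive (0 : R) (1 : R) (fun t => \tr (F t *m X)) (\tr (DF *m X)).
Proof.
move=> dF; rewrite /mxtrace; apply: is_derive_bigsum => i _; rewrite mxE.
rewrite (_ : (fun t => _) = (fun t => \sum_j X j i * F t i j)); last first.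
  by apply/funext => t; rewrite mxE; apply: eq_bigr => j _; rewrite mulrC.
rewrite (_ : \sum_j _ = \sum_j X j i * DF i j); last by apply: eq_bigr => j _; rewrite mulrC.
by apply: is_derive_bigsum => j _; apply: is_derive_scale.
Qed.

End MatrixCalculus.

Section DensityDerivatives.
Context {R : realType} {d : nat}.
Implicit Types G H K X : 'M[R]_d.

Lemma ln_sqrt (x : R) : 0 < x -> ln (Num.sqrt x) = 2^-1 * ln x.
Proof. by move=> x0; rewrite -powR12_sqrt ?ltW // ln_powR. Qed.

(** Writes the volume factor as an exponential of the log-determinant, so that the trace and
    [ln (\det _)] are the only matrix functions left to differentiate. *)
Lemma KL_densityE X G : 0 < \det X -> 0 < \det G ->
  KL_density X G = (\tr (invmx G *m X) - (ln (\det X) - ln (\det G)) - d%:R)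
    * expR (2^-1 * ln (\det G)).
Proof.
move=> X0 G0; rewrite /KL_density -{2}[Num.sqrt (\det G)]lnK ?posrE ?sqrtr_gt0 //.
rewrite ln_div ?posrE ?sqrtr_gt0 // !ln_sqrt //; congr (_ * _).
by field.
Qed.

(** The derivative in the second argument, by the product rule: the first summand differentiates the
    volume factor, the second the bracket. *)
Definition KL_density_deriv1 X G K : R :=
  ((\tr (invmx G *m X) - (ln (\det X) - ln (\det G)) - d%:R) * (2^-1 * \tr (invmx G *m K))
   + (\tr (invmx G *m K) - \tr (invmx G *m K *m invmx G *m X))) * expR (2^-1 * ln (\det G)).

Lemma is_derive_ln_det G K : 0 < \det G ->
  is_derive (0 : R) (1 : R) (fun t : R => ln (\det (G + t *: K))) (\tr (invmx G *m K)).
Proof.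
move=> G0; have Gn0 : \det G != 0 by rewrite gt_eqF.
have D := is_derive_det_unit K Gn0.
have Dl : is_derive (\det (G + 0 *: K)) (1 : R) (@ln R) (\det G)^-1.
  by rewrite scale0r addr0; apply: is_derive1_ln.
have := is_derive1_comp Dl D; congr is_derive.
by rewrite mulrA mulVf // mul1r.
Qed.

Lemma is_derive_KL_density_r X G K : 0 < \det X -> 0 < \det G ->
  is_derive (0 : R) (1 : R) (fun t : R => KL_density X (G + t *: K)) (KL_density_deriv1 X G K).
Proof.
move=> X0 G0; have Gn0 : \det G != 0 by rewrite gt_eqF.
pose f1 (t : R) := \tr (invmx (G + t *: K) *m X).
pose f2 (t : R) := ln (\det (G + t *: K)).
pose f3 (t : R) := expR (2^-1 * f2 t).
have D1 : is_derive (0 : R) (1 : R) f1 (\tr (- (invmx G *m K *m invmx G) *m X)).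
  apply: is_derive_trace_mul => a b.
  by apply: (is_derive_eq (is_derive_invmx K a b Gn0)); rewrite [RHS]mxE.
have D2 : is_derive (0 : R) (1 : R) f2 (\tr (invmx G *m K)) by exact: is_derive_ln_det.
have D3 : is_derive (0 : R) (1 : R) f3 (f3 0 * (2^-1 * \tr (invmx G *m K))).
  exact: (@is_derive1_comp R expR (fun t => 2^-1 * f2 t) 0 _ _ (is_derive_expR _)
    (is_derive_scale 2^-1 D2)).
have Dc := is_derive_cst (- ln (\det X) - d%:R) (0 : R) (1 : R).
have D := is_deriveM (is_deriveD (is_deriveD D1 D2) Dc) D3.
have E : \forall t \near (0 : R),
    ((f1 + f2 + cst (- ln (\det X) - d%:R)) * f3) t = KL_density X (G + t *: K).
  apply: filterS (det_near K G0) => t Gt.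
  rewrite KL_densityE //.
  have ar (a b c e w : R) : (a + b + (- c - e)) * w = (a - (c - b) - e) * w by ring.
  exact: ar.
apply: (is_derive_eq (near_eq_is_derive E D)).
rewrite [(f1 + f2 + _) 0]/(f1 0 + f2 0 + (- ln (\det X) - d%:R)).
rewrite /KL_density_deriv1 /f3 /f1 /f2 /= !scale0r !addr0 mulNmx linearN /=.
have ar (a b c e u v w : R) : (a + b + (- c - e)) * (w * (2^-1 * u)) + w * (- v + u) =
    ((a - (c - b) - e) * (2^-1 * u) + (u - v)) * w by ring.
exact: ar.
Qed.

Lemma is_derive_trace_affine X G H :
  is_derive (0 : R) (1 : R) (fun s : R => \tr (X *m (G + s *: H))) (\tr (X *m H)).
Proof.
have -> : (fun s : R => \tr (X *m (G + s *: H))) =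
    cst (\tr (X *m G)) + (fun s : R => \tr (X *m H) * s).
  apply/funext => s; rewrite mulmxDr linearD /= -scalemxAr linearZ /=.
  by rewrite [RHS]/(_ + _) /= [X in _ = _ + X]mulrC.
have H1 : is_derive (0 : R) (1 : R) (fun s : R => \tr (X *m H) * s) (\tr (X *m H) * 1).
  exact: is_derive_scale (is_derive_id _ _).
have := is_deriveD (is_derive_cst (\tr (X *m G)) (0 : R) (1 : R)) H1.
by rewrite add0r mulr1.
Qed.

(** On the diagonal the trace and the log-determinant have the same derivative,
    [\tr (invmx G *m H)], and enter with opposite signs. *)
Lemma is_derive_KL_density_l G H : 0 < \det G ->
  is_derive (0 : R) (1 : R) (fun s : R => KL_density (G + s *: H) G) 0.
Proof.
move=> G0; have Gn0 : \det G != 0 by rewrite gt_eqF.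
have D1 := is_derive_trace_affine (invmx G) G H.
have D2 := is_derive_ln_det H G0.
have D := is_deriveM (is_deriveD (is_deriveB D1 D2)
  (is_derive_cst (ln (\det G) - d%:R) (0 : R) (1 : R)))
  (is_derive_cst (expR (2^-1 * ln (\det G))) (0 : R) (1 : R)).
apply: (is_derive_eq (near_eq_is_derive _ D)); last by rewrite subrr addr0 !scaler0 addr0.
apply: filterS (det_near H G0) => t Gt.
rewrite KL_densityE //.
have ar (a b c e w : R) : (a - b + (c - e)) * w = (a - (b - c) - e) * w by ring.
exact: ar.
Qed.

Lemma KL_density_deriv1_diag G K : 0 < \det G -> KL_density_deriv1 G G K = 0.
Proof.
move=> G0; have Gu : G \in unitmx by rewrite unitmxE unitfE gt_eqF.
rewrite /KL_density_deriv1 mulVmx // mulmxKV // mxtrace1 subrr subr0 subrr.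
by rewrite !mul0r add0r subrr mul0r.
Qed.

(** By that same cancellation the bracket has derivative 0, the term [\tr (invmx G *m K)] is
    constant in s, and only the double trace remains. *)
Lemma is_derive_KL_density_deriv1 G H K : 0 < \det G ->
  is_derive (0 : R) (1 : R) (fun s : R => KL_density_deriv1 (G + s *: H) G K)
    (- (\tr (invmx G *m H *m invmx G *m K) * Num.sqrt (\det G))).
Proof.
move=> G0; have Gn0 : \det G != 0 by rewrite gt_eqF.
have D1 := is_derive_trace_affine (invmx G) G H.
have D2 := is_derive_ln_det H G0.
have D3 := is_derive_trace_affine (invmx G *m K *m invmx G) G H.
have Dc (c : R) := is_derive_cst c (0 : R) (1 : R).
have D := is_deriveM (is_deriveB (is_deriveD (is_deriveM (is_deriveD (is_deriveB D1 D2)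
  (Dc (ln (\det G) - d%:R))) (Dc (2^-1 * \tr (invmx G *m K)))) (Dc (\tr (invmx G *m K)))) D3)
  (Dc (expR (2^-1 * ln (\det G)))).
apply: (is_derive_eq (near_eq_is_derive _ D)).
  apply: filterS (det_near H G0) => t Gt.
  have ar (a b c e u v w z : R) : ((a - b + (c - e)) * u + v - w) * z =
    ((a - (b - c) - e) * u + (v - w)) * z by ring.
  exact: ar.
rewrite subrr !addr0 !scaler0 !addr0 !add0r.
have -> : \tr (invmx G *m H *m invmx G *m K) = \tr (invmx G *m K *m invmx G *m H).
  by rewrite -mulmxA mxtrace_mulC mulmxA.
rewrite -[Num.sqrt _]lnK ?posrE ?sqrtr_gt0 // ln_sqrt //.
have ar (v w : R) : w * - v = - (v * w) by ring.
exact: ar.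
Qed.

(** The abstract expansion and the explicit formula are both derivatives of the same function of t,
    hence equal. It is stated off the diagonal because X is differentiated afterwards. *)
Lemma multi_derive_KL_r X G K : 0 < \det X -> 0 < \det G ->
  multi_derive (@KL_coord R d) [:: enc (0, K)] [::] (enc (X, G)) = KL_density_deriv1 X G K.
Proof.
move=> X0 G0.
have UXG : KL_dom (enc (X, G)) by rewrite /KL_dom /= enc0K enc1K.
have := (is_derive_line _ _ _ _).2
  (multi_derive_is_derive KL_dom_open KL_coord_smooth [::] [::] (enc (0, K)) UXG).
have -> : (fun t : R => multi_derive (@KL_coord R d) [::] [::] (enc (X, G) + t *: enc (0, K))) =
    (fun t : R => KL_density X (G + t *: K)).
  apply/funext => t /=; rewrite -encD /KL_coord enc0K enc1K /=.
  by rewrite scaler0 addr0.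
by move=> [_ HE]; have [_ E] := is_derive_KL_density_r K X0 G0; exact: etrans (esym HE) E.
Qed.

Lemma multi_derive_KL_l G H : 0 < \det G ->
  multi_derive (@KL_coord R d) [:: enc (H, 0)] [::] (enc (G, G)) = 0.
Proof.
move=> G0.
have UG : KL_dom (enc (G, G)) by rewrite /KL_dom /= enc0K enc1K.
have := (is_derive_line _ _ _ _).2
  (multi_derive_is_derive KL_dom_open KL_coord_smooth [::] [::] (enc (H, 0)) UG).
have -> : (fun t : R => multi_derive (@KL_coord R d) [::] [::] (enc (G, G) + t *: enc (H, 0))) =
    (fun t : R => KL_density (G + t *: H) G).
  apply/funext => t /=; rewrite -encD /KL_coord enc0K enc1K /=.
  by rewrite scaler0 addr0.
by move=> [_ HE]; have [_ E] := is_derive_KL_density_l H G0; exact: etrans (esym HE) E.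
Qed.

Lemma multi_derive_KL_lr G H K : 0 < \det G ->
  multi_derive (@KL_coord R d) [:: enc (H, 0); enc (0, K)] [::] (enc (G, G)) =
  - (\tr (invmx G *m H *m invmx G *m K) * Num.sqrt (\det G)).
Proof.
move=> G0.
have UG : KL_dom (enc (G, G)) by rewrite /KL_dom /= enc0K enc1K.
have := (is_derive_line _ _ _ _).2
  (multi_derive_is_derive KL_dom_open KL_coord_smooth [:: enc (0, K)] [::] (enc (H, 0)) UG).
move=> [_ HE]; have [_ E] := is_derive_KL_density_deriv1 H K G0.
(* The explicit first derivative is available at [G + s *: H] while its determinant is positive,
   that is for s near 0. *)
apply: etrans (esym HE) (etrans (near_eq_derive _ _) E).
apply: filterS (det_near H G0) => s Gs.
by rewrite -encD /= scaler0 addr0; apply: multi_derive_KL_r.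
Qed.

End DensityDerivatives.

(** * The divergence on metrics *)

Section PairDirections.
Context {R : pzRingType} {V : lmodType R}.
Implicit Types (a b c e : V) (s t : R).

Lemma pair_dir_l a b c t : (a, b) + t *: (c, 0) = (a + t *: c, b).
Proof. by congr (_, _); rewrite /= scaler0 addr0. Qed.

Lemma pair_dir_r a b e t : (a, b) + t *: (0, e) = (a, b + t *: e).
Proof. by congr (_, _); rewrite /= scaler0 addr0. Qed.

End PairDirections.

Section KLDivergence.
Context {R : realType} {M : topologicalType} {d : nat}.
Variable A : smooth_atlas R M d.
Hypotheses (M_hausdorff : hausdorff_space M) (M_compact : compact [set: M]).
Local Notation cdom := (cdom A).
Local Notation cmap := (cmap A).
Local Notation cinv := (cinv A).
Implicit Types (i j : cidx A) (x : M) (y : 'rV[R]_d) (g h k : tensor_field A).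

Definition KL_field g0 g1 : density_field A := fun i x => KL_density (g0 i x) (g1 i x).

Lemma KL_MetE g0 g1 : KL_Met A g0 g1 = 2^-1 * integral_dens (KL_field g0 g1).
Proof. by []. Qed.

Lemma KL_field_continuous g0 g1 : Met A g0 -> Met A g1 ->
  chart_continuous (KL_field g0 g1).
Proof.
move=> g0M g1M i y iy; have [yi _] := crangeP iy.
have -> : (fun z => KL_field g0 g1 i (cinv i z)) =
    @KL_coord R d \o (fun z => enc (g0 i (cinv i z), g1 i (cinv i z))).
  by apply/funext => z; rewrite /KL_coord /= enc0K enc1K.
apply: continuous_comp.
  apply: (@enc_cvg _ _ _ _ (nbhs_filter y)) => a b.
    by apply: (smooth_on_continuous _ iy); apply: Sym2_smooth g0M.1.
  by apply: (smooth_on_continuous _ iy); apply: Sym2_smooth g1M.1.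
apply: (smooth_on_continuous KL_coord_smooth).
by rewrite /KL_dom /= enc0K enc1K; split; apply: Met_det_gt0 yi.
Qed.

Lemma KL_field_ge0 g0 g1 i x : Met A g0 -> Met A g1 -> cdom i x -> 0 <= KL_field g0 g1 i x.
Proof.
move=> g0M g1M xi; rewrite /KL_field KL_densityE; try exact: Met_det_gt0 xi.
apply: mulr_ge0 (expR_ge0 _).
have := relative_trace_ge (Met_posdef g0M xi) (Met_posdef g1M xi) ltr01.
by rewrite ln1 mulr0 divr1; lra.
Qed.

Lemma KL_Met_ge0 g0 g1 : Met A g0 -> Met A g1 -> 0 <= KL_Met A g0 g1.
Proof.
move=> g0M g1M; rewrite KL_MetE mulr_ge0 ?invr_ge0 //.
apply: integral_dens_ge0 => //; first exact: KL_field_continuous.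
by move=> i x; apply: KL_field_ge0.
Qed.

Lemma KL_field_diag g i x : Met A g -> cdom i x -> KL_field g g i x = 0.
Proof.
move=> gM xi; have G0 := Met_det_gt0 gM xi.
rewrite /KL_field KL_densityE // mulVmx ?mxtrace1 ?subrr ?subr0 ?subrr ?mul0r //.
by rewrite unitmxE unitfE gt_eqF.
Qed.

(** A zero integral gives equality of the metrics at x in the chart of some p with [p.2 x != 0]; the
    transformation law carries it to the other charts at x, and outside the chart domains both
    fields are 0. *)
Lemma KL_Met_eq0 g0 g1 : Met A g0 -> Met A g1 -> KL_Met A g0 g1 = 0 <-> g0 = g1.
Proof.
move=> g0M g1M; split=> [|<-]; last first.
  (* Homogeneity with factor 0 shows that a field vanishing in every chart has integral 0. *)
  have := integral_densZ M_hausdorff M_compact 0 (KL_field_continuous g0M g0M).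
  rewrite mul0r KL_MetE => E; rewrite (eq_integral_dens _ (rho' := fun i x => 0 * KL_field g0 g0 i x)).
    by rewrite E mulr0.
  by move=> i x xi; rewrite KL_field_diag // mul0r.
rewrite KL_MetE => /eqP; rewrite mulf_eq0 invr_eq0 pnatr_eq0 /= => /eqP I0.
have K0 := integral_dens_eq0 M_hausdorff M_compact (KL_field_continuous g0M g1M)
  (fun i x => KL_field_ge0 g0M g1M) I0.
apply/funext => i; apply/funext => x.
have [[_ t0 _ z0] _] := g0M; have [[_ t1 _ z1] _] := g1M.
have [xi|xi] := pselect (cdom i x); last by rewrite z0 ?z1.
have [p pP px] := pou_neq0 A M_hausdorff M_compact x.
have xp := pou_support M_hausdorff M_compact pP px.
suff E : g0 p.1 x = g1 p.1 x.
  by apply: etrans (t0 i p.1 x xi xp) (esym _); apply: etrans (t1 i p.1 x xi xp) _; rewrite E.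
apply: relative_trace_eq; [exact: Met_posdef xp|exact: Met_posdef xp|].
have /eqP := K0 p x pP px; rewrite /KL_field KL_densityE; try exact: Met_det_gt0 xp.
by rewrite mulf_eq0 expR_eq0 orbF => /eqP; lra.
Qed.

Lemma Sym2_0 : Sym2 A (0 : tensor_field A).
Proof.
split=> //.
- by move=> i x _; rewrite trmx0.
- by move=> i j x _ _; rewrite mulmx0 mul0mx.
- move=> i a b; apply: (@smooth_on_ext _ _ _ (@open_crange _ _ _ A i) (fun=> 0)).
    by move=> y _; rewrite mxE.
  exact: smooth_on_cst (@open_crange _ _ _ A i) _.
Qed.

Lemma integral_Rn_0 n : integral_Rn (fun _ : 'rV[R]_n => 0) = 0.
Proof.
have [_ iZ _ _ _] := @integral_Rn_spec R n 0 (lexx _).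
apply: etrans (etrans (iZ (fun=> 0) 0 _) (mul0r _)).
  by congr integral_Rn; apply/funext => y; rewrite mul0r.
by split=> // y; apply: cst_continuous.
Qed.

Lemma KL_deriv_eq0 vs (q : tensor_field A * tensor_field A) :
  (forall i y, crange i y ->
     multi_derive (@KL_coord R d) [seq eval_pair i y v | v <- vs] [::] (eval_pair i y q) = 0) ->
  KL_deriv vs q = 0.
Proof.
move=> H; rewrite /KL_deriv big1 ?mulr0 // => p _.
rewrite -[RHS](integral_Rn_0 d); congr integral_Rn; apply/funext => y; rewrite patchE.
by case: ifP => //; rewrite inE => py; rewrite H // mulr0.
Qed.

Lemma KL_Met_is_derive0 g h : Met A g -> Sym2 A h ->
  is_derive (0 : R) (1 : R) (fun t : R => KL_Met A (g + t *: h) g) 0 /\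
  is_derive (0 : R) (1 : R) (fun t : R => KL_Met A g (g + t *: h)) 0.
Proof.
move=> gM hS; have gr : regular (g, g) by apply: (Met_regular M_hausdorff M_compact).
have hl : regular_dir (h, (0 : tensor_field A)).
  by apply: (Sym2_regular_dir M_hausdorff M_compact); split => //; apply: Sym2_0.
have hr : regular_dir ((0 : tensor_field A), h).
  by apply: (Sym2_regular_dir M_hausdorff M_compact); split => //; apply: Sym2_0.
have noD : forall v : tensor_field A * tensor_field A, v \in [::] -> regular_dir v.
  by move=> v; rewrite in_nil => H; discriminate H.
split.
- have D := KL_deriv_is_derive M_hausdorff M_compact gr hl noD.
  rewrite KL_deriv_eq0 in D => [|i y /crangeP[yi _]]; last first.
    exact: (multi_derive_KL_l (h i (cinv i y)) (Met_det_gt0 gM yi)).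
  suff -> : (fun t : R => KL_Met A (g + t *: h) g) =
    (fun t : R => KL_deriv [::] ((g, g) + t *: (h, (0 : tensor_field A)))) by [].
  by apply/funext => t; rewrite -KL_Met_deriv (pair_dir_l g g h t).
- have D := KL_deriv_is_derive M_hausdorff M_compact gr hr noD.
  rewrite KL_deriv_eq0 in D => [|i y /crangeP[yi _]]; last first.
    have G0 := Met_det_gt0 gM yi.
    apply: etrans (multi_derive_KL_r (h i (cinv i y)) G0 G0) _.
    exact: KL_density_deriv1_diag.
  suff -> : (fun t : R => KL_Met A g (g + t *: h)) =
    (fun t : R => KL_deriv [::] ((g, g) + t *: ((0 : tensor_field A), h))) by [].
  by apply/funext => t; rewrite -KL_Met_deriv (pair_dir_r g g h t).
Qed.

Lemma KL_divergence_function : divergence_function (Met A) (KL_Met A).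
Proof.
split.
- exact: KL_smooth_functional.
- exact: KL_Met_ge0.
- exact: KL_Met_eq0.
- exact: KL_Met_is_derive0.
Qed.

Lemma induced_metric_ebin g h k : Met A g -> Sym2 A h -> Sym2 A k ->
  induced_metric (KL_Met A) g h k = 2^-1 * ebin_metric g h k.
Proof.
move=> gM hS kS; have gr : regular (g, g) by apply: (Met_regular M_hausdorff M_compact).
pose v : tensor_field A * tensor_field A := (h, 0).
pose w : tensor_field A * tensor_field A := (0, k).
have dirs u : u \in [:: v; w] -> regular_dir u.
  rewrite !inE => /orP[] /eqP ->; apply: (Sym2_regular_dir M_hausdorff M_compact); split => //;
    exact: Sym2_0.
have -> : induced_metric (KL_Met A) g h k =
    - iter_dderiv [:: v; w] (fun q => KL_Met A q.1 q.2) (g, g).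
  (* The head of the list is differentiated last: [v] is the outer direction, with parameter s, and
     [w] the inner one, with parameter t. *)
  have E : (fun s => derive1 (fun t : R => KL_Met A (g + s *: h) (g + t *: k)) 0) =
      (fun s : R => iter_dderiv [:: w] (fun q => KL_Met A q.1 q.2) ((g, g) + s *: v)).
    apply/funext => s; rewrite (pair_dir_l g g h s).
    have {}E : (fun t : R => KL_Met A (g + s *: h) (g + t *: k)) =
        (fun t : R => (fun q => KL_Met A q.1 q.2) ((g + s *: h, g) + t *: w)).
      by apply/funext => t; rewrite (pair_dir_r (g + s *: h) g k t).
    by rewrite E.
  by rewrite /induced_metric E.
rewrite (iter_dderiv_KL M_hausdorff M_compact gr dirs).
pose e : density_field A := fun i x =>
  \tr (invmx (g i x) *m h i x *m invmx (g i x) *m k i x) * vol g i x.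
have ce : chart_continuous e.
  move=> i y iy; have oi := @open_crange _ _ _ A i.
  have gs := fun a b => Sym2_smooth (i := i) a b gM.1.
  have dpos z : crange i z -> 0 < \det (g i (cinv i z)).
    by move=> /crangeP[zi _]; apply: Met_det_gt0.
  have ginv : forall a b, smooth_on (crange i) (fun z => invmx (g i (cinv i z)) a b).
    by apply: (smooth_on_invmx oi) => // z /dpos; apply: lt0r_neq0.
  suff es : smooth_on (crange i) (fun z => e i (cinv i z)) by exact: smooth_on_continuous es iy.
  apply: (smooth_onM oi); last by apply: (smooth_on_sqrt oi) => //; apply: (smooth_on_det oi).
  apply: (smooth_on_sum oi) => a _.
  apply: (smooth_on_mulmx oi (F := fun z => _ *m _ *m _)) => [b c|b c]; last exact: Sym2_smooth.
  apply: (smooth_on_mulmx oi (F := fun z => _ *m _)) => [b' c'|b' c']; last exact: ginv.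
  by apply: (smooth_on_mulmx oi) => [b'' c''|b'' c'']; [apply: ginv|apply: Sym2_smooth].
(* The minus sign of the mixed derivative sits inside the integral; taking it out uses homogeneity,
   for which [e] was shown continuous in charts. *)
have -> : ebin_metric g h k = - integral_dens (fun i x => -1 * e i x).
  by rewrite (integral_densZ M_hausdorff M_compact) // mulN1r opprK.
rewrite mulrN; congr (- (_ * _)); apply: eq_bigr => p _; congr integral_Rn.
apply/funext => y; rewrite !patchE; case: ifP => //; rewrite inE => /crangeP[yp _].
congr (_ * _); rewrite mulN1r.
exact: (multi_derive_KL_lr (h p.1 (cinv p.1 y)) (k p.1 (cinv p.1 y)) (Met_det_gt0 gM yp)).
Qed.

(** * Descent to densities *)

Section Descent.
Hypothesis d_gt0 : (0 < d)%N.
Variables rho0 rho1 : density_field A.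
Hypotheses (D0 : Dens A rho0) (D1 : Dens A rho1).

Let r i x := rho0 i x / rho1 i x.

Let r_gt0 i x : cdom i x -> 0 < r i x.
Proof. by move=> xi; rewrite divr_gt0 //; [case: D0|case: D1] => + _ _ _; apply. Qed.

Let dR : d%:R != 0 :> R.
Proof. by rewrite pnatr_eq0 -lt0n. Qed.

Lemma conformal_trace g i x : Met A g -> vol g = rho1 -> cdom i x ->
  \tr (invmx (g i x) *m conformal rho0 g i x) = d%:R * r i x `^ (2 / d%:R).
Proof.
move=> gM gv xi; rewrite /conformal gv -scalemxAr mulVmx.
  by rewrite linearZ /= mxtrace1 mulrC.
by rewrite unitmxE unitfE gt_eqF // Met_det_gt0.
Qed.

(** With c = r^(2/d) the term [d%:R * ln c] equals 2 ln r, which is exactly the difference of the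
    log-determinants, so the general bound collapses to d <= tr / c. *)
Lemma trace_ge_vol_ratio g0 g1 i x : Met A g0 -> Met A g1 -> vol g0 = rho0 -> vol g1 = rho1 ->
  cdom i x -> d%:R * r i x `^ (2 / d%:R) <= \tr (invmx (g1 i x) *m g0 i x).
Proof.
move=> g0M g1M v0 v1 xi; have rx := r_gt0 xi.
have c0 : 0 < r i x `^ (2 / d%:R) by rewrite powR_gt0.
have := relative_trace_ge (Met_posdef g0M xi) (Met_posdef g1M xi) c0.
have s0 := Met_det_gt0 g0M xi; have s1 := Met_det_gt0 g1M xi.
have -> : ln (\det (g0 i x)) - ln (\det (g1 i x)) = 2 * ln (r i x).
  rewrite /r -v0 -v1 /vol ln_div ?posrE ?sqrtr_gt0 // !ln_sqrt //.
  by field.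
have -> : d%:R * ln (r i x `^ (2 / d%:R)) = 2 * ln (r i x).
  by rewrite ln_powR mulrA mulrCA (divff dR) mulr1.
by rewrite addrK ler_pdivlMr.
Qed.

Lemma KL_Dens_f_divergence : KL_Dens rho0 rho1 = (f_divergence (f_KL d) rho0 rho1)%:E.
Proof.
have [g gM] := Met_nonempty A M_hausdorff M_compact.
(* [g0] is rescaled from [g1] rather than from [g]: then [invmx g1 *m g0] is a scalar matrix in each
   chart and the trace bound is attained at every point. *)
pose g1 := conformal rho1 g; pose g0 := conformal rho0 g1.
have g1M : Met A g1 by apply: conformal_Met.
have v1 : vol g1 = rho1 by apply: conformal_vol.
have g0M : Met A g0 by apply: conformal_Met.
have v0 : vol g0 = rho0 by apply: conformal_vol.
have E : KL_Met A g0 g1 = f_divergence (f_KL d) rho0 rho1.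
  rewrite KL_MetE -(integral_densZ M_hausdorff M_compact); last exact: KL_field_continuous.
  apply: eq_integral_dens => i x xi; rewrite /KL_field /KL_density.
  rewrite conformal_trace // -/(vol g0 i x) -/(vol g1 i x) v0 v1 /f_KL -/(r i x).
  by rewrite mulrA.
apply/eqP; rewrite eq_le; apply/andP; split.
  by apply: ereal_inf_lbound; exists (g0, g1) => //=; rewrite E.
apply: le_ereal_inf_tmp => _ [[h0 h1] [/= h0M h1M w0 w1] <-].
rewrite -E lee_fin !KL_MetE ler_pM2l ?invr_gt0 //.
apply: (le_integral_dens M_hausdorff M_compact); try exact: KL_field_continuous.
move=> i x xi; rewrite /KL_field /KL_density.
rewrite conformal_trace // -/(vol g0 i x) -/(vol g1 i x) -/(vol h0 i x) -/(vol h1 i x).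
rewrite v0 v1 w0 w1 ler_wpM2r //; first by have [+ _ _ _] := D1 => /(_ i x xi)/ltW.
by rewrite !lerD2r; apply: trace_ge_vol_ratio.
Qed.

Lemma f_divergence_dim2 : d = 2%N ->
  f_divergence (f_KL d) rho0 rho1 = f_divergence (fun s : R => s - ln s - 1) rho0 rho1.
Proof.
move=> d2; apply: eq_integral_dens => i x xi; congr (_ * _).
have dE : d%:R = 2 :> R by rewrite d2.
rewrite /f_KL dE divff ?pnatr_eq0 // powRr1; last exact: ltW (r_gt0 xi).
have ar (a b : R) : 2^-1 * (2 * a - 2 * b - 2) = a - b - 1 by field.
exact: ar.
Qed.

End Descent.

End KLDivergence.

Theorem theorem6p2 (R : realType) (M : topologicalType) (d : nat)
  (A : smooth_atlas R M d)
  (M_hausdorff : hausdorff_space M) (M_compact : compact [set: M]) :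
  [/\ divergence_function (Met A) (KL_Met A),
      (forall g h k : tensor_field A, Met A g -> Sym2 A h -> Sym2 A k ->
         induced_metric (KL_Met A) g h k = 2^-1 * ebin_metric g h k) &
      ((0 < d)%N ->
         (forall g : tensor_field A, Met A g -> Dens A (vol g)) /\
         forall rho0 rho1 : density_field A, Dens A rho0 -> Dens A rho1 ->
           KL_Dens rho0 rho1 = (f_divergence (f_KL d) rho0 rho1)%:E /\
           (d = 2%N ->
              KL_Dens rho0 rho1 =
                (f_divergence (fun r : R => r - ln r - 1) rho0 rho1)%:E))].
Proof.
split.
- exact: KL_divergence_function.
- exact: induced_metric_ebin.
- move=> d0; split=> [g|rho0 rho1 D0 D1]; first exact: vol_Dens.
  have E := KL_Dens_f_divergence M_hausdorff M_compact d0 D0 D1.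
  by split=> // d2; rewrite E f_divergence_dim2.
Qed.
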